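(* Let $\{\ell_n\}_{n\ge1}$ be a decreasing sequence of positive numbers tending to $0$ such that there are constants $0<M_0\le M_1<\infty$ with $M_0/n\le \ell_n\le M_1/n$ for every $n$. Consider the Poisson circle covering model with parameter $\alpha=0$ and lengths $\{\ell_n\}$, with associated random sets $F_t\subseteq C$, and let $u_n=\prod_{k=1}^n(1-\ell_k)$. (i) If $\ell_1\le1/2$ and $\liminf_n n(\log n)u_n<\infty$, then $P(\exists t\in[0,1]:F_t\ne\varnothing)=0$. (ii) If $$\sum_{n=2}^\infty\frac{e^{\ell_1+\ell_2+\cdots+\ell_n}}{n^2\log n}<\infty,$$ then $P(\exists t\in[0,1]:F_t\neq\varnothing)=1$.
   Context: $C$ is the circle of circumference $1$. Poisson model with parameter $\alpha=0$: let $\{C_{i,j}\}_{i,j\ge1}$ and $\{Y_{i,j}\}_{i,j\ge1}$ be mutually independent random variables, with $C_{i,j}$ uniformly distributed on $C$ and $Y_{i,j}$ exponentially distributed with rate parameter $\ell_i^{-\alpha}=1$. Let $T_{i,0}:=0$ and $T_{i,j}:=\sum_{k=1}^jY_{i,k}$ for $j\ge1$, and let $U_{i,t}:=C_{i,j}$ for $t\in[T_{i,j-1},T_{i,j})$; that is, the center of each arc is resampled uniformly at the times of an independent rate $1$ Poisson process. For each $n$ and $t\ge 0$, $I_{n,t}$ is the open arc of $C$ with center $U_{n,t}$ and length $\ell_n$ (an arc of length greater than $1$ is all of $C$). Put $E_t:=\limsup_n I_{n,t}$ (the set of points belonging to $I_{n,t}$ for infinitely many $n$) and $F_t:=C\setminus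 E_t$. *)

(* Defs.v *)
From HB Require Import structures.
From mathcomp Require Import all_boot all_order all_algebra.
From mathcomp Require Import all_classical all_reals all_analysis.

Set Implicit Arguments.
Unset Strict Implicit.
Unset Printing Implicit Defensive.

Import Order.TTheory GRing.Theory Num.Theory.
Import numFieldNormedType.Exports.

Local Open Scope classical_set_scope.
Local Open Scope ring_scope.

(* Indexing: all sequences are 0-based, so that l i is the (i+1)-st length, and
   C i j, Y i j are the variables with mathematical indices (i+1, j+1). *)

(* Mutual independence of an arbitrary family of real random variables: the
   product rule for every finite subfamily. *)
Definition mutually_independent (R : realType) (d : measure_display)
    (Omega : measurableType d) (P : probability Omega R)
    (I : choiceType) (X : I -> {RV P >-> R}) : Prop :=
  forall (s : seq I) (B : I -> set R),
    uniq s -> (forall i, measurable (B i)) ->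
    P (\bigcap_(i in [set` s]) (X i @^-1` B i))
      = (\prod_(i <- s) P (X i @^-1` B i))%E.

Section circle.
Context {R : realType}.

(* The circle of circumference 1, i.e. R/Z, through the representatives in
   [0, 1[. *)
Definition circle : set R := `[0, 1[.

(* Open arc with center (the class of) u and length len: the points at circle
   distance less than len / 2 from u; it is the whole circle if len > 1. *)
Definition arc (u len : R) : set R :=
  [set x | circle x /\ exists k : int, `|x - u - k%:~R| < len / 2].

End circle.

Section dynamical_circle_covering.
Context {R : realType} {d : measure_display} {Omega : measurableType d}
  {P : probability Omega R}.
Variables (l : R^nat) (C Y : nat -> nat -> {RV P >-> R}).

(* The uniform law on the circle is that of a representative uniform on
   [0, 1]; the single family indexed by a sum type expresses that all the C i j
   and all the Y i j are jointly mutually independent. *)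
Definition poisson_covering_model (alpha : R) : Prop :=
  [/\ forall i j (A : set R), measurable A ->
        distribution P (C i j) A = uniform_prob (@ltr01 R) A,
      forall i j (A : set R), measurable A ->
        distribution P (Y i j) A = exponential_prob (l i `^ (- alpha)) A &
      mutually_independent (fun k : (nat * nat + nat * nat)%type =>
        match k with
        | inl ij => C ij.1 ij.2
        | inr ij => Y ij.1 ij.2
        end)].

Definition resample_time (i j : nat) (w : Omega) : R := \sum_(k < j) Y i k w.

(* The index j is unique when the Y i k w are positive; when there is none,
   which has probability 0 for each of the i, the value C i 0 w is irrelevant. *)
Definition center (i : nat) (t : R) (w : Omega) : R :=
  C i (xget 0%N
    [set j | resample_time i j w <= t < resample_time i j.+1 w]) w.

Definition moving_arc (i : nat) (t : R) (w : Omega) : set R :=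
  arc (center i t w) (l i).

Definition covered_io (t : R) (w : Omega) : set R :=
  lim_sup_set (fun i => moving_arc i t w).

Definition uncovered (t : R) (w : Omega) : set R :=
  circle `\` covered_io t w.

End dynamical_circle_covering.

(* u_n, the product over the first n lengths. *)
Definition gap_product (R : realType) (l : R^nat) (n : nat) : R :=
  \prod_(k < n) (1 - l k).

(* Main.v *)
(** Time in [0, 1] and the circle are replaced by finite grids, on which the
   positions of the arcs form independent finite-state Markov chains.

   (i) Shrink every arc to the cells that it covers entirely, and let Q(m, n) be
   the probability that the arcs of index in [m, n) leave a site uncovered at
   some grid time. Cut space-time into about n log n blocks of size 1/n by
   1/log n. A block contains an uncovered site with probability O(u_n / u_m):
   Doob's maximal inequality deals with the times, and the first uncovered site
   to the right of a covered one with the sites. Along the subsequence the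
   expected number of such blocks is thus bounded. If there are at most K of
   them, the arcs of index in [n, 2 n) cover them all with probability at least
   delta(K) > 0, whence Q(m, 2 n) <= (1 - delta(K)) Q(m, n) + delta(K) B / K.
   Iterating along the subsequence and then letting K tend to infinity makes
   Q(m, n) small, uniformly in the grids; right continuity of the positions
   transfers this to all times.

   (ii) Enlarge the arcs to whole cells. Two sites at distance about 1/J are
   simultaneously uncovered, at times t apart, with at most
   exp (e^(- t) (l_1 + ... + l_J + O(1))) times the product of the
   probabilities, so the second moment of the number of uncovered space-time
   sites exceeds the square of the first by a factor at most 1 + eps_m, where
   eps_m is a tail of the given series. So, almost surely, for some m there are
   for every n a time and a point avoided by the arcs of index in [m, n). At a
   cluster point (t, x) of these, x is avoided at time t by every arc of index at
   least m which is not resampled at time t, and almost surely at most one arc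
   is resampled at any given time. *)
Require Import Defs.
From HB Require Import structures.
From mathcomp Require Import all_boot all_order all_algebra.
From mathcomp Require Import all_classical all_reals all_analysis.
From mathcomp Require Import measurable_realfun ring lra zify.

Set Implicit Arguments.
Unset Strict Implicit.
Unset Printing Implicit Defensive.

Import Order.TTheory GRing.Theory Num.Theory.
Import numFieldNormedType.Exports.

Local Open Scope classical_set_scope.
Local Open Scope ring_scope.

(** In (i) the expected number of blocks meeting the uncovered set is only bounded, not small, so a
    union bound proves nothing. What helps is that the next [n] arcs have lengths comparable with a
    block, hence remove any bounded number of blocks with a probability independent of [n]. The
    factor [log n] has the same origin in both parts. A site is covered at rate
    [L = l_1 + ... + l_n], which is of order [log n]. In (i) an uncovered site thus survives for a
    time [1 / L], the duration of a block; in (ii) averaging [exp (L e^(- t))] over [t] in [[0, 1]]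
    gives about [e^L / L]. Finite grids turn conditioning on the past into finite sums and avoid
    both Fubini and uncountable unions: the random sets are never shown measurable, only compared
    with grid events off a null set. The direction of rounding follows: shrunk arcs make the grid
    events larger than the true one in (i), enlarged arcs make an uncovered grid site truly avoided
    in (ii). *)

Lemma le_of_eq (disp : Order.disp_t) (T : porderType disp) (x y : T) :
  x = y -> (x <= y)%O.
Proof. by move=> ->. Qed.

(** * Probabilities as real numbers *)

Section real_valued_probability.
Context {R : realType} {d : measure_display} {Omega : measurableType d}
  {P : probability Omega R}.
Implicit Types A B : set Omega.

Definition pr (Q : probability Omega R) A : R := fine (Q A).
Local Notation Pr := (pr P).

Lemma prE A : measurable A -> P A = (Pr A)%:E.
Proof. by move=> mA; rewrite /pr fineK// fin_num_measure. Qed.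

Lemma pr_ge0 A : 0 <= Pr A.
Proof. exact: fine_ge0. Qed.

Lemma pr_le1 A : measurable A -> Pr A <= 1.
Proof. by move=> mA; rewrite -lee_fin -prE// probability_le1. Qed.

Lemma le_pr A B : measurable A -> measurable B -> A `<=` B -> Pr A <= Pr B.
Proof.
by move=> mA mB AB; rewrite -lee_fin -!prE// le_measure// inE.
Qed.

Lemma prT : Pr setT = 1.
Proof. by rewrite /pr probability_setT. Qed.

Lemma pr0 : Pr set0 = 0.
Proof. by rewrite /pr measure0. Qed.

Lemma prU A B : measurable A -> measurable B -> A `&` B = set0 ->
  Pr (A `|` B) = Pr A + Pr B.
Proof.
move=> mA mB AB; apply: EFin_inj.
rewrite EFinD -!prE ?measureU//; exact: measurableU.
Qed.

Lemma prC A : measurable A -> Pr (~` A) = 1 - Pr A.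
Proof.
move=> mA; apply: EFin_inj.
by rewrite EFinB -!prE ?probability_setC//; exact: measurableC.
Qed.

Lemma pr_setI_setC A B : measurable A -> measurable B ->
  Pr A = Pr (A `&` B) + Pr (A `&` ~` B).
Proof.
move=> mA mB; rewrite -prU.
- by rewrite -setIUr setUv setIT.
- exact: measurableI.
- by apply: measurableI => //; exact: measurableC.
- by rewrite setIACA setICr setI0.
Qed.

Lemma prU_le A B : measurable A -> measurable B ->
  Pr (A `|` B) <= Pr A + Pr B.
Proof.
move=> mA mB; rewrite -lee_fin EFinD -!prE//; last exact: measurableU.
by rewrite measureU2.
Qed.

(** Total probability over a finite-valued variable; it replaces conditional expectation
    throughout. *)
Lemma pr_fibres (T : finType) (X : Omega -> T) (A : set Omega) :
  measurable A ->
  (forall v, measurable (X @^-1` [set v])) ->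
  forall phi : pred T,
  Pr (A `&` [set w | phi (X w)]) = \sum_(v | phi v) Pr (A `&` X @^-1` [set v]).
Proof.
move=> mA mX phi.
have mAX v : measurable (A `&` X @^-1` [set v]) by exact: measurableI.
apply: EFin_inj; rewrite -sumEFin.
under eq_bigr do rewrite -prE//.
have -> : A `&` [set w | phi (X w)]
    = \bigcup_(v in [set` enum phi]) (A `&` X @^-1` [set v]).
  apply/seteqP; split => w /=.
    by move=> [Aw pw]; exists (X w) => //=; rewrite mem_enum.
  by move=> [v /= vphi [Aw Xw]]; rewrite Xw; split => //; rewrite mem_enum in vphi.
rewrite -prE; last by apply: fin_bigcup_measurable.
rewrite measure_fin_bigcup//.
  by rewrite -fsbig_seq ?enum_uniq// big_enum.
by move=> u v _ _ [w /= [[_ <-] [_ <-]]].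
Qed.

End real_valued_probability.

(** * Independence *)

Section independence.
Context {R : realType} {d : measure_display} {Omega : measurableType d}
  {P : probability Omega R} {I : choiceType} (X : I -> {RV P >-> R}).
Hypothesis indep : mutually_independent X.
Local Notation Pr := (pr P).

(** The sets [B i] are full outside [s] so that two cylinders intersect in the cylinder over the
    union of their supports: the cylinders form a pi-system generating the sigma-algebra of the
    variables indexed by [S]. *)
Definition cylinders (S : set I) : set (set Omega) :=
  [set A | exists s : seq I, exists B : I -> set R,
    [/\ uniq s, (forall i, i \in s -> S i), (forall i, measurable (B i)),
        (forall i, i \notin s -> B i = setT) &
        A = \bigcap_(i in [set` s]) (X i @^-1` B i)]].

Definition sig (S : set I) : set (set Omega) := <<s cylinders S >>.

Lemma measurable_cylinders S : cylinders S `<=` measurable.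
Proof.
move=> _ [s [B [_ _ mB _ ->]]].
apply: fin_bigcap_measurable => // i _.
by rewrite -[_ @^-1` _]setTI; exact: measurable_funP.
Qed.

Lemma sig_measurable S A : sig S A -> measurable A.
Proof. by apply: smallest_sub; [exact: sigma_algebra_measurable|exact: measurable_cylinders]. Qed.

Lemma cylinders_setI S : setI_closed (cylinders S).
Proof.
move=> _ _ [s [B [us sS mB BT ->]]] [s' [B' [us' sS' mB' BT' ->]]].
exists (undup (s ++ s')), (fun i => B i `&` B' i); split.
- exact: undup_uniq.
- by move=> i; rewrite mem_undup mem_cat => /orP[/sS|/sS'].
- by move=> i; exact: measurableI.
- move=> i; rewrite mem_undup mem_cat negb_or => /andP[/BT -> /BT' ->].
  by rewrite setIT.
- apply/seteqP; split => w.
    move=> [ws ws'] i _ /=; split.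
      by have [/ws//|/BT ->] := boolP (i \in s).
    by have [/ws'//|/BT' ->] := boolP (i \in s').
  move=> ws; split => i /= ii.
    by have [] := ws i; rewrite /= ?mem_undup ?mem_cat ?ii.
  by have [] := ws i; rewrite /= ?mem_undup ?mem_cat ?ii ?orbT.
Qed.

Lemma sig_sub S S' : S `<=` S' -> sig S `<=` sig S'.
Proof.
move=> SS'; apply: smallest_sub; first exact: smallest_sigma_algebra.
move=> _ [s [B [us sS mB BT ->]]]; apply: sub_sigma_algebra.
by exists s, B; split => // i /sS /SS'.
Qed.

Lemma sig_preimage S i B : S i -> measurable B -> sig S (X i @^-1` B).
Proof.
move=> Si mB; apply: sub_sigma_algebra.
exists [:: i], (fun j => if j == i then B else setT); split => //.
- by move=> j; rewrite inE => /eqP ->.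
- by move=> j; case: ifP.
- by move=> j; rewrite inE => /negbTE ->.
- apply/seteqP; split => w /=.
    by move=> Bw j /=; rewrite inE => /eqP ->; rewrite /= eqxx.
  by move=> /(_ i) /=; rewrite inE eqxx; apply.
Qed.

Lemma cylinders_indep S S' A B : S `&` S' = set0 ->
  cylinders S A -> cylinders S' B -> Pr (A `&` B) = Pr A * Pr B.
Proof.
move=> SS' cA cB; apply: EFin_inj; rewrite EFinM -!prE; last 3 first.
- exact: measurable_cylinders cB.
- exact: measurable_cylinders cA.
- apply: measurableI; [exact: measurable_cylinders cA|exact: measurable_cylinders cB].
case: cA => s [D [us sS mD DT ->]]; case: cB => s' [D' [us' sS' mD' DT' ->]].
pose E i := if i \in s then D i else D' i.
have ss' i : i \in s -> i \notin s'.
  move=> si; apply/negP => s'i.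
  have : (S `&` S') i by split; [exact: sS|exact: sS'].
  by rewrite SS'.
rewrite !indep//.
have -> : \bigcap_(i in [set` s]) (X i @^-1` D i) `&`
    \bigcap_(i in [set` s']) (X i @^-1` D' i) =
    \bigcap_(i in [set` s ++ s']) (X i @^-1` E i).
  apply/seteqP; split => w.
    move=> [ws ws'] i /=; rewrite mem_cat /E; case: ifPn => [si _|_ /= s'i].
      exact: ws.
    exact: ws'.
  move=> ws; split => i /= ii.
    by have := ws i; rewrite /= mem_cat /E ii; apply.
  have := ws i; rewrite /= mem_cat /E ii orbT.
  by case: ifPn => [/ss'|_]; [rewrite ii|apply].
rewrite indep//; last 2 first.
- rewrite cat_uniq us us' andbT /=; apply/hasPn => i s'i.
  by apply/negP => /ss'; rewrite s'i.
- by move=> i; rewrite /E; case: ifP.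
rewrite big_cat/=; congr (_ * _)%E; apply: eq_big_seq => i ii.
  by rewrite /E ii.
by rewrite /E; case: ifPn => // /ss'; rewrite ii.
Qed.

Lemma indep_dynkin (A : set Omega) : measurable A ->
  dynkin [set B | measurable B /\ Pr (A `&` B) = Pr A * Pr B].
Proof.
move=> mA; split.
- by split => //; rewrite setIT prT mulr1.
- move=> B [mB AB]; split; first exact: measurableC.
  have := @pr_setI_setC _ _ _ P _ _ mA mB.
  by rewrite AB prC// => h; lra.
- move=> F tF mF; have mF' k : measurable (F k) by case: (mF k).
  have mU : measurable (\bigcup_k F k) by exact: bigcup_measurable.
  split => //; apply: EFin_inj; rewrite EFinM -!prE//; last exact: measurableI.
  rewrite setI_bigcupr !measure_bigcup//; last 2 first.
    by move=> k _; exact: measurableI.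
    exact: trivIset_setIl.
  rewrite [P A]prE// -nneseriesZl//.
  apply: eq_eseriesr => k _; rewrite -[RHS]/((Pr A)%:E * P (F k))%E.
  rewrite (prE (mF' k)) -EFinM -(mF k).2; apply: (@prE _ _ _ P).
  exact: measurableI.
Qed.

(** Dynkin's pi-lambda theorem, used twice: the product rule passes from cylinders to generated
    events first on one side, with a cylinder fixed on the other, then on the other side. *)
Lemma sig_indep S S' A B : S `&` S' = set0 ->
  sig S A -> sig S' B -> Pr (A `&` B) = Pr A * Pr B.
Proof.
move=> SS'.
have key S1 (C : set Omega) : measurable C ->
    (forall D, cylinders S1 D -> Pr (C `&` D) = Pr C * Pr D) ->
    forall D, sig S1 D -> Pr (C `&` D) = Pr C * Pr D.
  move=> mC CD D; rewrite /sig -setI_closed_g_dynkin_g_sigma_algebra; last first.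
    exact: cylinders_setI.
  move=> /(_ [set B | measurable B /\ Pr (C `&` B) = Pr C * Pr B])[]//.
  split; first exact: indep_dynkin.
  by move=> E cE; split; [exact: measurable_cylinders cE|exact: CD].
move=> sA sB; apply: (key S') sB; first exact: sig_measurable sA.
move=> D cD; rewrite setIC mulrC; apply: (key S) sA.
  exact: measurable_cylinders cD.
by move=> C cC; rewrite setIC mulrC; exact: cylinders_indep cC cD.
Qed.

Lemma sigT S : sig S setT.
Proof.
apply: sub_sigma_algebra; exists [::], (fun=> setT); split => //.
by apply/seteqP; split => w // _ i.
Qed.

Lemma sigC S A : sig S A -> sig S (~` A).
Proof. by move=> sA; rewrite -setTD; have [_ h _] := smallest_sigma_algebra setT (cylinders S); exact: h. Qed.

Lemma sig_bigcup S (F : nat -> set Omega) : (forall k, sig S (F k)) ->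
  sig S (\bigcup_k F k).
Proof. by have [_ _ h] := smallest_sigma_algebra setT (cylinders S); exact: h. Qed.

Lemma sig_bigcap S (F : nat -> set Omega) : (forall k, sig S (F k)) ->
  sig S (\bigcap_k F k).
Proof.
move=> sF; rewrite -[X in sig _ X]setCK setC_bigcap; apply: sigC.
by apply: sig_bigcup => k; exact: sigC.
Qed.

Lemma sigU S A B : sig S A -> sig S B -> sig S (A `|` B).
Proof.
move=> sA sB; rewrite -bigcup2E; apply: sig_bigcup => -[|[|k]] //=.
by rewrite -setCT; apply: sigC; exact: sigT.
Qed.

Lemma sigI S A B : sig S A -> sig S B -> sig S (A `&` B).
Proof.
by move=> sA sB; rewrite -[A `&` B]setCK setCI; apply: sigC; apply: sigU; exact: sigC.
Qed.

Lemma sig0 S : sig S set0.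
Proof. by rewrite -setCT; apply: sigC; exact: sigT. Qed.

Lemma sig_forall S (Q : set nat) (F : nat -> set Omega) :
  (forall k, Q k -> sig S (F k)) -> sig S [set w | forall k, Q k -> F k w].
Proof.
move=> sF.
have -> : [set w | forall k, Q k -> F k w]
    = \bigcap_k (if k \in Q then F k else setT).
  apply/seteqP; split => w h k.
    by move=> _; case: ifPn => // /set_mem; exact: h.
  by move=> Qk; have := h k Logic.I; rewrite mem_set.
apply: sig_bigcap => k; case: ifPn => [/set_mem/sF//|_]; exact: sigT.
Qed.

Lemma sig_exists S (Q : set nat) (F : nat -> set Omega) :
  (forall k, Q k -> sig S (F k)) -> sig S [set w | exists2 k, Q k & F k w].
Proof.
move=> sF.
have -> : [set w | exists2 k, Q k & F k w]
    = \bigcup_k (if k \in Q then F k else set0).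
  apply/seteqP; split => w.
    by move=> [k Qk Fk]; exists k => //; rewrite mem_set.
  by move=> [k _]; case: ifPn => // /set_mem Qk Fk; exists k.
apply: sig_bigcup => k; case: ifPn => [/set_mem/sF//|_]; exact: sig0.
Qed.

Lemma sig_fun_sum S (f : nat -> Omega -> R) n :
  (forall k, (k < n)%N -> forall B, measurable B -> sig S (f k @^-1` B)) ->
  forall B, measurable B -> sig S ((fun w => \sum_(k < n) f k w) @^-1` B).
Proof.
(* [Omega] with the smaller sigma-algebra [sig S] is again a measurable type, so measurability of
   finite sums applies to it. *)
move=> mf; pose T := g_sigma_algebraType (cylinders S).
suff m : measurable_fun [set: T] (fun w : T => \sum_(k < n) f k w).
  by move=> B mB; have := m measurableT B mB; rewrite setTI.
apply: measurable_sum => k; move=> _ B mB; rewrite setTI; exact: mf.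
Qed.

End independence.

(** * Cells of the circle and the laws of the variables *)

Section discretisation.
Context {R : realType}.

(* The cell of [u], out of the [h.+1] intervals [[c / h.+1, (c + 1) / h.+1[];
   the extreme cells are extended to infinity to make this total. *)
Definition cell (h : nat) (u : R) : 'I_h.+1 :=
  inord (minn h (Num.truncn (u * h.+1%:R))).

Definition cell_itv h (c : 'I_h.+1) : interval R :=
  Interval (if c == ord0 then -oo%O else BLeft (c%:R / h.+1%:R))
           (if c == ord_max then +oo%O else BLeft (c.+1%:R / h.+1%:R)).

Lemma cell_itvE h (c : 'I_h.+1) : @cell h @^-1` [set c] = [set` cell_itv c].
Proof.
have H0 : 0 < h.+1%:R :> R by rewrite ltr0n.
have cellE u : (cell h u : nat) = minn h (Num.truncn (u * h.+1%:R)).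
  by rewrite inordK// ltnS geq_minl.
apply/seteqP; split => u /=; rewrite /cell_itv in_itv /=.
  move=> <-; apply/andP; split.
    have [//|c0] := eqVneq (cell h u) ord0.
    rewrite /= ler_pdivrMr//.
    have t0 : (0 < Num.truncn (u * h.+1%:R))%N.
      rewrite lt0n; apply: contra c0 => /eqP t0; apply/eqP/val_inj => /=.
      by rewrite cellE t0 minn0.
    rewrite cellE; apply: le_trans (_ : (Num.truncn (u * h.+1%:R))%:R <= _).
      by rewrite ler_nat geq_minr.
    by rewrite truncn_le; move: t0; rewrite truncn_gt0; exact: le_trans.
  have [//|cm] := eqVneq (cell h u) ord_max.
  rewrite /= ltr_pdivlMr//.
  have : (cell h u < h)%N.
    rewrite ltn_neqAle -ltnS ltn_ord andbT; apply: contra cm => /eqP e.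
    by apply/eqP/val_inj.
  rewrite cellE gtn_min ltnn /= => tm.
  by rewrite (minn_idPr (ltnW tm)); exact: truncnS_gt.
move=> /andP[c1 c2]; apply/val_inj; rewrite /= cellE.
have [u0|u0] := ltP u 0.
  have -> : Num.truncn (u * h.+1%:R) = 0%N.
    apply/eqP; rewrite -leqn0 truncn_le_nat; apply: lt_trans ltr01.
    by rewrite pmulr_llt0.
  rewrite minn0; move: c1; case: eqP => [->//|_] /=.
  rewrite leNgt => /negP[]; apply: lt_le_trans u0 _.
  by rewrite divr_ge0.
have c1' : (c <= Num.truncn (u * h.+1%:R))%N.
  rewrite truncn_ge_nat; last by rewrite mulr_ge0// ltW.
  move: c1; case: eqP => [-> _|_] /=; first by rewrite mulr_ge0// ltW.
  by rewrite ler_pdivrMr.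
move: c2; case: eqP => [e _|cm /=].
  have ch : (c : nat) = h by rewrite e.
  by move: c1'; rewrite ch => c1'; exact/minn_idPl.
rewrite ltr_pdivlMr// -truncn_lt_nat ?mulr_ge0// ?(ltW H0)// ltnS => c2.
have -> : Num.truncn (u * h.+1%:R) = c by apply/eqP; rewrite eqn_leq c2 c1'.
by apply/minn_idPr; rewrite -ltnS.
Qed.

Lemma measurable_cell h (c : 'I_h.+1) : measurable (@cell h @^-1` [set c]).
Proof. by rewrite cell_itvE; exact: measurable_itv. Qed.

Lemma uniform_cell h (c : 'I_h.+1) :
  uniform_prob (@ltr01 R) (@cell h @^-1` [set c]) = (h.+1%:R^-1)%:E.
Proof.
have H0 : 0 < h.+1%:R :> R by rewrite ltr0n.
rewrite /uniform_prob integral_uniform_pdf.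
(* The uniform law lives on the closed interval [[0, 1]], so the trace of the last cell is closed on
   the right. *)
pose J : interval R := Interval (BLeft (c%:R / h.+1%:R))
  (if c == ord_max then BRight 1 else BLeft (c.+1%:R / h.+1%:R)).
have -> : (@cell h @^-1` [set c]) `&` `[0, 1] = [set` J].
  rewrite cell_itvE /cell_itv /J; apply/seteqP; split => u /=; rewrite !in_itv /=.
    move=> [/andP[c1 c2] /andP[u0 u1]]; apply/andP; split.
      by move: c1; case: eqP => // -> _; rewrite mul0r.
    by move: c2; case: eqP.
  move=> /andP[c1 c2].
  have u0 : 0 <= u by apply: le_trans c1; rewrite divr_ge0.
  split; apply/andP; split => //; first by case: eqP.
  - by move: c2; case: eqP.
  - move: c2; case: eqP => // _ /ltW/le_trans; apply.
    by rewrite ler_pdivrMr// mul1r ler_nat.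
rewrite (eq_integral (fun=> 1%:E)); last first.
  move=> u /set_mem uJ; rewrite /uniform_pdf subr0 invr1.
  suff -> : 0 <= u <= 1 by [].
  move: uJ; rewrite /J /= in_itv /= => /andP[c1 c2].
  apply/andP; split; first by apply: le_trans c1; rewrite divr_ge0.
  move: c2; case: eqP => // _ /ltW/le_trans; apply.
  by rewrite ler_pdivrMr// mul1r ler_nat.
rewrite integral_cst//= mul1e lebesgue_measure_itv /=.
have e : (c.+1%:R / h.+1%:R - c%:R / h.+1%:R = h.+1%:R^-1 :> R).
  by rewrite -mulrBl -natrB// subSnn mul1r.
case: eqP => [cm|_] /=.
  have ch : (c : nat) = h by rewrite cm.
  rewrite ch lte_fin ltr_pdivrMr// mul1r ltr_nat leqnn -EFinB; congr _%:E.
  by rewrite -[RHS]e ch divff// gt_eqF.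
rewrite lte_fin ltr_pM2r ?invr_gt0// ltr_nat leqnn -EFinB; congr _%:E.
exact: e.
Qed.

End discretisation.

Section exponential_tail.
Context {R : realType}.

Lemma exponential_prob_lt0 : exponential_prob (1 : R) `]-oo, 0[ = 0%E.
Proof.
rewrite /exponential_prob integral0_eq// => x /=; rewrite in_itv /= => x0.
by rewrite lt0_exponential_pdf.
Qed.

Lemma exponential_prob_itv (x : R) : 0 <= x ->
  exponential_prob (1 : R) `[0, x] = (1 - expR (- x))%:E.
Proof.
rewrite le_eqVlt => /predU1P[<-|x0].
  by rewrite set_itv1 /exponential_prob integral_set1 oppr0 expR0 subrr.
by rewrite exponential_prob_itv0c// mulN1r.
Qed.

End exponential_tail.

Section marginals.
Context {R : realType} {d : measure_display} {Omega : measurableType d}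
  {P : probability Omega R}.
Variables (l : R^nat) (C Y : nat -> nat -> {RV P >-> R}).
Hypothesis model : poisson_covering_model l C Y 0.
Local Notation Pr := (pr P).

Lemma measurable_rv (X : {RV P >-> R}) (A : set R) :
  measurable A -> measurable (X @^-1` A).
Proof. by move=> mA; rewrite -[_ @^-1` _]setTI; exact: measurable_funP. Qed.

Lemma pr_C_cell i j h (c : 'I_h.+1) :
  Pr (C i j @^-1` (@cell R h @^-1` [set c])) = h.+1%:R^-1.
Proof.
have [hC _ _] := model.
have := hC i j _ (measurable_cell c); rewrite uniform_cell.
by rewrite /pr /distribution /pushforward => ->.
Qed.

Lemma C_unit_interval i j : Pr (C i j @^-1` (~` `[0, 1[)) = 0.
Proof.
have [hC _ _] := model.
have mI : measurable (`[0, 1[ : set R) by exact: measurable_itv.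
have m1 : measurable (C i j @^-1` `[0, 1[) by exact: measurable_rv.
rewrite preimage_setC prC//.
have := hC i j _ mI.
rewrite /pr /distribution /pushforward => ->.
rewrite /uniform_prob integral_uniform_pdf setIidl; last first.
  by move=> x /=; rewrite !in_itv /= => /andP[-> /ltW ->].
rewrite (eq_integral (fun=> 1%:E)); last first.
  move=> u /set_mem /=; rewrite in_itv /= => /andP[u0 u1].
  by rewrite /uniform_pdf u0 ltW// subr0 invr1.
by rewrite integral_cst//= mul1e lebesgue_measure_itv /= lte_fin ltr01 /= subr0 subrr.
Qed.

Lemma exponential_Y i j A : measurable A ->
  P (Y i j @^-1` A) = exponential_prob (1 : R) A.
Proof.
have [_ hY _] := model.
by move=> mA; have := hY i j _ mA; rewrite oppr0 powRr0.
Qed.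

Lemma Y_lt0 i j : Pr (Y i j @^-1` `]-oo, 0[) = 0.
Proof. by rewrite /pr exponential_Y// exponential_prob_lt0. Qed.

Lemma Y_le i j x : 0 <= x -> Pr (Y i j @^-1` `]-oo, x]) = 1 - expR (- x).
Proof.
move=> x0.
have -> : `]-oo, x]%classic = `]-oo, (0 : R)[%classic `|` `[0, x]%classic.
  apply/seteqP; split => y /=; rewrite !in_itv /=.
    by move=> yx; case: (ltP y 0) => y0; [left|right].
  by move=> [/ltW y0|/andP[]//]; exact: le_trans y0 x0.
rewrite preimage_setU (@prU _ _ _ P); last first.
- rewrite -preimage_setI -(preimage_set0 (Y i j)); congr (_ @^-1` _).
  by apply/seteqP; split => y //= []; rewrite !in_itv /= => y0; rewrite leNgt y0.
- by apply: measurable_rv; exact: measurable_itv.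
- by apply: measurable_rv; exact: measurable_itv.
 by rewrite Y_lt0 add0r /pr exponential_Y// exponential_prob_itv.
Qed.

Lemma Y_gt i j x : 0 <= x -> Pr (Y i j @^-1` `]x, +oo[) = expR (- x).
Proof.
move=> x0.
have -> : Y i j @^-1` `]x, +oo[ = ~` (Y i j @^-1` `]-oo, x]).
  by rewrite -setCitvl preimage_setC.
rewrite (@prC _ _ _ P); last by apply: measurable_rv; exact: measurable_itv.
rewrite Y_le//.
by rewrite opprB addrC subrK.
Qed.

Definition resampling_family (k : (nat * nat + nat * nat)%type) : {RV P >-> R} :=
  match k with inl ij => C ij.1 ij.2 | inr ij => Y ij.1 ij.2 end.

Lemma family_indep : mutually_independent resampling_family.
Proof. by have [] := model. Qed.

End marginals.

Section memoryless.
Context {R : realType} {d : measure_display} {Omega : measurableType d}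
  {P : probability Omega R} {I : choiceType} (X : I -> {RV P >-> R}).
Hypothesis indep : mutually_independent X.
Local Notation Pr := (pr P).

(** Lets the mesh tend to 0: cells of size [L / h.+1] cost a factor [expR (L / h.+1)]. *)
Lemma le_of_le_expR_div (L x y : R) :
  (forall h : nat, x <= expR (L / h.+1%:R) * y) -> x <= y.
Proof.
move=> xy; have cv : (fun h : nat => expR (L / h.+1%:R) * y) @ \oo --> y.
  have c1 : (fun h : nat => L / h.+1%:R) @ \oo --> L * 0.
    by apply: cvgMl_tmp; exact: (@cvg_harmonic R).
  rewrite mulr0 in c1.
  have c2 : (fun h : nat => expR (L / h.+1%:R)) @ \oo --> expR (0 : R).
    by apply: continuous_cvg => //; exact: continuous_expR.
  rewrite expR0 in c2.
  have : (fun h : nat => expR (L / h.+1%:R) * y) @ \oo --> 1 * y.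
    exact: cvgMr_tmp.
  by rewrite mul1r.
by apply: (cvgr_to_ge cv); apply: nearW => h; exact: xy.
Qed.

Lemma cell_bounds h (u : R) : 0 <= u < 1 ->
  (cell h u)%:R / h.+1%:R <= u < (cell h u).+1%:R / h.+1%:R.
Proof.
have H0 : 0 < h.+1%:R :> R by rewrite ltr0n.
move=> /andP[u0 u1]; have /truncn_itv : 0 <= u * h.+1%:R by rewrite mulr_ge0// ltW.
suff -> : (cell h u : nat) = Num.truncn (u * h.+1%:R).
  by rewrite ler_pdivrMr// ltr_pdivlMr.
rewrite inordK ?ltnS ?geq_minl//; apply/minn_idPr.
rewrite -ltnS truncn_lt_nat; first by rewrite gtr_pMl.
by rewrite mulr_ge0// ltW.
Qed.

(** As [V <= a] on [G] and [X k] is an independent exponential variable, for [y >= a] the event with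
    threshold [y] has probability [expR (- y)] times the expectation of [expR V] on [G]. Fubini is
    replaced by cutting the values of [V] into cells and a two-sided estimate. *)
Lemma memoryless (S : set I) (k : I) (G : set Omega) (V : Omega -> R) (a s : R) :
  ~ S k -> sig X S G -> (forall B, measurable B -> sig X S (V @^-1` B)) ->
  (forall w, G w -> 0 <= V w <= a) -> 0 <= a -> a <= s ->
  (forall y, 0 <= y -> Pr (X k @^-1` `]y, +oo[) = expR (- y)) ->
  Pr (G `&` [set w | s < V w + X k w]) =
  expR (- (s - a)) * Pr (G `&` [set w | a < V w + X k w]).
Proof.
move=> Sk sG sV GV a0 as_ tail.
(* With [a + 1] instead of [a], the ratio [V / L] stays below 1, where [cell] is not truncated, and
   [L] is positive even if [a = 0]. *)
pose L := a + 1; have L0 : 0 < L by rewrite ltr_wpDl.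
have mG : measurable G := sig_measurable sG.
have mV B : measurable B -> measurable (V @^-1` B).
  by move=> mB; exact: sig_measurable (sV _ mB).
have mB y : measurable [set w | y < V w + X k w].
  have m : measurable_fun setT (fun w => V w + X k w).
    by apply: measurable_funD => // _ B mB; rewrite setTI; exact: mV.
  have := m measurableT _ (measurable_itv `]y, +oo[); rewrite setTI.
  by congr measurable; apply/seteqP; split => w /=; rewrite in_itv /= andbT.
(* For negative [y] only this inequality is available; it suffices for the upper estimate, whose
   threshold [z] may be negative. *)
have tail_le y : Pr (X k @^-1` `]y, +oo[) <= expR (- y).
  have [y0|y0] := leP 0 y; first by rewrite tail.
  apply: le_trans (pr_le1 _) _; first by apply: measurable_rv; exact: measurable_itv.
  by rewrite -[leLHS]expR0 ler_expR oppr_ge0 ltW.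
have SI : S `&` [set k] = set0 by apply/seteqP; split => // i [/= Si ik]; rewrite ik in Si.
have ind A y : sig X S A ->
    Pr (A `&` X k @^-1` `]y, +oo[) = Pr A * Pr (X k @^-1` `]y, +oo[).
  move=> sA; apply: (sig_indep indep SI) => //.
  by apply: sig_preimage => //; exact: measurable_itv.
pose cl h w := cell h (V w / L).
have scl h c : sig X S (cl h @^-1` [set c]).
  have -> : cl h @^-1` [set c] = V @^-1` ((fun u => u / L) @^-1` (@cell R h @^-1` [set c])) by [].
  apply: sV; rewrite -[X in measurable X]setTI.
  have : measurable_fun setT (fun u : R => u / L) by apply: measurable_funM.
  by apply => //; exact: measurable_cell.
pose p h c := Pr (G `&` cl h @^-1` [set c]).
(* A Riemann sum for the expectation of [expR V] on [G], independent of the threshold. *)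
pose D h := \sum_(c < h.+1) p h c * expR (L * (c%:R / h.+1%:R)).
have cb h w : G w -> L * ((cl h w)%:R / h.+1%:R) <= V w < L * ((cl h w)%:R / h.+1%:R) + L / h.+1%:R.
  move=> /GV /andP[V0 Va]; have := @cell_bounds h (V w / L).
  rewrite divr_ge0// ?(ltW L0)// ltr_pdivrMr// mul1r ltr_pwDr//.
  move=> /(_ isT) /andP[]; rewrite ler_pdivlMr// ltr_pdivrMr// -/(cl h w) => c1 c2.
  rewrite mulrC c1 /=; apply: lt_le_trans c2 _.
  by rewrite -natr1 mulrDl mulrDl mul1r mulrC [_^-1 * L]mulrC.
have split_b h y : Pr (G `&` [set w | y < V w + X k w]) =
    \sum_(c < h.+1) Pr (G `&` [set w | y < V w + X k w] `&` cl h @^-1` [set c]).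
  have := @pr_fibres _ _ _ P _ (cl h) (G `&` [set w | y < V w + X k w])
    (measurableI _ _ mG (mB y)) (fun c => sig_measurable (scl h c)) xpredT.
  by rewrite (_ : [set w | xpredT (cl h w)] = setT) ?setIT//; apply/seteqP; split.
have upper h y : a <= y -> Pr (G `&` [set w | y < V w + X k w]) <=
    expR (- y) * expR (L / h.+1%:R) * D h.
  move=> ay; rewrite (split_b h) /D mulr_sumr; apply: ler_sum => c _.
  pose z := y - L * (c%:R / h.+1%:R) - L / h.+1%:R.
  have -> : expR (- y) * expR (L / h.+1%:R) * (p h c * expR (L * (c%:R / h.+1%:R)))
      = p h c * expR (- z).
    rewrite /z !opprB !expRD; ring.
  apply: (@le_trans _ _ (p h c * Pr (X k @^-1` `]z, +oo[))); last first.
    by rewrite ler_wpM2l// ?pr_ge0.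
  rewrite -ind; last by apply: sigI.
  apply: le_pr.
  - by apply: measurableI; [exact: measurableI|exact: sig_measurable (scl h c)].
  - apply: measurableI; last by apply: measurable_rv; exact: measurable_itv.
    by apply: measurableI => //; exact: sig_measurable (scl h c).
  - move=> w [[Gw /= yV] cw]; split => //=; rewrite in_itv /= andbT /z.
    have := cb h w Gw; rewrite cw => /andP[_].
    by move: (L * _) (L / _) => t1 t2; lra.
have lower h y : a <= y -> expR (- y) * D h <= Pr (G `&` [set w | y < V w + X k w]).
  move=> ay; rewrite (split_b h) /D mulr_sumr; apply: ler_sum => c _.
  pose z := y - L * (c%:R / h.+1%:R).
  have -> : expR (- y) * (p h c * expR (L * (c%:R / h.+1%:R))) = p h c * expR (- z).
    rewrite /z !opprB !expRD; ring.
  (* An empty piece contributes nothing; for a nonempty one the left end of the cell is at most [a],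
     so [z] is nonnegative and the tail is exact. *)
  have [G0|/set0P[w0 [Gw0 cw0]]] := eqVneq (G `&` cl h @^-1` [set c]) set0.
    by rewrite /p G0 pr0 mul0r pr_ge0.
  have z0 : 0 <= z.
    have := cb h w0 Gw0; rewrite cw0 => /andP[h1 _].
    by have /andP[_] := GV _ Gw0; move: h1; rewrite /z; move: (L * _) => t1; lra.
  rewrite -(tail _ z0) /p -ind; last by apply: sigI.
  apply: le_pr.
  - apply: measurableI; last by apply: measurable_rv; exact: measurable_itv.
    by apply: measurableI => //; exact: sig_measurable (scl h c).
  - by apply: measurableI; [exact: measurableI|exact: sig_measurable (scl h c)].
  - move=> w [[Gw cw] /=]; rewrite in_itv /= andbT /z => h1; split => //; split => //=.
    have := cb h w Gw; rewrite cw => /andP[+ _].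
    by move: (L * _) h1 => t1; lra.
apply/eqP; rewrite eq_le; apply/andP; split.
  apply: (@le_of_le_expR_div L) => h; apply: le_trans (upper h _ as_) _.
  have := ler_wpM2l (expR_ge0 (L / h.+1%:R))
    (ler_wpM2l (expR_ge0 (- (s - a))) (lower h a (lexx _))).
  apply: le_trans; apply: le_of_eq.
  by rewrite !mulrA -!expRD; congr (expR _ * _); ring.
apply: (@le_of_le_expR_div L) => h.
apply: le_trans (ler_wpM2l (expR_ge0 (- (s - a))) (upper h a (lexx _))) _.
apply: le_trans (ler_wpM2l (expR_ge0 (L / h.+1%:R)) (lower h s as_)).
apply: le_of_eq.
by rewrite !mulrA -!expRD; congr (expR _ * _); ring.
Qed.

End memoryless.

(** * The law of one arc *)

Section one_arc.
Context {R : realType} {d : measure_display} {Omega : measurableType d}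
  {P : probability Omega R}.
Variables (l : R^nat) (C Y : nat -> nat -> {RV P >-> R}).
Hypothesis model : poisson_covering_model l C Y 0.
Local Notation Pr := (pr P).
Local Notation X := (resampling_family C Y).
Local Notation T := (resample_time Y).

(** While the arc waits in its position [C i j], the centres up to [C i j] are known, but only the
    waiting times before [Y i j] are: hence two separate bounds. *)
Definition history (i jc jy : nat) : set (nat * nat + nat * nat)%type :=
  [set k | match k with
           | inl ij => ij.1 = i /\ (ij.2 < jc)%N
           | inr ij => ij.1 = i /\ (ij.2 < jy)%N
           end].

Definition arcs_index (A : set nat) : set (nat * nat + nat * nat)%type :=
  [set k | match k with inl ij => A ij.1 | inr ij => A ij.1 end].

(** Bounding all the partial sums, and not just the last, makes the events [at_index] for different
    [j] disjoint on all of [Omega], although the [Y i k] may be negative on a null set. *)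
Definition not_passed (i : nat) (t : R) (j : nat) : set Omega :=
  [set w | forall k, (k < j.+1)%N -> 0 <= T i k w <= t].

(* The event that arc [i] has been resampled exactly [j] times by time [t]; it
   coincides almost surely with [T i j <= t < T i j.+1]. *)
Definition at_index (i : nat) (t : R) (j : nat) : set Omega :=
  not_passed i t j `&` [set w | t < T i j.+1 w].

Lemma resample_time0 i w : T i 0 w = 0.
Proof. by rewrite /resample_time big_ord0. Qed.

Lemma resample_timeS i j w : T i j.+1 w = T i j w + Y i j w.
Proof. by rewrite /resample_time big_ord_recr. Qed.

Lemma sig_resample_time i j jc B : measurable B ->
  sig X (history i jc j) (T i j @^-1` B).
Proof.
move=> mB.
apply: (@sig_fun_sum _ _ _ P _ X (history i jc j) (fun k => Y i k) j) mB => k kj B' mB'.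
by apply: (@sig_preimage _ _ _ P _ X (history i jc j) (inr (i, k)) B').
Qed.

Lemma sub_history i jc jy jc' jy' : (jc <= jc')%N -> (jy <= jy')%N ->
  history i jc jy `<=` history i jc' jy'.
Proof.
by move=> h1 h2 [] [a b] [/= -> h]; split => //; exact: leq_trans h _.
Qed.

Lemma sub_history_arcs i jc jy A : A i -> history i jc jy `<=` arcs_index A.
Proof. by move=> Ai [] [a b] [/= -> _]. Qed.

Lemma sig_not_passed i t j jc : sig X (history i jc j) (not_passed i t j).
Proof.
apply: (@sig_forall _ _ _ P _ X _ [set k | (k < j.+1)%N]
  (fun k => [set w | 0 <= T i k w <= t])) => k /= kj.
apply: (@sig_sub _ _ _ P _ X (history i jc k)); first exact: sub_history.
have -> : [set w | 0 <= T i k w <= t] = T i k @^-1` `[0, t].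
  by apply/seteqP; split => w /=; rewrite in_itv.
by apply: sig_resample_time; exact: measurable_itv.
Qed.

Lemma sig_T_gt i t j jc : sig X (history i jc j) [set w | t < T i j w].
Proof.
have -> : [set w | t < T i j w] = T i j @^-1` `]t, +oo[.
  by apply/seteqP; split => w /=; rewrite in_itv /= andbT.
by apply: sig_resample_time; exact: measurable_itv.
Qed.

Lemma sig_at_index i t j jc : sig X (history i jc j.+1) (at_index i t j).
Proof.
apply: sigI; last exact: sig_T_gt.
by apply: (@sig_sub _ _ _ P _ X (history i jc j)); [exact: sub_history|exact: sig_not_passed].
Qed.

Lemma measurable_at_index i t j : measurable (at_index i t j).
Proof.
have h : sig X (history i 0 j.+1) (at_index i t j) by exact: sig_at_index.
exact: sig_measurable h.
Qed.

Lemma at_index_uniq i t j j' w :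
  at_index i t j w -> at_index i t j' w -> j = j'.
Proof.
have key a b : at_index i t a w -> at_index i t b w -> (a <= b)%N.
  move=> [pa _] [_ tb]; rewrite leqNgt; apply/negP => ba.
  have /andP[_] := pa b.+1 ba.
  by rewrite leNgt tb.
by move=> h h'; apply/eqP; rewrite eqn_leq !key.
Qed.

Definition regular (i : nat) : set Omega :=
  [set w | (forall j, 0 <= Y i j w) /\
           (forall t : R, exists j, t < T i j w)].

Lemma regular_at_index i t w : 0 <= t -> regular i w ->
  exists j, at_index i t j w.
Proof.
move=> t0 [Y0 Tinf].
have ex : exists j, t < T i j w by exact: Tinf.
case: (ex_minnP ex) => -[|j] tj jmin; first by rewrite resample_time0 ltNge t0 in tj.
exists j; split => // k kj; apply/andP; split.
  by rewrite /resample_time; apply: sumr_ge0 => n _.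
rewrite leNgt; apply/negP => /jmin; rewrite leqNgt => /negP; exact.
Qed.

Lemma pr_T_le i j (t : R) : 0 <= t ->
  Pr [set w | forall k, (k < j)%N -> Y i k w <= t] = (1 - expR (- t)) ^+ j.
Proof.
move=> t0; elim: j => [|j IH].
  by rewrite expr0 -[RHS](@prT _ _ _ P); congr (Pr _); apply/seteqP; split.
have sA n : sig X (history i 0 n) [set w | forall k, (k < n)%N -> Y i k w <= t].
  apply: (@sig_forall _ _ _ P _ X _ [set k | (k < n)%N]
    (fun k => [set w | Y i k w <= t])) => k /= kn.
  have -> : [set w | Y i k w <= t] = Y i k @^-1` `]-oo, t].
    by apply/seteqP; split => w /=; rewrite in_itv.
  apply: (@sig_preimage _ _ _ P _ X _ (inr (i, k))) => //; exact: measurable_itv.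
have -> : [set w | forall k, (k < j.+1)%N -> Y i k w <= t] =
    [set w | forall k, (k < j)%N -> Y i k w <= t] `&` Y i j @^-1` `]-oo, t].
  apply/seteqP; split => w /=.
    by move=> h; split; [move=> k kj; apply: h; exact: ltnW|rewrite in_itv; exact: h].
  move=> [h]; rewrite in_itv /= => hj k; rewrite ltnS leq_eqVlt => /predU1P[-> //|].
  exact: h.
rewrite (@sig_indep _ _ _ P _ X (family_indep model) (history i 0 j) [set inr (i, j)]).
- by rewrite IH (Y_le model)// exprSr.
- by apply/seteqP; split => // -[] [a b] [/= h1 h2] //; case: h2 h1 => -> -> []; rewrite ltnn.
- exact: sA.
- by apply: (@sig_preimage _ _ _ P _ X _ (inr (i, j))) => //; exact: measurable_itv.
Qed.

(** If the waiting times are nonnegative and the [T i j] bounded, then all waiting times are at most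
    some integer [n], which has probability at most [(1 - expR (- n)) ^+ j] for every [j]. *)
Lemma negligible_not_regular i : P.-negligible (~` regular i).
Proof.
pose N1 := \bigcup_j (Y i j @^-1` `]-oo, 0[).
pose N2 := \bigcup_n \bigcap_j [set w | forall k, (k < j)%N -> Y i k w <= n%:R].
suff N12 : P.-negligible (N1 `|` N2).
  apply: negligibleS N12.
  move=> w nr; apply: contrapT => /not_orP[n1 n2]; apply: nr.
  have Y0 j : 0 <= Y i j w.
    rewrite leNgt; apply/negP => h; apply: n1; exists j => //=; rewrite in_itv.
  split => // t; apply: contrapT => /forallNP Tle; apply: n2.
  exists (Num.truncn t).+1 => // j _ k _.
  apply: (@le_trans _ _ (T i k.+1 w)).
    rewrite resample_timeS lerDr; apply: sumr_ge0 => n _; exact: Y0.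
  have /negP := Tle k.+1; rewrite -leNgt => /le_trans; apply.
  by rewrite ltW// truncnS_gt.
apply: negligibleU; apply: negligible_bigcup => n.
  exists (Y i n @^-1` `]-oo, 0[); split => //.
    by apply: measurable_rv; exact: measurable_itv.
  rewrite -[LHS]fineK ?fin_num_measure//; last first.
    by apply: measurable_rv; exact: measurable_itv.
  by rewrite -/(pr P _) (Y_lt0 model).
set A := fun j => [set w | forall k, (k < j)%N -> Y i k w <= n%:R].
have mA j : measurable (A j).
  have -> : A j = \bigcap_(k in [set k | (k < j)%N]) (Y i k @^-1` `]-oo, n%:R]).
    by apply/seteqP; split => w /= h k kj; have := h k kj; rewrite /= in_itv.
  apply: bigcap_measurableType => k _.
  by apply: measurable_rv; exact: measurable_itv.
have mI : measurable (\bigcap_j A j) by exact: bigcapT_measurable.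
exists (\bigcap_j A j); split => //.
apply: etrans (prE mI) _; congr _%:E; apply/eqP; rewrite eq_le pr_ge0 andbT.
have bnd j : Pr (\bigcap_j A j) <= (1 - expR (- n%:R)) ^+ j.
  rewrite -(pr_T_le i j (ler0n _ n)); apply: le_pr => //; first exact: mA.
  by move=> w; apply.
have cv : (fun j => (1 - expR (- n%:R : R)) ^+ j) @ \oo --> 0.
  apply: cvg_expr; rewrite ger0_norm.
    by rewrite ltrBlDr ltrDl expR_gt0.
  by rewrite subr_ge0 -[leRHS]expR0 ler_expR oppr_le0.
by apply: (cvgr_to_ge cv); apply: nearW => j; exact: bnd.
Qed.

End one_arc.

Section markov.
Context {R : realType} {d : measure_display} {Omega : measurableType d}
  {P : probability Omega R}.
Variables (l : R^nat) (C Y : nat -> nat -> {RV P >-> R}).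
Hypothesis model : poisson_covering_model l C Y 0.
Local Notation Pr := (pr P).
Local Notation X := (resampling_family C Y).
Local Notation T := (resample_time Y).
Local Notation at_ := (at_index Y).
Variable h : nat.

(** Defined through the disjoint events [at_index]; on [regular] it is the index selected by
    [center]. *)
Definition jumps (i : nat) (t : R) (w : Omega) : nat :=
  xget 0%N [set j | at_ i t j w].

Definition state (i : nat) (t : R) (w : Omega) : 'I_h.+1 :=
  cell h (C i (jumps i t w) w).

Lemma jumps_at i t j w : at_ i t j w -> jumps i t w = j.
Proof.
move=> aj; rewrite /jumps; apply: xget_unique => // k ak.
exact: at_index_uniq ak aj.
Qed.

Lemma sig_C_cell S i j (c : 'I_h.+1) : S (inl (i, j)) ->
  sig X S (C i j @^-1` (@cell R h @^-1` [set c])).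
Proof.
move=> Sij; apply: (@sig_preimage _ _ _ P _ X _ (inl (i, j))) => //.
exact: measurable_cell.
Qed.

Lemma sig_at_arc i t j : sig X (arcs_index [set i]) (at_ i t j).
Proof.
have s : sig X (history i 0 j.+1) (at_ i t j) by exact: sig_at_index.
by apply: sig_sub s; exact: sub_history_arcs.
Qed.

Lemma sig_state i t c : sig X (arcs_index [set i]) (state i t @^-1` [set c]).
Proof.
pose A := [set w | exists2 j, setT j & (at_ i t j `&` C i j @^-1` (@cell R h @^-1` [set c])) w].
pose N := [set w | exists2 j, setT j & at_ i t j w].
(* Off [N] no index is valid and [jumps] takes its default 0, which gives the second piece. *)
have -> : state i t @^-1` [set c] = A `|` (~` N `&` C i 0 @^-1` (@cell R h @^-1` [set c])).
  apply/seteqP; split => w /=; rewrite /state.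
    have [[j _ aj]|nN] := pselect (N w).
      by rewrite (jumps_at aj) => cj; left; exists j.
    rewrite /jumps xgetPN => [c0|j aj]; first by right.
    by apply: nN; exists j.
  move=> [[j _ [aj /= cj]]|[nN c0]]; first by rewrite (jumps_at aj).
  by rewrite /jumps xgetPN// => j aj; apply: nN; exists j.
apply: sigU; first apply: sig_exists => j _.
  apply: sigI; [exact: sig_at_arc|exact: sig_C_cell].
apply: sigI; last exact: sig_C_cell.
by apply: sigC; apply: sig_exists => j _; exact: sig_at_arc.
Qed.

Lemma measurable_state i t c : measurable (state i t @^-1` [set c]).
Proof. exact: sig_measurable (@sig_state i t c). Qed.

(* [E] is determined by the past of arc [i] up to time [t]. *)
Definition adapted (i : nat) (t : R) (E : set Omega) : Prop :=
  forall j, exists2 W, sig X (history i j.+1 j) W & E `&` at_ i t j = W `&` at_ i t j.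

Lemma adaptedI i t E F : adapted i t E -> adapted i t F -> adapted i t (E `&` F).
Proof.
move=> aE aF j; have [W sW EW] := aE j; have [W' sW' FW] := aF j.
exists (W `&` W'); first exact: sigI.
by rewrite setIAC EW -setIA [at_ i t j `&` F]setIC FW setIA.
Qed.

Lemma at_index_before i s t j w : 0 <= s -> s <= t -> at_ i t j w ->
  exists2 k, (k <= j)%N & at_ i s k w.
Proof.
move=> s0 st aj; have ex : exists k, s < T i k.+1 w.
  by exists j; apply: le_lt_trans st _; case: aj.
case: (ex_minnP ex) => k sk kmin.
have kj : (k <= j)%N by apply: kmin; apply: le_lt_trans st _; case: aj.
exists k => //; split => // -[|n]; first by rewrite resample_time0 lexx.
rewrite ltnS => nk; apply/andP; split.
  have [pj _] := aj; have nj : (n.+1 < j.+1)%N by rewrite ltnS (leq_trans nk).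
  by have /andP[] := pj n.+1 nj.
by rewrite leNgt; apply/negP => /kmin; rewrite leqNgt nk.
Qed.

(** On [at_ i t j] the arc has been resampled [k <= j] times by time [s]. If [k < j], the event
    [at_ i s k] involves only the first [j] waiting times. If [k = j], the condition [s < T i j.+1]
    would involve [Y i j], but it follows from [t < T i j.+1], so [not_passed] is enough. *)
Lemma adapted_le i s t E : 0 <= s -> s <= t -> adapted i s E -> adapted i t E.
Proof.
move=> s0 st aE j; have [W sW EW] := aE j.
pose W1 := [set w | exists2 k, [set k | (k < j)%N] k & (E `&` at_ i s k) w].
exists (W1 `|` (W `&` not_passed Y i s j)).
  apply: sigU; first apply: sig_exists => k /= kj.
    suff : sig X (history i j.+1 j) (E `&` at_ i s k) by [].
    have [W' sW' ->] := aE k; apply: sigI.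
      by apply: sig_sub sW'; apply: sub_history; exact: ltnW.
    have sk : sig X (history i 0 k.+1) (at_ i s k) by exact: sig_at_index.
    by apply: sig_sub sk; exact: sub_history.
  by apply: sigI => //; exact: sig_not_passed.
have late w : at_ i t j w -> s < T i j.+1 w by move=> [_]; exact: le_lt_trans.
apply/seteqP; split => w [Ew aj]; split => //.
  have [k kj ak] := at_index_before s0 st aj.
  move: kj; rewrite leq_eqVlt => /predU1P[kj|kj]; last by left; exists k.
  rewrite kj in ak; right; split; last by case: ak.
  have : (E `&` at_ i s j) w by [].
  by rewrite EW => -[].
case: Ew => [[k _ []//]|[Ww pw]].
have : (W `&` at_ i s j) w by do 2!split => //; exact: late.
by rewrite -EW => -[].
Qed.

Lemma adapted_state i s t c : 0 <= s -> s <= t ->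
  adapted i t (state i s @^-1` [set c]).
Proof.
move=> s0 st; apply: adapted_le s0 st _ => j.
exists (C i j @^-1` (@cell R h @^-1` [set c])).
  by apply: sig_C_cell; split => /=.
by apply/seteqP; split => w [+ aj]; rewrite /= /state (jumps_at aj).
Qed.

Lemma pr_sum_at_index i t E : 0 <= t -> measurable E ->
  P E = (\sum_(0 <= j <oo) P (E `&` at_ i t j))%E.
Proof.
move=> t0 mE.
have mA j : measurable (E `&` at_ i t j).
  by apply: measurableI => //; exact: measurable_at_index.
transitivity (P (\bigcup_j (E `&` at_ i t j))); last first.
  rewrite measure_bigcup//.
    by apply: eq_eseriesl => j; rewrite in_setT.
  move=> j k _ _ [w /= [[_ aj] [_ ak]]]; exact: at_index_uniq aj ak.
have mU : measurable (\bigcup_j (E `&` at_ i t j)) by exact: bigcupT_measurable.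
have [N [mN N0 subN]] := negligible_not_regular model i.
apply/eqP; rewrite eq_le; apply/andP; split; last first.
  by apply: le_measure; rewrite ?inE//; move=> w [j _ []].
apply: le_trans (_ : P ((\bigcup_j (E `&` at_ i t j)) `|` N) <= _)%E.
  apply: le_measure; rewrite ?inE//; first exact: measurableU.
  move=> w Ew; have [r|nr] := pselect (regular Y i w); last by right; exact: subN.
  by have [j aj] := regular_at_index t0 r; left; exists j.
by rewrite measureU0.
Qed.

(** Either no resampling occurs during a time [delta], or the last one puts the arc in a uniform
    cell, possibly the same. *)
Definition kernel (delta : R) (c c' : 'I_h.+1) : R :=
  expR (- delta) * (c == c')%:R + (1 - expR (- delta)) / h.+1%:R.

(** Split according to [L], the absence of resampling between [t] and [t']. Its conditional
    probability comes from [memoryless], applied with the past waiting time [T i j] as [V]; on [L]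
    the state does not change. *)
Lemma markov_at_index i t t' E (c c' : 'I_h.+1) j :
  0 <= t -> t <= t' -> measurable E -> adapted i t E ->
  E `<=` state i t @^-1` [set c] ->
  Pr (E `&` state i t' @^-1` [set c'] `&` at_ i t j) =
  kernel (t' - t) c c' * Pr (E `&` at_ i t j).
Proof.
move=> t0 tt' mE aE Ec.
have t'0 := le_trans t0 tt'.
have [W sW EW] := aE j.
set A := E `&` at_ i t j; set D := state i t' @^-1` [set c'].
have mA : measurable A by apply: measurableI => //; exact: measurable_at_index.
have mD : measurable D := measurable_state i t' c'.
pose L := [set w | t' < T i j.+1 w].
have sL : sig X (history i 0 j.+1) L by exact: sig_T_gt.
have mL : measurable L := sig_measurable sL.
have AL : Pr (A `&` L) = expR (- (t' - t)) * Pr A.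
  pose G := W `&` not_passed Y i t j.
  have AG : A = G `&` [set w | t < T i j w + Y i j w].
    rewrite /A EW -setIA; congr (_ `&` (_ `&` _)).
    by apply/seteqP; split => w /=; rewrite resample_timeS.
  have ALG : A `&` L = G `&` [set w | t' < T i j w + Y i j w].
    rewrite AG -setIA; congr (_ `&` _); apply/seteqP; split => w /=.
      by move=> [_]; rewrite /L /= resample_timeS.
    by rewrite /L /= resample_timeS => h'; split => //; exact: le_lt_trans h'.
  rewrite ALG [in RHS]AG.
  apply: (@memoryless _ _ _ P _ X (family_indep model) (history i j.+1 j) (inr (i, j))) => //.
  - by move=> [_]; rewrite ltnn.
  - by apply: sigI => //; exact: sig_not_passed.
  - by move=> B mB; exact: sig_resample_time.
  - by move=> w [_]; apply.
  - by move=> y y0; exact: Y_gt model _ _ _ y0.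
have ALD : Pr (A `&` L `&` D) = (c == c')%:R * Pr (A `&` L).
  have inC w : (A `&` L) w -> C i j w = C i (jumps i t' w) w /\ state i t' w = c.
    move=> [[Ew aj] Lw].
    have aj' : at_ i t' j w.
      split => // k kj; case: aj => /(_ k kj) /andP[-> /le_trans ->//].
    rewrite /state (jumps_at aj'); split => //.
    by have := Ec _ Ew; rewrite /= /state (jumps_at aj).
  have [ec|cc'] := eqVneq c c'.
    rewrite mul1r /D -ec; congr Pr; apply/seteqP; split => w; first by case.
    by move=> ALw; split => //; have [] := inC w ALw.
  rewrite mul0r -[RHS](@pr0 _ _ _ P); congr Pr; apply/seteqP; split => w //.
  move=> [/inC[_ sc] Dw]; move/eqP: cc'; apply.
  by rewrite -sc; exact: Dw.
pose A2 := A `&` ~` L.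
have mA2 : measurable A2 by apply: measurableI => //; exact: measurableC.
(* Off [L] the arc sits at time [t'] in the cell of some [C i k] with [k > j], which is independent
   of the history determining [A2] and [at_ i t' k]. *)
have A2D : Pr (A2 `&` D) = h.+1%:R^-1 * Pr A2.
  apply: EFin_inj; rewrite EFinM -!prE//; last exact: measurableI.
  rewrite (pr_sum_at_index i t'0 (measurableI _ _ mA2 mD)) (pr_sum_at_index i t'0 mA2).
  rewrite -nneseriesZl//; apply: eq_eseriesr => k _.
  have mat : measurable (A2 `&` at_ i t' k).
    by apply: measurableI => //; exact: measurable_at_index.
  have mat' : measurable (A2 `&` D `&` at_ i t' k).
    by apply: measurableI; [exact: measurableI|exact: measurable_at_index].
  suff e : Pr (A2 `&` D `&` at_ i t' k) = h.+1%:R^-1 * Pr (A2 `&` at_ i t' k).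
    by rewrite -[RHS]/((h.+1%:R^-1)%:E * P (A2 `&` at_ i t' k))%E (prE mat) -EFinM -e -prE.
  have [kj|jk] := leqP k j.
    have e0 : A2 `&` at_ i t' k = set0.
      apply/seteqP; split => // w [[[Ew [pj _]] nL] [_ /= tk]]; apply: nL.
      move: kj; rewrite leq_eqVlt => /predU1P[kj|kj].
        by rewrite /L /= -kj.
      have /andP[_] := pj k.+1 kj; rewrite leNgt => /negP[].
      exact: le_lt_trans tk.
    by rewrite setIAC e0 set0I pr0 mulr0.
  have -> : A2 `&` D `&` at_ i t' k =
      (A2 `&` at_ i t' k) `&` C i k @^-1` (@cell R h @^-1` [set c']).
    apply/seteqP; split => w.
      move=> [[aw Dw] ak]; split => //.
      by move: Dw; rewrite /D /= /state (jumps_at ak).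
    move=> [[aw ak] Cw]; split => //; split => //.
    by rewrite /D /= /state (jumps_at ak).
  rewrite -(pr_C_cell model i k c') mulrC.
  apply: (@sig_indep _ _ _ P _ X (family_indep model) (history i k k.+1) [set inl (i, k)]).
  - apply/seteqP; split => // -[] [a b] [/= h1 h2] //.
    by case: h2 h1 => -> -> []; rewrite ltnn.
  - have sub : history i j.+1 j.+1 `<=` history i k k.+1.
      by apply: sub_history => //; exact: leqW.
    apply: sigI; last exact: sig_at_index.
    apply: (sig_sub sub); rewrite /A2 /A EW; apply: sigI; last first.
      by apply: sigC; exact: sig_T_gt.
    apply: sigI; last exact: sig_at_index.
    by apply: sig_sub sW; exact: sub_history.
  - exact: sig_C_cell.
rewrite setIAC -/A.
have mAD : measurable (A `&` D) by exact: measurableI.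
rewrite (@pr_setI_setC _ _ _ P _ _ mAD mL) setIAC ALD AL setIAC -/A2 A2D.
have : Pr A = Pr (A `&` L) + Pr A2 := @pr_setI_setC _ _ _ P _ _ mA mL.
rewrite AL => e; have -> : Pr A2 = (1 - expR (- (t' - t))) * Pr A.
  by move: e; rewrite mulrBl mul1r => {1}->; rewrite addrC addKr.
rewrite /kernel; ring.
Qed.

Lemma markov i t t' E (c c' : 'I_h.+1) :
  0 <= t -> t <= t' -> measurable E -> adapted i t E ->
  E `<=` state i t @^-1` [set c] ->
  Pr (E `&` state i t' @^-1` [set c']) = kernel (t' - t) c c' * Pr E.
Proof.
move=> t0 tt' mE aE Ec.
have mED : measurable (E `&` state i t' @^-1` [set c']).
  by apply: measurableI => //; exact: measurable_state.
apply: EFin_inj; rewrite EFinM -!prE//.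
rewrite (pr_sum_at_index i t0 mED) (pr_sum_at_index i t0 mE).
rewrite -nneseriesZl//; apply: eq_eseriesr => k _.
have mat := @measurable_at_index _ _ _ P C Y i t k.
have m1 : measurable (E `&` at_ i t k) by exact: measurableI.
have m2 : measurable (E `&` state i t' @^-1` [set c'] `&` at_ i t k).
  exact: measurableI.
rewrite -[RHS]/((kernel (t' - t) c c')%:E * P (E `&` at_ i t k))%E (prE m1) -EFinM.
by rewrite -(@markov_at_index i t t' E c c' k)// -prE.
Qed.

Lemma pr_state i t (c : 'I_h.+1) : 0 <= t ->
  Pr (state i t @^-1` [set c]) = h.+1%:R^-1.
Proof.
move=> t0; have mS := measurable_state i t c.
apply: EFin_inj; rewrite -prE// (pr_sum_at_index i t0 mS).
transitivity ((h.+1%:R^-1)%:E * (\sum_(0 <= j <oo) P (setT `&` at_ i t j)))%E; last first.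
  by rewrite -pr_sum_at_index// probability_setT mule1.
rewrite -nneseriesZl//; apply: eq_eseriesr => k _.
have mat := @measurable_at_index _ _ _ P C Y i t k.
have m1 : measurable (setT `&` at_ i t k) by exact: measurableI.
have m2 : measurable (state i t @^-1` [set c] `&` at_ i t k) by exact: measurableI.
rewrite -[RHS]/((h.+1%:R^-1)%:E * P (setT `&` at_ i t k))%E (prE m1) -EFinM.
have -> : state i t @^-1` [set c] `&` at_ i t k =
    at_ i t k `&` C i k @^-1` (@cell R h @^-1` [set c]).
  apply/seteqP; split => w [a b]; split => //; move: a b; rewrite /= /state.
    by move=> + ak; rewrite (jumps_at ak).
  by move=> ak; rewrite (jumps_at ak).
rewrite setTI mulrC -(pr_C_cell model i k c).
rewrite -(@sig_indep _ _ _ P _ X (family_indep model) (history i k k.+1) [set inl (i, k)]).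
- rewrite prE//; apply: measurableI => //; apply: measurable_rv; exact: measurable_cell.
- apply/seteqP; split => // -[] [a b] [/= h1 h2] //.
  by case: h2 h1 => -> -> []; rewrite ltnn.
- exact: sig_at_index.
- exact: sig_C_cell.
Qed.

End markov.

(** * The joint law of the arcs *)

Section joint_law.
Context {R : realType} {d : measure_display} {Omega : measurableType d}
  {P : probability Omega R}.
Variables (l : R^nat) (C Y : nat -> nat -> {RV P >-> R}).
Hypothesis model : poisson_covering_model l C Y 0.
Local Notation Pr := (pr P).
Local Notation X := (resampling_family C Y).
Variable h : nat.
Local Notation st := (state C Y h).
Local Notation adapt := (adapted C Y).
Local Notation arc_sig k := (sig X (arcs_index (@set1 nat k))).

Lemma sub_arcs_index (A B : set nat) : A `<=` B -> arcs_index A `<=` arcs_index B.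
Proof. by move=> AB [] [a b] /= /AB. Qed.

Lemma sig_arcs_forall (E : nat -> set Omega) m n :
  (forall k, (m <= k < n)%N -> arc_sig k (E k)) ->
  sig X (arcs_index [set k | (m <= k < n)%N])
    [set w | forall k, (m <= k < n)%N -> E k w].
Proof.
move=> sE; apply: (@sig_forall _ _ _ P _ X _ [set k | (m <= k < n)%N]) => k /= mkn.
by apply: sig_sub (sE k mkn); apply: sub_arcs_index => _ ->.
Qed.

Lemma pr_arcs (E : nat -> set Omega) m n : (m <= n)%N ->
  (forall k, (m <= k < n)%N -> arc_sig k (E k)) ->
  Pr [set w | forall k, (m <= k < n)%N -> E k w] = \prod_(m <= k < n) Pr (E k).
Proof.
elim: n => [|n IH] mn sE.
  move: mn; rewrite leqn0 => /eqP ->; rewrite big_geq// -[RHS](@prT _ _ _ P).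
  by congr Pr; apply/seteqP; split => // w _ k; rewrite ltn0 andbF.
move: mn; rewrite leq_eqVlt => /predU1P[<-|mn].
  rewrite big_geq// -[RHS](@prT _ _ _ P); congr Pr; apply/seteqP; split => // w _ k.
  by rewrite ltnNge andbN.
rewrite ltnS in mn; rewrite big_nat_recr//= -IH//; last first.
  by move=> k /andP[mk kn]; apply: sE; rewrite mk ltnW.
have -> : [set w | forall k, (m <= k < n.+1)%N -> E k w] =
    [set w | forall k, (m <= k < n)%N -> E k w] `&` E n.
  apply/seteqP; split => w /=.
    move=> h1; split; last by apply: h1; rewrite mn /=.
    by move=> k /andP[mk kn]; apply: h1; rewrite mk ltnW.
  move=> [h1 h2] k /andP[mk]; rewrite ltnS leq_eqVlt => /predU1P[->//|kn].
  by apply: h1; rewrite mk.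
apply: (@sig_indep _ _ _ P _ X (family_indep model)
  (arcs_index [set k | (m <= k < n)%N]) (arcs_index [set n])).
- apply/seteqP; split => // -[] [a b] [/= h1 h2]; move: h1; rewrite h2 ltnn andbF//.
- apply: sig_arcs_forall => k /andP[mk kn]; apply: sE; by rewrite mk ltnW.
- by apply: sE; rewrite mn /=.
Qed.

Definition config (N : nat) (t : R) (w : Omega) : {ffun 'I_N -> 'I_h.+1} :=
  [ffun k : 'I_N => st k t w].

(* An event determined by the past, up to time [t], of the first [N] arcs, on
   which their configuration at time [t] is [v]. *)
Definition past N (t : R) (v : {ffun 'I_N -> 'I_h.+1}) (E : set Omega) : Prop :=
  exists F : 'I_N -> set Omega,
    (forall k : 'I_N, [/\ arc_sig k (F k), adapt k t (F k) &
                   F k `<=` st k t @^-1` [set v k]]) /\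
    E = [set w | forall k : 'I_N, F k w].

Definition kernels N (delta : R) (v v' : {ffun 'I_N -> 'I_h.+1}) : R :=
  \prod_(k < N) kernel delta (v k) (v' k).

Lemma pr_forall_ord N (F : 'I_N -> set Omega) : (forall k : 'I_N, arc_sig k (F k)) ->
  Pr [set w | forall k : 'I_N, F k w] = \prod_(k < N) Pr (F k).
Proof.
move=> sF; pose E k := if insub k is Some k' then F k' else setT.
have EF (k : 'I_N) : E k = F k by rewrite /E valK.
transitivity (Pr [set w | forall k, (0 <= k < N)%N -> E k w]).
  congr Pr; apply/seteqP; split => w /= hw k.
    by move=> kN; rewrite -[k]/(val (Ordinal kN)) EF; exact: hw.
  by rewrite -EF; apply: hw; rewrite /=.
rewrite pr_arcs//; last first.
  by move=> k /= kN; rewrite -[k]/(val (Ordinal kN)) EF; exact: sF.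
by rewrite big_mkord; apply: eq_bigr => k _; rewrite EF.
Qed.

Lemma past_measurable N t (v : {ffun 'I_N -> 'I_h.+1}) E :
  past t v E -> measurable E.
Proof.
move=> [F [hF ->]].
have -> : [set w | forall k : 'I_N, F k w] = \bigcap_(k in [set: 'I_N]) F k.
  by apply/seteqP; split => w /= Fw k; [move=> _|]; exact: Fw.
apply: fin_bigcap_measurable => // k _.
by have [sF _ _] := hF k; exact: sig_measurable sF.
Qed.

Lemma past_config0 N t (v : {ffun 'I_N -> 'I_h.+1}) : 0 <= t ->
  past t v (config N t @^-1` [set v]).
Proof.
move=> t0; exists (fun k : 'I_N => st k t @^-1` [set v k]); split.
  by move=> k; split => //; [exact: sig_state|exact: adapted_state].
apply/seteqP; split => w /=; first by move=> <- k; rewrite ffunE.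
by move=> e; apply/ffunP => k; rewrite ffunE e.
Qed.

(** A [past] event is an intersection of events of single arcs, so the one-arc transition
    probabilities multiply, and adding the configuration at [t'] preserves this form. *)
Lemma past_step N t t' (v v' : {ffun 'I_N -> 'I_h.+1}) E : 0 <= t -> t <= t' ->
  past t v E -> past t' v' (E `&` config N t' @^-1` [set v']) /\
  Pr (E `&` config N t' @^-1` [set v']) = kernels (t' - t) v v' * Pr E.
Proof.
move=> t0 tt' [F [hF ->]]; have t'0 := le_trans t0 tt'.
have sF (k : 'I_N) : arc_sig k (F k) by have [] := hF k.
have e : [set w | forall k : 'I_N, F k w] `&` config N t' @^-1` [set v'] =
    [set w | forall k : 'I_N, (F k `&` st k t' @^-1` [set v' k]) w].
  apply/seteqP; split => w /=.
    by move=> [Fw <-] k; split => //; rewrite ffunE.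
  move=> Fw; split => [k|]; first by have [] := Fw k.
  by apply/ffunP => k; rewrite ffunE; have [_ ->] := Fw k.
have sF' (k : 'I_N) : arc_sig k (F k `&` st k t' @^-1` [set v' k]).
  by apply: sigI; [exact: sF|exact: sig_state].
split.
  exists (fun k : 'I_N => F k `&` st k t' @^-1` [set v' k]); split => // k; split => //.
    apply: adaptedI; last exact: adapted_state.
    by apply: adapted_le t0 tt' _; have [] := hF k.
rewrite e pr_forall_ord// pr_forall_ord// /kernels -big_split /=.
apply: eq_bigr => k _; have [_ aF Fv] := hF k.
by rewrite (markov model _ t0 tt' _ aF Fv)//; exact: sig_measurable (sF k).
Qed.
End joint_law.

(** * A maximal inequality on a time grid *)

Section maximal_inequality.
Context {R : realType} {d : measure_display} {Omega : measurableType d}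
  {P : probability Omega R}.
Variables (l : R^nat) (C Y : nat -> nat -> {RV P >-> R}).
Hypothesis model : poisson_covering_model l C Y 0.
Local Notation Pr := (pr P).
Variables (h N : nat) (delta cc : R) (f : pred {ffun 'I_N -> 'I_h.+1}).
Local Notation cfg := (config C Y h N).
Hypothesis delta_ge0 : 0 <= delta.
Hypothesis cc_ge0 : 0 <= cc.
Hypothesis cc_le1 : cc <= 1.
Hypothesis stay : forall v, f v -> cc <= \sum_(v' | f v') kernels delta v v'.

Lemma measurable_fibres (T : finType) (X : Omega -> T) (phi : pred T) :
  (forall v, measurable (X @^-1` [set v])) -> measurable [set w | phi (X w)].
Proof.
move=> mX; have -> : [set w | phi (X w)] = \bigcup_(v in [set` phi]) X @^-1` [set v].
  apply/seteqP; split => w /=; first by move=> pw; exists (X w).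
  by move=> [v /= pv Xw]; rewrite Xw.
by apply: fin_bigcup_measurable.
Qed.

Lemma measurable_config t v : 0 <= t -> measurable (cfg t @^-1` [set v]).
Proof. by move=> t0; exact: past_measurable (@past_config0 _ _ _ P C Y h N t v t0). Qed.

Lemma measurable_config_pred t (phi : pred {ffun 'I_N -> 'I_h.+1}) : 0 <= t ->
  measurable [set w | phi (cfg t w)].
Proof. by move=> t0; apply: measurable_fibres => v; exact: measurable_config. Qed.

Definition hit (t : R) (n : nat) : set Omega :=
  [set w | exists2 i, (i <= n)%N & f (cfg (t + i%:R * delta) w)].

Let time_ge0 t i : 0 <= t -> 0 <= t + i%:R * delta.
Proof. by move=> t0; rewrite addr_ge0// mulr_ge0. Qed.

Lemma measurable_hit t n : 0 <= t -> measurable (hit t n).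
Proof.
move=> t0; have -> : hit t n =
    \bigcup_(i in [set i | (i <= n)%N]) [set w | f (cfg (t + i%:R * delta) w)].
  by apply/seteqP; split => w /= [i ii fi]; exists i.
by apply: bigcup_measurable => i _; apply: measurable_config_pred; exact: time_ge0.
Qed.

Lemma hitS t n : hit t n.+1 = [set w | f (cfg t w)] `|` hit (t + delta) n.
Proof.
have e i : t + delta + i%:R * delta = t + i.+1%:R * delta.
  by rewrite -natr1; ring.
apply/seteqP; split => w /=.
  move=> [[_|i]]; first by rewrite mul0r addr0; left.
  by rewrite ltnS => ii fi; right; exists i => //; rewrite e.
move=> [fw|[i ii]]; first by exists 0%N => //; rewrite mul0r addr0.
by rewrite e; exists i.+1.
Qed.

Lemma pr_next t (v : {ffun 'I_N -> 'I_h.+1}) E (A : set Omega) : 0 <= t -> past C Y t v E -> measurable A ->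
  Pr (E `&` A) = \sum_v' Pr (E `&` cfg (t + delta) @^-1` [set v'] `&` A).
Proof.
move=> t0 pE mA; have mE := past_measurable pE.
have td0 : 0 <= t + delta by rewrite addr_ge0.
have := @pr_fibres _ _ _ P _ (cfg (t + delta)) (E `&` A) (measurableI _ _ mE mA)
  (fun v => measurable_config v td0) xpredT.
rewrite (_ : [set w | xpredT (cfg (t + delta) w)] = setT); last by apply/seteqP; split.
by rewrite setIT => ->; apply: eq_bigr => v' _; rewrite setIAC.
Qed.

Lemma pr_stay n t (v : {ffun 'I_N -> 'I_h.+1}) E : 0 <= t -> past C Y t v E -> f v ->
  cc ^+ n * Pr E <= Pr (E `&` [set w | f (cfg (t + n%:R * delta) w)]).
Proof.
elim: n t v E => [|n IH] t v E t0 pE fv.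
  rewrite expr0 mul1r mul0r addr0 (_ : E `&` _ = E)//.
  apply/seteqP; split => w; [by case|move=> Ew]; move: (pE) => [F [hF EF]].
  split => //=; suff -> : cfg t w = v by [].
  apply/ffunP => k; rewrite ffunE; have [_ _] := hF k; apply.
  by move: Ew; rewrite EF; apply.
have td0 : 0 <= t + delta by rewrite addr_ge0.
rewrite (pr_next t0 pE); last by apply: measurable_config_pred; exact: time_ge0.
apply: (@le_trans _ _ (\sum_(v' | f v') cc ^+ n * (kernels delta v v' * Pr E))).
  rewrite -mulr_sumr -mulr_suml exprSr -mulrA ler_wpM2l ?exprn_ge0//.
  by rewrite ler_wpM2r ?pr_ge0//; exact: stay.
rewrite big_mkcond /=; apply: ler_sum => v' _; case: ifPn => [fv'|_]; last exact: pr_ge0.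
have tt : t <= t + delta by rewrite lerDl.
have [pE' e] := past_step model v' t0 tt pE.
have -> : kernels delta v v' = kernels (t + delta - t) v v'.
  by rewrite addrAC subrr add0r.
rewrite -e (_ : t + n.+1%:R * delta = t + delta + n%:R * delta).
  exact: IH td0 pE' fv'.
by rewrite -natr1; ring.
Qed.

(** Decomposition at the first hit, by induction on [n]: if [f] holds at the start, [pr_stay] keeps
    it until the end; otherwise one step is taken, and the factor [cc <= 1] saved on it is given
    away. *)
Lemma pr_hit_past n t (v : {ffun 'I_N -> 'I_h.+1}) E : 0 <= t -> past C Y t v E ->
  cc ^+ n * Pr (E `&` hit t n) <= Pr (E `&` [set w | f (cfg (t + n%:R * delta) w)]).
Proof.
elim: n t v E => [|n IH] t v E t0 pE.
  rewrite expr0 mul1r; apply: le_of_eq; congr (Pr (_ `&` _)).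
  apply/seteqP; split => w /=; first by move=> [i]; rewrite leqn0 => /eqP ->.
  by exists 0%N.
have mE := past_measurable pE.
have mF : measurable [set w | f (cfg (t + n.+1%:R * delta) w)].
  by apply: measurable_config_pred; exact: time_ge0.
have [fv|nfv] := boolP (f v).
  apply: le_trans (pr_stay n.+1 t0 pE fv).
  rewrite ler_wpM2l ?exprn_ge0//; apply: le_pr => //.
  by apply: measurableI => //; exact: measurable_hit.
have td0 : 0 <= t + delta by rewrite addr_ge0.
have Ev w : E w -> cfg t w = v.
  move: pE => [F [hF ->]] Fw; apply/ffunP => k; rewrite ffunE.
  by have [_ _] := hF k; apply; exact: Fw.
have -> : E `&` hit t n.+1 = E `&` hit (t + delta) n.
  rewrite hitS; apply/seteqP; split => w [Ew]; last by split => //; right.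
  by move=> [/=|//]; rewrite (Ev w Ew) (negbTE nfv).
rewrite (pr_next t0 pE (measurable_hit n td0)) (pr_next t0 pE mF) mulr_sumr.
apply: ler_sum => v' _.
have tt : t <= t + delta by rewrite lerDl.
have [pE' _] := past_step model v' t0 tt pE.
rewrite (_ : t + n.+1%:R * delta = t + delta + n%:R * delta); last first.
  by rewrite -natr1; ring.
apply: le_trans (IH _ _ _ td0 pE'); rewrite exprS -mulrA ler_piMl//.
by rewrite mulr_ge0 ?exprn_ge0 ?pr_ge0.
Qed.

(* Doob's maximal inequality for the submartingale [cc ^- i * f (cfg (t + i delta))]. *)
Lemma pr_hit n t : 0 <= t ->
  cc ^+ n * Pr (hit t n) <= Pr [set w | f (cfg (t + n%:R * delta) w)].
Proof.
move=> t0; have mC v := measurable_config v t0.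
have split_ A : measurable A -> Pr A = \sum_v Pr (cfg t @^-1` [set v] `&` A).
  move=> mA; have := @pr_fibres _ _ _ P _ (cfg t) A mA mC xpredT.
  rewrite (_ : [set w | xpredT (cfg t w)] = setT); last by apply/seteqP; split.
  by rewrite setIT => ->; apply: eq_bigr => v _; rewrite setIC.
rewrite (split_ _ (measurable_hit n t0)) mulr_sumr [leRHS]split_; last first.
  by apply: measurable_config_pred; exact: time_ge0.
apply: ler_sum => v _; have p0 : past C Y t v (cfg t @^-1` [set v]) by exact: past_config0.
exact: pr_hit_past t0 p0.
Qed.

End maximal_inequality.

(** * Sites left uncovered *)

Section discrete_covering.
Context {R : realType} {d : measure_display} {Omega : measurableType d}
  {P : probability Omega R}.
Variables (l : R^nat) (C Y : nat -> nat -> {RV P >-> R}).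
Hypothesis model : poisson_covering_model l C Y 0.
Local Notation Pr := (pr P).
Local Notation X := (resampling_family C Y).
Variable h : nat.
Local Notation st := (state C Y h).
Local Notation arc_sig k := (sig X (arcs_index (@set1 nat k))).

(* The discrete arc of [w] consecutive sites starting at [c - s]. *)
Definition cov (w s : nat) (c y : 'I_h.+1) : bool :=
  (((y - c + inZp s)%R : 'I_h.+1) < w)%N.

Lemma sum_ord_lt (w : nat) : (w <= h.+1)%N ->
  \sum_(e < h.+1) ((e < w)%N%:R : R) = w%:R.
Proof.
move=> wh.
transitivity (\sum_(e < h.+1 | (e < w)%N) (1 : R)).
  by rewrite [RHS]big_mkcond /=; apply: eq_bigr => e _; case: ifP.
by rewrite -(big_ord_widen _ (fun=> 1)) // sumr_const card_ord.
Qed.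

Lemma shift_inj (y z : 'I_h.+1) : injective (fun c : 'I_h.+1 => y - c + z).
Proof. by move=> a b /addIr /addrI /oppr_inj. Qed.

Lemma sum_cov w s (y : 'I_h.+1) : (w <= h.+1)%N ->
  \sum_c ((cov w s c y)%:R : R) = w%:R.
Proof.
move=> wh; rewrite -(sum_ord_lt wh).
by rewrite [RHS](reindex_inj (@shift_inj y (inZp s))).
Qed.

Lemma pr_state_pred k t (phi : pred 'I_h.+1) : 0 <= t ->
  Pr [set om | phi (st k t om)] = (\sum_c (phi c)%:R) / h.+1%:R.
Proof.
move=> t0; have := @pr_fibres _ _ _ P _ (st k t) setT measurableT
  (fun c => @measurable_state _ _ _ P C Y h k t c) phi.
rewrite setTI => ->; rewrite big_distrl big_mkcond /=; apply: eq_bigr => c _.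
by rewrite setTI; case: ifP => _; rewrite ?mul0r// mul1r (pr_state model).
Qed.

Lemma sig_state_pred k t (phi : pred 'I_h.+1) : arc_sig k [set om | phi (st k t om)].
Proof.
pose F j := if insub j is Some c then (if phi c then st k t @^-1` [set c] else set0) else set0.
have -> : [set om | phi (st k t om)] = [set om | exists2 j, setT j & F j om].
  apply/seteqP; split => om /=.
    move=> p; exists (st k t om : nat) => //; rewrite /F valK p.
    by [].
  move=> [j _]; rewrite /F; case: insubP => // c _ _.
  by case: ifPn => // pc /= stc; rewrite stc.
apply: sig_exists => j _; rewrite /F; case: insub => [c|]; last exact: sig0.
by case: ifP => _; [exact: sig_state|exact: sig0].
Qed.

Variables (w s : nat -> nat).
Hypothesis wH : forall k, (w k <= h.+1)%N.

Local Notation p k := ((w k)%:R / h.+1%:R : R).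

Definition uncov m n t (y : 'I_h.+1) : set Omega :=
  [set om | forall k, (m <= k < n)%N -> ~~ cov (w k) (s k) (st k t om) y].

Lemma sig_uncov m n t y :
  sig X (arcs_index [set k | (m <= k < n)%N]) (uncov m n t y).
Proof.
exact: (sig_arcs_forall (fun k _ => @sig_state_pred k t (fun c => ~~ cov (w k) (s k) c y))).
Qed.

Lemma measurable_uncov m n t y : measurable (uncov m n t y).
Proof. exact: sig_measurable (@sig_uncov m n t y). Qed.

Lemma sum_not_cov k (y : 'I_h.+1) :
  (\sum_c ((~~ cov (w k) (s k) c y)%:R : R)) / h.+1%:R = 1 - p k.
Proof.
have H0 : h.+1%:R != 0 :> R by rewrite pnatr_eq0.
transitivity ((h.+1%:R - (w k)%:R) / h.+1%:R : R); last by rewrite mulrBl (divff H0).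
congr (_ / _).
rewrite -(sum_cov (s k) y (wH k)).
have -> : (h.+1%:R : R) = \sum_(c < h.+1) 1 by rewrite sumr_const card_ord.
rewrite -sumrB; apply: eq_bigr => c _.
by case: cov; rewrite ?subrr ?subr0.
Qed.

Lemma pr_uncov m n t y : (m <= n)%N -> 0 <= t ->
  Pr (uncov m n t y) = \prod_(m <= k < n) (1 - p k).
Proof.
move=> mn t0.
rewrite (pr_arcs model mn (fun k _ => @sig_state_pred k t (fun c => ~~ cov (w k) (s k) c y))).
apply: eq_bigr => k _; rewrite -(sum_not_cov k y).
exact: (@pr_state_pred k t (fun c => ~~ cov (w k) (s k) c y) t0).
Qed.

Lemma pr_exists_le (E : nat -> set Omega) m n : (m <= n)%N ->
  (forall k, measurable (E k)) ->
  Pr [set om | exists2 k, (m <= k < n)%N & E k om] <= \sum_(m <= k < n) Pr (E k).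
Proof.
move=> mn mE; elim: n mn => [|n IH].
  rewrite leqn0 => /eqP ->; rewrite big_geq// (_ : [set om | _] = set0) ?pr0//.
  by apply/seteqP; split => // om [k]; rewrite ltn0 andbF.
rewrite leq_eqVlt => /predU1P[->|mn].
  rewrite big_geq// (_ : [set om | _] = set0) ?pr0//.
  by apply/seteqP; split => // om [k /andP[mk /(leq_ltn_trans mk)]]; rewrite ltnn.
rewrite ltnS in mn; rewrite big_nat_recr//=.
have -> : [set om | exists2 k, (m <= k < n.+1)%N & E k om] =
    [set om | exists2 k, (m <= k < n)%N & E k om] `|` E n.
  apply/seteqP; split => om /=.
    move=> [k /andP[mk]]; rewrite ltnS leq_eqVlt => /predU1P[->|kn] Ek; first by right.
    by left; exists k => //; rewrite mk.
  move=> [[k /andP[mk kn] Ek]|En]; first by exists k => //; rewrite mk ltnW.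
  by exists n => //; rewrite mn /=.
apply: le_trans (prU_le _ (mE n)) _; last by rewrite lerD2r IH.
have -> : [set om | exists2 k, (m <= k < n)%N & E k om] =
    \bigcup_(k in [set k | (m <= k < n)%N]) E k by [].
by apply: bigcup_measurable => k _.
Qed.

Lemma prod_if_one m n k (x : R) : (m <= k < n)%N ->
  \prod_(m <= i < n) (if i == k then x else 1) = x.
Proof.
move=> mkn; rewrite (bigD1_seq k) ?mem_index_iota ?iota_uniq//= eqxx.
by rewrite big1 ?mulr1// => i /negbTE ->.
Qed.

Definition site (a : 'I_h.+1) (j : nat) : 'I_h.+1 := a + inZp j.

Lemma inZpS j : inZp j.+1 = inZp j + inZp 1 :> 'I_h.+1.
Proof. by apply/val_inj; rewrite /= modnDm addn1. Qed.

(** An arc covering a site but not the next one ends exactly there, so its position is determined;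
    such a position has probability only [1 / h.+1]. *)
Lemma cov_last ww ss c a j : (ww <= h.+1)%N ->
  cov ww ss c (site a j) -> ~~ cov ww ss c (site a j.+1) ->
  c = site a j.+1 + inZp ss - inZp ww.
Proof.
rewrite /cov /site inZpS => wwh; set e := a + inZp j - c + inZp ss => c1 c2.
have e1 : a + (inZp j + inZp 1) - c + inZp ss = e + inZp 1.
  by rewrite /e addrA [_ + inZp 1 - c]addrAC [_ + inZp 1 + _]addrAC.
rewrite e1 in c2; clearbody e.
have vE : (nat_of_ord (e + inZp 1)%R = e.+1 %% h.+1)%N by rewrite /= modnDmr addn1.
have ew : (e.+1 = ww)%N.
  move: c1 c2; rewrite -leqNgt vE => c1.
  have [eh|eh] := ltnP e.+1 h.+1; first by rewrite modn_small//; lia.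
  have -> : e.+1 = h.+1 by apply/eqP; rewrite eqn_leq eh ltn_ord.
  by rewrite modnn leqn0 => /eqP w0; rewrite w0 in c1.
have : e + inZp 1 = inZp ww by rewrite -ew [RHS]inZpS valZpK.
by move=> <-; rewrite -e1 [X in _ - X]addrAC subKr.
Qed.

Hypothesis p_half : forall k, p k <= 1 / 2.

Lemma pr_last_cover m n t k (y c : 'I_h.+1) : (m <= k < n)%N -> 0 <= t ->
  Pr [set om | forall i, (m <= i < n)%N ->
    (if i == k then st i t om == c else ~~ cov (w i) (s i) (st i t om) y)]
  <= 2 / h.+1%:R * \prod_(m <= i < n) (1 - p i).
Proof.
move=> mkn t0; have mn : (m <= n)%N by case/andP: mkn => /leq_trans h1 /ltnW /h1.
pose phi i := (fun e => if i == k then e == c else ~~ cov (w i) (s i) e y).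
rewrite (pr_arcs model mn (fun i _ => @sig_state_pred i t (phi i))).
(* The arc [k] contributes [1 / h.+1]; its missing factor [1 - p k] is restored at the price of a
   factor 2, since [p k <= 1 / 2]. *)
have -> : 2 / h.+1%:R * \prod_(m <= i < n) (1 - p i) =
    \prod_(m <= i < n) ((if i == k then 2 / h.+1%:R else 1) * (1 - p i)).
  by rewrite big_split/= prod_if_one.
apply: ler_prod => i _; rewrite pr_ge0 /= (@pr_state_pred i t (phi i))// /phi.
case: eqP => [->|_]; last by rewrite mul1r sum_not_cov.
have -> : \sum_e ((e == c)%:R : R) = 1.
  by rewrite (bigD1 c)//= eqxx big1 ?addr0// => e /negbTE ->.
have H0 : 0 < (h.+1%:R^-1 : R) by rewrite invr_gt0 ltr0n.
by have := p_half k; move: (p k) (h.+1%:R^-1) H0 => x1 x2; nra.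
Qed.

(** The least uncovered [j] is either 0 or preceded by a site that some arc [k] covers, and then
    [cov_last] fixes the position of this arc. A union bound over the sites would cost a factor [r];
    here the cost [r (n - m) 2 / h.+1] is bounded for blocks of length of order [1 / n]. *)
Lemma pr_static m n t (a : 'I_h.+1) r : (m <= n)%N -> 0 <= t ->
  Pr [set om | exists2 j, (j <= r)%N & uncov m n t (site a j) om]
  <= (1 + r%:R * (n - m)%:R * (2 / h.+1%:R)) * \prod_(m <= i < n) (1 - p i).
Proof.
move=> mn t0; set U := \prod_(m <= i < n) _.
pose E j k := [set om | forall i, (m <= i < n)%N ->
    (if i == k then st i t om == site a j.+1 + inZp (s k) - inZp (w k)
     else ~~ cov (w i) (s i) (st i t om) (site a j.+1))].
have mE j k : measurable (E j k).
  have : sig X (arcs_index [set i | (m <= i < n)%N]) (E j k).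
    exact: (sig_arcs_forall (fun i _ => @sig_state_pred i t (fun e => if i == k
      then e == site a j.+1 + inZp (s k) - inZp (w k) else ~~ cov (w i) (s i) e (site a j.+1)))).
  exact: sig_measurable.
pose B j := [set om | exists2 k, (m <= k < n)%N & E j k om].
have mB j : measurable (B j).
  have -> : B j = \bigcup_(k in [set k | (m <= k < n)%N]) E j k by [].
  by apply: bigcup_measurable => k _.
pose D := [set om | exists2 j, (0 <= j < r)%N & B j om].
have mD : measurable D.
  have -> : D = \bigcup_(k in [set k | (0 <= k < r)%N]) B k by [].
  by apply: bigcup_measurable => k _.
apply: (@le_trans _ _ (Pr (uncov m n t (site a 0) `|` D))).
  apply: le_pr.
  - have -> : [set om | exists2 j, (j <= r)%N & uncov m n t (site a j) om] =
      \bigcup_(j in [set j | (j <= r)%N]) uncov m n t (site a j) by [].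
    by apply: bigcup_measurable => k _; exact: measurable_uncov.
  - by apply: measurableU => //; exact: measurable_uncov.
  - move=> om [j jr uj].
    have ex : exists j, `[< uncov m n t (site a j) om >] by exists j; apply/asboolP.
    case: (ex_minnP ex) => -[|j'] /asboolP uj' jmin; first by left.
    right; exists j'; first by apply: (leq_trans (jmin j _) jr); exact/asboolP.
    have nu : ~ uncov m n t (site a j') om.
      by move=> /asboolP /jmin; rewrite ltnn.
    have [k nk] : exists k, ~ ((m <= k < n)%N -> ~~ cov (w k) (s k) (st k t om) (site a j')).
      by apply/existsNP.
    have [mkn cv] := proj1 (not_implyP _ _) nk; move/negP : cv; rewrite negbK => cv.
    exists k => // i mi; case: eqP => [->|_]; last exact: uj'.
    by apply/eqP; apply: cov_last cv _ => //; exact: uj'.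
apply: le_trans (prU_le (measurable_uncov _ _ _ _) mD) _.
rewrite mulrDl mul1r pr_uncov// lerD2l.
apply: le_trans (pr_exists_le (leq0n r) mB) _.
apply: (@le_trans _ _ (\sum_(0 <= j < r) \sum_(m <= k < n) 2 / h.+1%:R * U)); last first.
  rewrite !sumr_const_nat subn0; apply: le_of_eq.
  by rewrite -mulrnA -[LHS]mulr_natr natrM; ring.
apply: ler_sum_nat => j _; apply: le_trans (pr_exists_le mn (mE j)) _.
by apply: ler_sum_nat => k mkn; exact: pr_last_cover.
Qed.

End discrete_covering.

Section block_estimates.
Context {R : realType} {d : measure_display} {Omega : measurableType d}
  {P : probability Omega R}.
Variables (l : R^nat) (C Y : nat -> nat -> {RV P >-> R}).
Hypothesis model : poisson_covering_model l C Y 0.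
Local Notation Pr := (pr P).
Local Notation X := (resampling_family C Y).
Variable h : nat.
Local Notation st := (state C Y h).
Local Notation arc_sig k := (sig X (arcs_index (@set1 nat k))).
Variables (w s : nat -> nat).
Hypothesis wH : forall k, (w k <= h.+1)%N.
Local Notation p k := ((w k)%:R / h.+1%:R : R).
Local Notation uncov := (uncov C Y w s).

Lemma kernel_not_cov k delta (c y : 'I_h.+1) : ~~ cov (w k) (s k) c y ->
  \sum_c' kernel delta c c' * (~~ cov (w k) (s k) c' y)%:R
  = 1 - (1 - expR (- delta)) * p k :> R.
Proof.
move=> nc; rewrite /kernel; under eq_bigr do rewrite mulrDl.
rewrite big_split /= (bigD1 c)//= eqxx nc big1 ?addr0; last first.
  by move=> c' /negbTE; rewrite eq_sym => ->; rewrite mulr0 mul0r.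
rewrite -mulr_sumr; have := sum_not_cov (R := R) s wH k y.
set S := \sum_c' _; set q := p k => e.
rewrite !mulr1 -mulrA [_^-1 * S]mulrC e; ring.
Qed.

Lemma kernel_sum1 delta (c : 'I_h.+1) : \sum_c' kernel delta c c' = 1 :> R.
Proof.
rewrite /kernel big_split /= (bigD1 c)//= eqxx big1 ?addr0; last first.
  by move=> c' /negbTE; rewrite eq_sym => ->; rewrite mulr0.
rewrite sumr_const card_ord mulr1 -[X in _ + X]mulr_natr -mulrA mulVf ?pnatr_eq0//.
by rewrite mulr1 addrC subrK.
Qed.

Lemma kernel_ge0 delta (c c' : 'I_h.+1) : 0 <= delta -> 0 <= kernel delta c c' :> R.
Proof.
move=> d0; rewrite addr_ge0 ?mulr_ge0 ?expR_ge0//.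
rewrite subr_ge0 -[leRHS]expR0 ler_expR; lra.
Qed.

(** The maximal inequality is applied to the event that some site of the block is uncovered. It
    persists over one step at least when one chosen uncovered site stays uncovered, whence the base
    of the power; [pr_static] treats the final time. *)
Lemma pr_hit_block m n t delta Q (a : 'I_h.+1) r :
  (forall k, p k <= 1 / 2) -> (m <= n)%N -> 0 <= t -> 0 <= delta ->
  (\prod_(m <= k < n) (1 - (1 - expR (- delta)) * p k)) ^+ Q *
  Pr [set om | exists2 i, (i <= Q)%N & exists2 j, (j <= r)%N &
                 uncov m n (t + i%:R * delta) (site a j) om]
  <= (1 + r%:R * (n - m)%:R * (2 / h.+1%:R)) * \prod_(m <= i < n) (1 - p i).
Proof.
move=> p_half mn t0 d0.
pose f := [pred v : {ffun 'I_n -> 'I_h.+1} | [exists j : 'I_r.+1,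
  [forall k : 'I_n, (m <= k)%N ==> ~~ cov (w k) (s k) (v k) (site a j)]]].
have fE u om : f (config C Y h n u om) <->
    exists2 j, (j <= r)%N & uncov m n u (site a j) om.
  split.
    move=> /existsP[j /forallP fj]; exists j; first by rewrite -ltnS.
    move=> k /andP[mk kn]; have := fj (Ordinal kn).
    by rewrite mk /= ffunE.
  move=> [j jr uj]; apply/existsP; exists (inord j : 'I_r.+1).
  apply/forallP => k; apply/implyP => mk; rewrite ffunE inordK ?ltnS//.
  by apply: uj; rewrite mk /=.
have p0 k : 0 <= p k by rewrite divr_ge0.
have e1 : 0 <= 1 - expR (- delta) <= 1.
  rewrite subr_ge0 -[leRHS]expR0 ler_expR oppr_le0 d0 /=.
  by rewrite lerBlDr lerDl expR_ge0.
set cc := \prod_(m <= k < n) _.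
have fac k : 0 <= 1 - (1 - expR (- delta)) * p k <= 1.
  have := p_half k; have := p0 k; move: e1 => /andP[]; move: (1 - _) (p k) => x1 x2.
  by move=> ? ? ? ?; apply/andP; split; nra.
have cc0 : 0 <= cc.
  by apply: prodr_ge0 => k _; have /andP[] := fac k.
have cc1 : cc <= 1.
  by apply: prodr_ile1 => k _; exact: fac.
have stay v : f v -> cc <= \sum_(v' | f v') kernels delta v v'.
  move=> /existsP[j /forallP fj].
  (* Expanding the product of one-arc sums gives a sum over configurations [v']; the terms whose
     indicators do not vanish leave the same site [j] uncovered, hence satisfy [f]. *)
  pose G (k : 'I_n) c := kernel delta (v k) c *
    (if (m <= k)%N then (~~ cov (w k) (s k) c (site a j))%:R else 1).
  have -> : cc = \prod_(k < n) \sum_c G k c.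
    rewrite /cc big_geq_mkord big_mkcond /=; apply: eq_bigr => k _; rewrite /G.
    case: ifPn => mk; last by under eq_bigr do rewrite mulr1; rewrite kernel_sum1.
    by rewrite kernel_not_cov//; have := fj k; rewrite mk.
  rewrite bigA_distr_bigA /= [leRHS]big_mkcond /=; apply: ler_sum => v' _.
  rewrite big_split /= -/(kernels delta v v').
  have k0 : 0 <= kernels delta v v' by apply: prodr_ge0 => k _; exact: kernel_ge0.
  case: ifPn => [_|nf].
    rewrite ler_piMr//; apply: prodr_ile1 => k _; case: ifP => _; last by rewrite ler01 lexx.
    by case: cov; rewrite ?lexx ?ler01.
  have [k mk ck] : exists2 k : 'I_n, (m <= k)%N & cov (w k) (s k) (v' k) (site a j).
    move: nf; rewrite negb_exists => /forallP/(_ j); rewrite negb_forall.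
    by move=> /existsP[k]; rewrite negb_imply negbK => /andP[]; exists k.
  by rewrite [X in _ * X](bigD1 k)//= mk ck mul0r mulr0.
have e2 : [set om | f (config C Y h n (t + Q%:R * delta) om)] =
    [set om | exists2 j, (j <= r)%N & uncov m n (t + Q%:R * delta) (site a j) om].
  by apply/seteqP; split => om /fE.
have e3 : hit C Y delta f t Q = [set om | exists2 i, (i <= Q)%N &
    exists2 j, (j <= r)%N & uncov m n (t + i%:R * delta) (site a j) om].
  by apply/seteqP; split => om /= [i iQ] /fE; exists i.
have le := pr_hit model d0 cc0 cc1 stay Q t0.
rewrite -e3; apply: (le_trans le).
apply: (@le_trans _ _ (Pr [set om | exists2 j, (j <= r)%N &
    uncov m n (t + Q%:R * delta) (site a j) om])); first by rewrite -e2.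
have tQ : 0 <= t + Q%:R * delta by rewrite addr_ge0// mulr_ge0.
exact: (pr_static model s wH p_half a r mn tQ).
Qed.

Definition cover_block k t delta Q (a : 'I_h.+1) r : set Omega :=
  [set om | forall i, (i < Q.+1)%N -> forall j, (j < r.+1)%N ->
     cov (w k) (s k) (st k (t + i%:R * delta) om) (site a j)].

Lemma sig_cover_block k t delta Q a r : arc_sig k (cover_block k t delta Q a r).
Proof.
apply: (@sig_forall _ _ _ P _ X _ [set i | (i < Q.+1)%N]
  (fun i => [set om | forall j, (j < r.+1)%N ->
     cov (w k) (s k) (st k (t + i%:R * delta) om) (site a j)])) => i _.
apply: (@sig_forall _ _ _ P _ X _ [set j | (j < r.+1)%N]
  (fun j => [set om | cov (w k) (s k) (st k (t + i%:R * delta) om) (site a j)])) => j _.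
exact: (@sig_state_pred _ _ _ P C Y h k _ (fun c => cov (w k) (s k) c (site a j))).
Qed.

Lemma pr_constant k t delta Q (c : 'I_h.+1) : 0 <= t -> 0 <= delta ->
  expR (- delta) ^+ Q / h.+1%:R <=
  Pr [set om | forall i, (i < Q.+1)%N -> st k (t + i%:R * delta) om = c].
Proof.
move=> t0 d0; pose E q := [set om | forall i, (i < q.+1)%N -> st k (t + i%:R * delta) om = c].
have tq q : 0 <= t + q%:R * delta by rewrite addr_ge0// mulr_ge0.
have ES q : E q.+1 = E q `&` st k (t + q.+1%:R * delta) @^-1` [set c].
  apply/seteqP; split => om /=.
    by move=> Eq; split => [i iq|]; apply: Eq => //; exact: ltnW.
  by move=> [Eq e] i; rewrite ltnS leq_eqVlt => /predU1P[->//|]; exact: Eq.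
have E0 : E 0%N = st k t @^-1` [set c].
  apply/seteqP; split => om /=; first by move=> /(_ 0%N isT); rewrite mul0r addr0.
  by move=> e [|i]//; rewrite mul0r addr0.
have Ea q : [/\ measurable (E q), adapted C Y k (t + q%:R * delta) (E q) &
    E q `<=` st k (t + q%:R * delta) @^-1` [set c]].
  elim: q => [|q [mE aE _]].
    rewrite E0 mul0r addr0; split => //; first exact: measurable_state.
    exact: adapted_state.
  have le : t + q%:R * delta <= t + q.+1%:R * delta.
    by rewrite lerD2l ler_wpM2r// ler_nat.
  rewrite ES; split.
  - by apply: measurableI => //; exact: measurable_state.
  - apply: adaptedI; last exact: adapted_state.
    exact: adapted_le (tq q) le aE.
  - by move=> om [].
rewrite -/(E Q); elim: Q => [|q IH].
  by rewrite expr0 E0 (pr_state model)// mul1r.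
have [mE aE Ec] := Ea q.
have le : t + q%:R * delta <= t + q.+1%:R * delta.
  by rewrite lerD2l ler_wpM2r// ler_nat.
rewrite ES (markov model c (tq q) le mE aE Ec).
rewrite (_ : t + q.+1%:R * delta - (t + q%:R * delta) = delta); last first.
  by rewrite -natr1; ring.
rewrite exprS -mulrA; apply: ler_pM; [exact: expR_ge0| | |exact: IH].
  by rewrite mulr_ge0 ?exprn_ge0 ?expR_ge0 ?invr_ge0.
rewrite /kernel eqxx mulr1 lerDl mulr_ge0 ?invr_ge0//.
by rewrite subr_ge0 -[leRHS]expR0 ler_expR; lra.
Qed.

Lemma cov_site (ww r ss : nat) (c a : 'I_h.+1) j : (ww <= h.+1)%N -> (j <= r)%N ->
  cov (ww - r) ss c a -> cov ww ss c (site a j).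
Proof.
rewrite /cov /site => wwh jr.
rewrite (_ : a + inZp j - c + inZp ss = (a - c + inZp ss) + inZp j); last first.
  by rewrite [a + inZp j - c]addrAC [LHS]addrAC.
set e := a - c + inZp ss; clearbody e => ew.
have vE : (nat_of_ord (e + inZp j)%R = (e + j) %% h.+1)%N by rewrite /= modnDmr.
by rewrite vE modn_small//; lia.
Qed.

(** It suffices that the arc starts in one of the [w k - r] positions covering the whole width of
    the block and is in this position at every time of the block. *)
Lemma pr_cover_block k t delta Q (a : 'I_h.+1) r : 0 <= t -> 0 <= delta ->
  (w k - r)%:R / h.+1%:R * expR (- delta) ^+ Q <= Pr (cover_block k t delta Q a r).
Proof.
move=> t0 d0.
have mB : measurable (cover_block k t delta Q a r).
  have sB : arc_sig k (cover_block k t delta Q a r) by exact: sig_cover_block.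
  exact: sig_measurable sB.
have := @pr_fibres _ _ _ P _ (st k t) (cover_block k t delta Q a r) mB
  (fun c => @measurable_state _ _ _ P C Y h k t c) xpredT.
rewrite (_ : [set om | xpredT (st k t om)] = setT); last by apply/seteqP; split.
rewrite setIT => ->.
have wr : (w k - r <= h.+1)%N by rewrite (leq_trans (leq_subr _ _) (wH k)).
rewrite -(sum_cov (R := R) (s k) a wr) -mulrA mulr_suml.
apply: ler_sum => c _.
have [cv|_] := boolP (cov (w k - r) (s k) c a); last by rewrite mul0r pr_ge0.
rewrite mul1r mulrC; apply: (le_trans (pr_constant k Q c t0 d0)).
pose E := [set om | forall i, (i < Q.+1)%N -> st k (t + i%:R * delta) om = c].
have sE : arc_sig k E.
  apply: (@sig_forall _ _ _ P _ X _ [set i | (i < Q.+1)%N]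
    (fun i => st k (t + i%:R * delta) @^-1` [set c])) => i _; exact: sig_state.
apply: (@le_pr _ _ _ P E).
- exact: sig_measurable sE.
- by apply: measurableI => //; exact: measurable_state.
- move=> om Eom; split; last by have := Eom 0%N isT; rewrite mul0r addr0.
  move=> i iQ j jr; rewrite (Eom i iQ).
  by apply: (cov_site (wH k) _ cv); rewrite -ltnS.
Qed.

End block_estimates.

(** * Covering the remaining blocks by later arcs *)

Section thinning.
Context {R : realType} {d : measure_display} {Omega : measurableType d}
  {P : probability Omega R}.
Local Notation Pr := (pr P).
Variables (T : finType) (A : T -> set Omega).
Hypothesis mA : forall x, measurable (A x).

Definition pattern (om : Omega) : {set T} := [set x | `[< A x om >]]%SET.

Lemma patternE S om :
  pattern om = S <-> forall x, (if x \in S then A x om else ~ A x om).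
Proof.
split=> [<- x|h]; first by rewrite inE; case: ifPn => /asboolP.
apply/setP => x; rewrite inE; have := h x; case: ifP => _ a; exact/asboolP.
Qed.

Lemma measurable_pattern S : measurable (pattern @^-1` [set S]).
Proof.
have -> : pattern @^-1` [set S] =
    \bigcap_(x in [set: T]) (if x \in S then A x else ~` A x).
  apply/seteqP; split => om /=.
    by move=> /patternE h x _; have := h x; case: ifP.
  by move=> h; apply/patternE => x; have := h x Logic.I; case: ifP.
apply: fin_bigcap_measurable => // x _; case: ifP => _ //; exact: measurableC.
Qed.

Lemma pr_pattern (D : set Omega) (phi : pred {set T}) : measurable D ->
  Pr (D `&` [set om | phi (pattern om)]) =
  \sum_(S | phi S) Pr (D `&` pattern @^-1` [set S]).
Proof. by move=> mD; apply: pr_fibres => //; exact: measurable_pattern. Qed.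

Lemma sum_pr_pattern : \sum_x Pr (A x) =
  \sum_(S : {set T}) #|S|%:R * Pr (pattern @^-1` [set S]).
Proof.
transitivity (\sum_x \sum_(S : {set T} | x \in S) Pr (pattern @^-1` [set S])).
  apply: eq_bigr => x _.
  have := @pr_pattern setT (fun S => x \in S) measurableT; rewrite setTI.
  have -> : [set om | x \in pattern om] = A x.
    by apply/seteqP; split => om /=; rewrite inE => /asboolP.
  by move=> ->; apply: eq_bigr => S _; rewrite setTI.
rewrite (exchange_big_dep xpredT)//=; apply: eq_bigr => S _.
by rewrite sumr_const mulr_natl.
Qed.

(* Either more than [K] of the [A x] occur, which Markov's inequality controls,
   or, given which of them occur, [N] loses a factor [1 - e]. *)
Lemma pr_thinning (N : set Omega) (K : nat) (e : R) : measurable N ->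
  0 <= e <= 1 -> (0 < K)%N ->
  N `<=` [set om | exists x, A x om] ->
  (forall S : {set T}, (#|S| <= K)%N ->
     Pr (N `&` pattern @^-1` [set S]) <= (1 - e) * Pr (pattern @^-1` [set S])) ->
  Pr N <= (1 - e) * Pr [set om | exists x, A x om] + e * ((\sum_x Pr (A x)) / K%:R).
Proof.
move=> mN /andP[e0 e1] K0 NA hS.
pose q S := Pr (pattern @^-1` [set S]).
have q0 S : 0 <= q S by exact: pr_ge0.
have mNS S : measurable (N `&` pattern @^-1` [set S]).
  by apply: measurableI => //; exact: measurable_pattern.
have -> : Pr N = \sum_(S | S != finset.set0) Pr (N `&` pattern @^-1` [set S]).
  rewrite -(@pr_pattern N (fun S => S != finset.set0))//; congr Pr.
  apply/seteqP; split => om; last by case.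
  move=> Nom; split => //=; have [x Ax] := NA _ Nom.
  by apply/set0Pn; exists x; rewrite inE; apply/asboolP.
have -> : Pr [set om | exists x, A x om] = \sum_(S | S != finset.set0) q S.
  have := @pr_pattern setT (fun S => S != finset.set0) measurableT; rewrite setTI.
  under [in X in _ = X -> _]eq_bigr do rewrite setTI.
  move=> <-; congr Pr; apply/seteqP; split => om /=.
    by move=> [x Ax]; apply/set0Pn; exists x; rewrite inE; apply/asboolP.
  by move=> /set0Pn[x]; rewrite inE => /asboolP; exists x.
rewrite sum_pr_pattern.
(* Patterns with at most [K] elements get the weight [1 - e], the larger ones the full weight
   [(1 - e) + e]; Markov's inequality bounds the total of the latter. *)
pose y : R := (1 - e) * (\sum_(S : {set T} | S != finset.set0) q S) +
    e * \sum_(S : {set T} | (K < #|S|)%N) q S.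
apply: (@le_trans _ _ y); rewrite /y; last first.
  rewrite lerD2l ler_wpM2l// ler_pdivlMr ?ltr0n// mulr_suml big_mkcond /=.
  apply: ler_sum => S _; case: ifPn => KS; last by rewrite mulr_ge0 ?ler0n ?pr_ge0.
  by rewrite mulrC ler_wpM2r// ler_nat ltnW.
rewrite !mulr_sumr [in X in _ + X]big_mkcond [in X in X + _]big_mkcond /= -big_split /=.
rewrite [leLHS]big_mkcond; apply: ler_sum => S _ /=.
have [S0|S0] /= := boolP (S != finset.set0); last first.
  by rewrite add0r; case: ifP => _ //; rewrite mulr_ge0.
have [KS|SK] := ltnP K #|S|.
  rewrite -mulrDl subrK mul1r; apply: le_pr => //; first exact: measurable_pattern.
by rewrite addr0; exact: hS.
Qed.

End thinning.

Section sequential_cover.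
Context {R : realType} {d : measure_display} {Omega : measurableType d}
  {P : probability Omega R}.
Variables (l : R^nat) (C Y : nat -> nat -> {RV P >-> R}).
Hypothesis model : poisson_covering_model l C Y 0.
Local Notation Pr := (pr P).
Local Notation X := (resampling_family C Y).
Local Notation arc_sig k := (sig X (arcs_index (@set1 nat k))).
Local Notation before n := (sig X (arcs_index [set k | (k < n)%N])).
Variables (T : Type) (D : nat -> T -> set Omega) (g : nat) (e : R).
Hypothesis sD : forall k x, arc_sig k (D k x).
Hypothesis e_ge0 : 0 <= e.

(** Each element has its own group of [g] consecutive arcs, so the successes of different elements
    are independent. *)
Fixpoint cover_seq (s : seq T) (n : nat) : set Omega :=
  if s is x :: s' then
    [set om | exists2 k, (n <= k < n + g)%N & D k x om] `&` cover_seq s' (n + g)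
  else setT.

Lemma before_le n n' A : (n <= n')%N -> before n A -> before n' A.
Proof.
move=> nn'; apply: sig_sub; apply: sub_arcs_index => k /= kn.
exact: leq_trans kn nn'.
Qed.

Lemma pr_cover_seq (s : seq T) (n N : nat) E :
  (forall n' x, (n' + g <= N)%N ->
     e <= Pr [set om | exists2 k, (n' <= k < n' + g)%N & D k x om]) ->
  (n + size s * g <= N)%N -> before n E ->
  e ^+ size s * Pr E <= Pr (E `&` cover_seq s n).
Proof.
move=> De; elim: s n E => [|x s IH] n E /= nN sE.
  by rewrite expr0 mul1r setIT.
pose B := [set om | exists2 k, (n <= k < n + g)%N & D k x om].
have sB : sig X (arcs_index [set k | (n <= k < n + g)%N]) B.
  apply: (@sig_exists _ _ _ P _ X _ [set k | (n <= k < n + g)%N] (fun k => D k x)) => k /= nk.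
  by apply: sig_sub (@sD k x); apply: sub_arcs_index => _ ->.
rewrite setIA.
apply: le_trans (IH (n + g)%N (E `&` B) _ _); last 2 first.
- by rewrite -addnA -mulSn.
- apply: sigI; first by apply: before_le sE; exact: leq_addr.
  by apply: sig_sub sB; apply: sub_arcs_index => k /= /andP[].
rewrite exprSr -mulrA ler_wpM2l ?exprn_ge0//.
have -> : Pr (E `&` B) = Pr E * Pr B.
  apply: (@sig_indep _ _ _ P _ X (family_indep model)) sE sB.
  apply/seteqP; split => // -[] [a b] [/= h1 /andP[h2 _]];
  by rewrite ltnNge h2 in h1.
rewrite mulrC ler_wpM2l ?pr_ge0//; apply: De.
by apply: leq_trans nN; rewrite mulSn addnA leq_addr.
Qed.

End sequential_cover.

Section finite_closure.
Context {R : realType} {d : measure_display} {Omega : measurableType d}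
  {P : probability Omega R} {I : choiceType} (X : I -> {RV P >-> R}).

Lemma sig_exists_fin S (T : finType) (F : T -> set Omega) :
  (forall x, sig X S (F x)) -> sig X S [set om | exists x, F x om].
Proof.
move=> sF; pose G k := if unpickle k is Some x then F x else set0.
have -> : [set om | exists x, F x om] = [set om | exists2 k, setT k & G k om].
  apply/seteqP; split => om /=.
    by move=> [x Fx]; exists (pickle x) => //; rewrite /G pickleK.
  by move=> [k _]; rewrite /G; case: unpickle => // x Fx; exists x.
apply: sig_exists => k _; rewrite /G; case: unpickle => [x|]; last exact: sig0.
exact: sF.
Qed.

Lemma sig_forall_fin S (T : finType) (F : T -> set Omega) :
  (forall x, sig X S (F x)) -> sig X S [set om | forall x, F x om].
Proof.
move=> sF; have -> : [set om | forall x, F x om] = ~` [set om | exists x, (~` F x) om].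
  apply/seteqP; split => om /=; first by move=> h [x]; apply; exact: h.
  by move=> h x; apply: contrapT => nF; apply: h; exists x.
by apply: sigC; apply: sig_exists_fin => x; apply: sigC; exact: sF.
Qed.

End finite_closure.

Section recursion.
Context {R : realType} {d : measure_display} {Omega : measurableType d}
  {P : probability Omega R}.
Variables (l : R^nat) (C Y : nat -> nat -> {RV P >-> R}).
Hypothesis model : poisson_covering_model l C Y 0.
Local Notation Pr := (pr P).
Local Notation X := (resampling_family C Y).
Local Notation before n := (sig X (arcs_index [set k | (k < n)%N])).
Variables (h : nat) (w s : nat -> nat).
Hypothesis wH : forall k, (w k <= h.+1)%N.
Local Notation p k := ((w k)%:R / h.+1%:R : R).
Hypothesis p_half : forall k, p k <= 1 / 2.
Variable M : nat.
Local Notation delta := (M%:R^-1 : R).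
Local Notation uncov := (@uncov _ _ _ _ C Y h w s).

Definition noncov m n : set Omega :=
  [set om | exists2 i, (i <= M)%N & exists y, uncov m n (i%:R * delta) y om].

(* The uncovered points of the block with indices [a] in space and [b] in time;
   a block consists of [r.+1] sites and [q.+1] times. *)
Definition block m n (r q : nat) (a b : nat) : set Omega :=
  [set om | exists2 i, (i <= M)%N && (i %/ q.+1 == b)%N &
     exists2 y : 'I_h.+1, (y %/ r.+1 == a)%N & uncov m n (i%:R * delta) y om].

Lemma sig_uncov_before m n t y : before n (uncov m n t y).
Proof.
have sU : sig X (arcs_index [set k | (m <= k < n)%N]) (uncov m n t y).
  exact: sig_uncov.
by apply: sig_sub sU; apply: sub_arcs_index => k /= /andP[].
Qed.

Lemma sig_block m n r q a b : before n (block m n r q a b).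
Proof.
apply: (@sig_exists _ _ _ P _ X _ [set i | (i <= M)%N && (i %/ q.+1 == b)%N]
  (fun i => [set om | exists2 y : 'I_h.+1, (y %/ r.+1 == a)%N &
     uncov m n (i%:R * delta) y om])) => i _.
pose F (y : 'I_h.+1) := if (y %/ r.+1 == a)%N then uncov m n (i%:R * delta) y else set0.
have -> : [set om | exists2 y : 'I_h.+1, (y %/ r.+1 == a)%N &
    uncov m n (i%:R * delta) y om] = [set om | exists y, F y om].
  apply/seteqP; split => om /= [y].
    by move=> ya u; exists y; rewrite /F ya.
  by rewrite /F; case: ifP => // ya u; exists y.
apply: sig_exists_fin => y; rewrite /F; case: ifP => _; last exact: sig0.
exact: sig_uncov_before.
Qed.

Lemma sig_noncov m n : before n (noncov m n).
Proof.
apply: (@sig_exists _ _ _ P _ X _ [set i | (i <= M)%N]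
  (fun i => [set om | exists y, uncov m n (i%:R * delta) y om])) => i _.
by apply: sig_exists_fin => y; exact: sig_uncov_before.
Qed.

Lemma measurable_noncov m n : measurable (noncov m n).
Proof. exact: sig_measurable (@sig_noncov m n). Qed.

Lemma pr_block m n r q (a b : nat) : (m <= n)%N ->
  (\prod_(m <= k < n) (1 - (1 - expR (- delta)) * p k)) ^+ q *
  Pr (block m n r q a b)
  <= (1 + r%:R * (n - m)%:R * (2 / h.+1%:R)) * \prod_(m <= i < n) (1 - p i).
Proof.
move=> mn; have d0 : 0 <= delta by rewrite invr_ge0.
have t0 : 0 <= (b * q.+1)%:R * delta by rewrite mulr_ge0.
(* The last blocks may go beyond time 1 or wrap around the circle; this only enlarges the event to
   which [pr_hit_block] applies. *)
apply: le_trans (pr_hit_block model s wH q (inZp (a * r.+1)) r p_half mn t0 d0).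
rewrite ler_wpM2l//.
  apply: exprn_ge0; apply: prodr_ge0 => k _; rewrite subr_ge0.
  apply: (@le_trans _ _ (1 * p k)); last first.
    by rewrite mul1r (le_trans (p_half k))//; lra.
  by rewrite ler_wpM2r ?divr_ge0// lerBlDr lerDl expR_ge0.
apply: le_pr.
- have := @sig_block m n r q a b; exact: sig_measurable.
- have -> : [set om | exists2 i, (i <= q)%N & exists2 j, (j <= r)%N &
      uncov m n ((b * q.+1)%:R * delta + i%:R * delta) (site (inZp (a * r.+1)) j) om] =
    \bigcup_(i in [set i | (i <= q)%N]) \bigcup_(j in [set j | (j <= r)%N])
      uncov m n ((b * q.+1)%:R * delta + i%:R * delta) (site (inZp (a * r.+1)) j) by [].
  apply: bigcup_measurable => i _; apply: bigcup_measurable => j _.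
  exact: measurable_uncov.
- move=> om [i /andP[_ /eqP ib] [y /eqP ya u]].
  exists (i %% q.+1)%N; first by rewrite -ltnS ltn_mod.
  exists (y %% r.+1)%N; first by rewrite -ltnS ltn_mod.
  rewrite -mulrDl -natrD -ib -divn_eq.
  suff -> : site (inZp (a * r.+1)) (y %% r.+1) = y by [].
  apply/val_inj; rewrite /site /= modnDm -ya -divn_eq modn_small//.
Qed.

(* Given the set of at most [K] blocks met by the uncovered set of the first
   [n] arcs, [K] successive groups of [g'] later arcs cover one of them each. *)
Lemma noncov_recursion m n (r q G g K g' : nat) (e : R) :
  (m <= n)%N -> (h.+1 <= G * r.+1)%N -> (M < g * q.+1)%N ->
  (0 < K)%N -> (K * g' <= n)%N -> 0 <= e <= 1 ->
  (forall n' a b, (n' + g' <= n + n)%N ->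
     e <= Pr [set om | exists2 k, (n' <= k < n' + g')%N &
       cover_block C Y w s k ((b * q.+1)%:R * delta) delta q (inZp (a * r.+1) : 'I_h.+1) r om]) ->
  Pr (noncov m (n + n)) <= (1 - e ^+ K) * Pr (noncov m n) +
    e ^+ K * ((\sum_(ab : 'I_G * 'I_g) Pr (block m n r q ab.1 ab.2)) / K%:R).
Proof.
move=> mn HG Mg K0 Kn /andP[e0 e1] hcov.
pose A (ab : 'I_G * 'I_g) := block m n r q ab.1 ab.2.
have sA ab : before n (A ab) by exact: sig_block.
have mA ab : measurable (A ab) := sig_measurable (sA ab).
have blockP i (y : 'I_h.+1) om : (i <= M)%N -> uncov m n (i%:R * delta) y om ->
    exists ab : 'I_G * 'I_g, A ab om /\ (i %/ q.+1 = ab.2 /\ y %/ r.+1 = ab.1)%N.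
  move=> iM u.
  have aG : (y %/ r.+1 < G)%N by rewrite ltn_divLR// (leq_trans (ltn_ord y)).
  have bg : (i %/ q.+1 < g)%N by rewrite ltn_divLR// (leq_ltn_trans iM).
  exists (Ordinal aG, Ordinal bg); split => //.
  by exists i; [rewrite iM /=|exists y].
have union : [set om | exists x, A x om] = noncov m n.
  apply/seteqP; split => om /=.
    by move=> [x [i /andP[iM _] [y _ u]]]; exists i => //; exists y.
  by move=> [i iM [y u]]; have [ab [? _]] := blockP _ _ _ iM u; exists ab.
have mono om i y : uncov m (n + n) (i%:R * delta) y om -> uncov m n (i%:R * delta) y om.
  by move=> u k /andP[mk kn]; apply: u; rewrite mk (leq_trans kn)// leq_addr.
rewrite -[in X in _ * X + _]union.
apply: pr_thinning => //.
- exact: measurable_noncov.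
- by rewrite exprn_ge0//= exprn_ile1.
- by move=> om [i iM [y /mono u]]; rewrite union; exists i => //; exists y.
move=> S SK; set B := pattern A @^-1` [set S].
have sB : before n B.
  have -> : B = [set om | forall x, (if x \in S then A x else ~` A x) om].
    apply/seteqP; split => om.
      by move=> /patternE hh x; have := hh x; case: ifP.
    by move=> hh; apply/patternE => x; have := hh x; case: ifP.
  apply: sig_forall_fin => x; case: ifP => _; first exact: sA.
  by apply: sigC; exact: sA.
pose D k (ab : 'I_G * 'I_g) := cover_block C Y w s k ((ab.2 * q.+1)%:R * delta) delta q
  (inZp (ab.1 * r.+1) : 'I_h.+1) r.
have sD k ab : sig X (arcs_index (@set1 nat k)) (D k ab) by exact: sig_cover_block.
have mB : measurable B := sig_measurable sB.
have mN := measurable_noncov m (n + n).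
have szS : size (enum S) = #|S| by rewrite cardE.
have hc : e ^+ #|S| * Pr B <= Pr (B `&` cover_seq D g' (enum S) n).
  rewrite -szS; apply: (pr_cover_seq model sD e0 _ _ sB (N := (n + n)%N)).
    by move=> n' ab n'n; exact: hcov.
  by rewrite szS leq_add2l (leq_trans _ Kn)// leq_mul2r SK orbT.
have mono_cov (t : seq ('I_G * 'I_g)) : forall n1 om ab, cover_seq D g' t n1 om -> ab \in t ->
    exists2 k, (n1 <= k < n1 + size t * g')%N & D k ab om.
  elim: t => [//|x t IH] n1 om ab [[k /andP[k1 k2] Dk] ct].
  rewrite inE => /predU1P[->|abt].
    by exists k => //; rewrite k1 /= mulSn addnA (leq_trans k2)// leq_addr.
  have [k' /andP[k1' k2'] Dk'] := IH _ _ _ ct abt.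
  by exists k' => //; rewrite (leq_trans (leq_addr _ _) k1') /= mulSn addnA.
(* A point missed by all the arcs in [[m, 2 n)] lies in a block of [S], but an arc of index in
   [[n, 2 n)] covers this block at all its sites and times. *)
have disj : noncov m (n + n) `&` B `&` cover_seq D g' (enum S) n = set0.
  apply/seteqP; split => // om [[[i iM [y u]] Bom] cv].
  have [ab [Aab [ib ya]]] := blockP _ _ _ iM (mono _ _ _ u).
  have abS : ab \in enum S.
    rewrite mem_enum; move: Bom => /patternE /(_ ab); by case: ifP.
  have [k /andP[nk kn] Dk] := mono_cov _ _ _ _ cv abS.
  have : (m <= k < n + n)%N.
    rewrite (leq_trans mn nk) (leq_trans kn)// leq_add2l szS.
    by rewrite (leq_trans _ Kn)// leq_mul2r SK orbT.
  move=> /u /negP; apply.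
  have := Dk (i %% q.+1)%N (ltn_pmod _ _) (y %% r.+1)%N (ltn_pmod _ _).
  rewrite -mulrDl -natrD -ib -divn_eq => /(_ isT isT).
  suff -> : site (inZp (ab.1 * r.+1)) (y %% r.+1) = y by [].
  by apply/val_inj; rewrite /site /= modnDm -ya -divn_eq modn_small.
have mCS0 t : forall n1, measurable (cover_seq D g' t n1).
  elim: t => //= x t IH n1; apply: measurableI => //.
  have -> : [set om | exists2 k, (n1 <= k < n1 + g')%N & D k x om] =
     \bigcup_(k in [set k | (n1 <= k < n1 + g')%N]) D k x by [].
  by apply: bigcup_measurable => k _; exact: sig_measurable (@sD k x).
have mCS := mCS0 (enum S) n.
have mNB : measurable (noncov m (n + n) `&` B) by exact: measurableI.
rewrite (@pr_setI_setC _ _ _ P _ _ mNB mCS) disj pr0 add0r.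
apply: (@le_trans _ _ (Pr (B `&` ~` cover_seq D g' (enum S) n))).
  apply: le_pr; try by apply: measurableI => //; exact: measurableC.
  by move=> om [[_ Bo] no].
have := @pr_setI_setC _ _ _ P _ _ mB mCS.
(* Fewer blocks need fewer groups, and the bound with exponent [K] is the weaker one because
   [e <= 1]. *)
have : e ^+ K * Pr B <= e ^+ #|S| * Pr B.
  by rewrite ler_wpM2r ?pr_ge0// ler_wiXn2l.
by rewrite mulrBl mul1r; move: hc; lra.
Qed.

End recursion.

(** * Covering every point at every time *)

Section elementary_estimates.
Context {R : realType}.

Lemma le_oneB_expR (z : R) : 1 - z <= expR (- z).
Proof. exact: expR_ge1Dx. Qed.

Lemma expRN2_le (z : R) : 0 <= z <= 1 / 2 -> expR (- (2 * z)) <= 1 - z.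
Proof.
move=> /andP[z0 z1]; rewrite expRN -[leLHS]mul1r ler_pdivrMr ?expR_gt0//.
apply: (@le_trans _ _ ((1 - z) * (1 + 2 * z))); first by nra.
by rewrite ler_wpM2l ?expR_ge1Dx//; lra.
Qed.

Lemma natr_divn_le (a b : nat) : (0 < b)%N -> (a %/ b)%:R <= a%:R / b%:R :> R.
Proof.
by move=> b0; rewrite ler_pdivlMr ?ltr0n// -natrM ler_nat leq_trunc_div.
Qed.

Lemma ln_natS_sub (n : nat) : (0 < n)%N ->
  n.+1%:R^-1 <= ln n.+1%:R - ln n%:R :> R.
Proof.
move=> n0; have n0' : 0 < n%:R :> R by rewrite ltr0n.
have n1 : 0 < n.+1%:R :> R by rewrite ltr0n.
have : ln (1 + - n.+1%:R^-1) <= - n.+1%:R^-1 :> R.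
  by apply: le_ln1Dx; rewrite ltrN2 invf_lt1// ltr1n ltnS.
have -> : 1 + - n.+1%:R^-1 = n%:R / n.+1%:R :> R.
  by rewrite -natr1; field; rewrite natr1 gt_eqF.
by rewrite lnM ?posrE ?invr_gt0// lnV ?posrE// lerNr opprB.
Qed.

Lemma harmonic_le_ln (n : nat) : (0 < n)%N ->
  \sum_(k < n) k.+1%:R^-1 <= 1 + ln n%:R :> R.
Proof.
elim: n => // -[_ _|n IH _]; first by rewrite big_ord_recr big_ord0 /= invr1 ln1; lra.
rewrite big_ord_recr /=; have := IH isT; have := @ln_natS_sub n.+1 isT.
by move: (ln _) (ln _) (\sum_(_ < _) _) (_^-1) => x1 x2 x3 x4; lra.
Qed.

Lemma ln_le_harmonic (n : nat) : ln n.+1%:R <= \sum_(k < n) k.+1%:R^-1 :> R.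
Proof.
elim: n => [|n IH]; first by rewrite big_ord0 ln1.
rewrite big_ord_recr /=; apply: le_trans (lerD IH (lexx _)).
have n1 : 0 < n.+1%:R :> R by rewrite ltr0n.
have -> : n.+2%:R = n.+1%:R * (1 + n.+1%:R^-1) :> R.
  by rewrite mulrDr mulr1 divff ?gt_eqF// natr1.
have i0 : 0 < n.+1%:R^-1 :> R by rewrite invr_gt0.
have -> : ln (n.+1%:R * (1 + n.+1%:R^-1)) = ln n.+1%:R + ln (1 + n.+1%:R^-1) :> R.
  by apply: lnM; rewrite posrE//; apply: addr_gt0.
rewrite lerD2l; apply: le_ln1Dx; apply: lt_trans i0.
by rewrite ltrN10.
Qed.

End elementary_estimates.

Section inner_discretisation.
Context {R : realType}.
Variables (l : R^nat) (M0 M1 : R).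
Hypothesis l_pos : forall n, 0 < l n.
Hypothesis l_decr : nonincreasing_seq l.
Hypothesis M0_pos : 0 < M0.
Hypothesis l_bounds : forall n, M0 / n.+1%:R <= l n <= M1 / n.+1%:R.

Definition partial_sum (n : nat) : R := \sum_(k < n) l k.

Lemma partial_sum_ge0 n : 0 <= partial_sum n.
Proof. by apply: sumr_ge0 => k _; exact: ltW. Qed.

Lemma M1_gt0 : 0 < M1.
Proof.
have /andP[h1 h2] := l_bounds 0%N; rewrite !divr1 in h1 h2.
exact: lt_le_trans M0_pos (le_trans h1 h2).
Qed.

Lemma partial_sum_le n : (0 < n)%N -> partial_sum n <= M1 * (1 + ln n%:R).
Proof.
move=> n0; apply: (@le_trans _ _ (M1 * \sum_(k < n) k.+1%:R^-1)).
  rewrite mulr_sumr; apply: ler_sum => k _; by have /andP[] := l_bounds k.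
by rewrite ler_wpM2l ?(ltW M1_gt0)// harmonic_le_ln.
Qed.

Lemma partial_sum_ge n : M0 * ln n.+1%:R <= partial_sum n.
Proof.
apply: (@le_trans _ _ (M0 * \sum_(k < n) k.+1%:R^-1)).
  by rewrite ler_wpM2l ?(ltW M0_pos)// ln_le_harmonic.
rewrite mulr_sumr; apply: ler_sum => k _; by have /andP[] := l_bounds k.
Qed.

Hypothesis l_half : l 0%N <= 1 / 2.

Lemma le_half k : l k <= 1 / 2.
Proof. exact: le_trans (l_decr (leq0n k)) l_half. Qed.

Variable h : nat.
Local Notation H := (h.+1%:R : R).

(* An arc of length [l k] covers completely the [(2 * s).-1] cells around its
   center, where [s] is the number of cells in half its length. *)
Definition inner_radius (k : nat) : nat := Num.truncn (H * l k / 2).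
Definition inner_width (k : nat) : nat := (2 * inner_radius k).-1.
Definition inner_shift (k : nat) : nat := (inner_radius k).-1.
Local Notation w := inner_width.

Lemma inner_radius_le k : (inner_radius k)%:R <= H * l k / 2.
Proof. by rewrite truncn_le divr_ge0// mulr_ge0// ltW. Qed.

Lemma inner_width_le k : (w k)%:R <= H * l k.
Proof.
have := inner_radius_le k; move: (H * l k) => x hx.
apply: (@le_trans _ _ (2 * inner_radius k)%:R); first by rewrite ler_nat leq_pred.
by rewrite natrM; lra.
Qed.

Lemma inner_width_ge k : H * l k - 3 <= (w k)%:R.
Proof.
have : H * l k / 2 < (inner_radius k).+1%:R by exact: truncnS_gt.
rewrite /inner_width; case: (inner_radius k) => [|n].
  by move: (H * l k) => x hx /=; lra.
have -> : ((2 * n.+1).-1 = 2 * n + 1)%N by lia.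
rewrite [(2 * n + 1)%:R]natrD natrM -(addn2 n) natrD.
by move: (H * l k) n%:R => x1 x2; lra.
Qed.

Lemma inner_density_le k : (w k)%:R / H <= l k.
Proof. by rewrite ler_pdivrMr ?ltr0n// mulrC inner_width_le. Qed.

Lemma inner_density_ge k : l k - 3 / H <= (w k)%:R / H.
Proof.
have H0 : 0 < H by rewrite ltr0n.
rewrite ler_pdivlMr// mulrBl divfK ?gt_eqF// mulrC.
exact: inner_width_ge.
Qed.

Lemma inner_half k : (w k)%:R / H <= 1 / 2.
Proof. exact: le_trans (inner_density_le k) (le_half k). Qed.

Lemma inner_width_ltH k : (w k <= h.+1)%N.
Proof.
rewrite -(ler_nat R) (le_trans (inner_width_le k))//.
by rewrite ler_piMr// (le_trans (le_half k))//; lra.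
Qed.

(** Rounding changes each density by at most [3 / h.+1]; as [1 - l k >= 1 / 2] this is a factor at
    most [1 + 6 / h.+1] per arc, and there are at most [h.+1 / 6] arcs. *)
Lemma prod_inner_le m n : (6 * n <= h.+1)%N ->
  \prod_(m <= k < n) (1 - (w k)%:R / H) <= expR 1 * \prod_(m <= k < n) (1 - l k).
Proof.
move=> nH; have H0 : 0 < H by rewrite ltr0n.
have l1 k : 0 <= 1 - l k by have := le_half k; lra.
apply: (@le_trans _ _ (\prod_(m <= k < n) (expR (6 / H) * (1 - l k)))).
  apply: ler_prod => k _; apply/andP; split.
    by rewrite subr_ge0 (le_trans (inner_half k))//; lra.
  apply: (@le_trans _ _ ((1 + 6 / H) * (1 - l k))); last first.
    by rewrite ler_wpM2r ?expR_ge1Dx.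
  have := inner_density_ge k; have := le_half k.
  have : 0 <= 3 / H by rewrite divr_ge0// ltW.
  have -> : 6 / H = 2 * (3 / H) by rewrite mulrA; congr (_ / _); lra.
  by move: (3 / H) (w k)%:R (H) (l k) => x1 x2 x3 x4; move: (x2 / x3) => x5; nra.
rewrite big_split /= ler_wpM2r//; first by apply: prodr_ge0 => k _.
rewrite prodr_const_nat -expRM_natl ler_expR mulrA ler_pdivrMr// mul1r -natrM ler_nat.
by rewrite mulnC (leq_trans _ nH)// leq_mul2l leq_subr orbT.
Qed.

(** This fixes the duration [q / M <= 1 / g] of a block. Each factor is at least
    [expR (- 2 l_k / M)], so the loss is [expR (- 2 (q / M) L)] with [L <= g] the sum of the
    lengths. *)
Lemma stay_ge m n (M g q : nat) : (0 < M)%N -> partial_sum n <= g%:R -> (q * g <= M)%N ->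
  expR (- 2) <=
  (\prod_(m <= k < n) (1 - (1 - expR (- M%:R^-1)) * ((w k)%:R / H))) ^+ q.
Proof.
move=> M0' Lg qg; have Mr : 0 < M%:R :> R by rewrite ltr0n.
have e0 : 0 <= 1 - expR (- (M%:R^-1 : R)) <= M%:R^-1.
  rewrite subr_ge0 -[leRHS]expR0 ler_expR oppr_le0 invr_ge0 ler0n /=.
  by rewrite lerBlDr addrC -lerBlDr; exact: expR_ge1Dx.
apply: (@le_trans _ _ ((\prod_(m <= k < n) expR (- (2 * (M%:R^-1 * l k)))) ^+ q)).
  rewrite -expR_sum -expRM_natl ler_expR sumrN -mulr_sumr mulrN lerN2 -mulr_sumr.
  have S1 : \sum_(m <= k < n) l k <= partial_sum n.
    rewrite big_geq_mkord /partial_sum; rewrite big_mkcond /=; apply: ler_sum => k _.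
    by case: ifP => // _; exact: ltW.
  have S0 : 0 <= \sum_(m <= k < n) l k by apply: sumr_ge0 => k _; exact: ltW.
  rewrite mulrCA -[leRHS]mulr1 ler_wpM2l//.
  rewrite mulrCA mulrC ler_pdivrMr// mul1r.
  apply: (@le_trans _ _ (q%:R * g%:R)); first by rewrite ler_wpM2l// (le_trans S1).
  by rewrite -natrM ler_nat.
set p1 := \prod_(m <= k < n) expR _; set p2 := \prod_(m <= k < n) (1 - _).
have p10 : 0 <= p1 by apply: prodr_ge0 => k _; exact: expR_ge0.
suff p12 : p1 <= p2 by rewrite lerXn2r// nnegrE// (le_trans p10).
apply: ler_prod => k _; rewrite expR_ge0 /=.
have pl := inner_density_le k; have ph := inner_half k.
have p0 : 0 <= (w k)%:R / H by rewrite divr_ge0.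
move: e0 => /andP[e0 e1].
have e2 : 1 - expR (- (M%:R^-1 : R)) <= 1 by rewrite lerBlDr lerDl expR_ge0.
set z := (1 - _) * _.
apply: (@le_trans _ _ (expR (- (2 * z)))); last first.
  apply: expRN2_le; rewrite mulr_ge0//= /z.
  by move: (1 - _) ((w k)%:R / H) e0 e2 p0 ph => x1 x2; nra.
by rewrite ler_expR lerN2 ler_wpM2l// /z ler_pM.
Qed.

End inner_discretisation.

Section covering_step.
Context {R : realType} {d : measure_display} {Omega : measurableType d}
  {P : probability Omega R}.
Variables (l : R^nat) (C Y : nat -> nat -> {RV P >-> R}) (M0 M1 : R).
Hypothesis model : poisson_covering_model l C Y 0.
Hypothesis l_pos : forall n, 0 < l n.
Hypothesis l_decr : nonincreasing_seq l.
Hypothesis M0_pos : 0 < M0.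
Hypothesis l_bounds : forall n, M0 / n.+1%:R <= l n <= M1 / n.+1%:R.
Hypothesis l_half : l 0%N <= 1 / 2.
Local Notation Pr := (pr P).
Local Notation w := (inner_width l).
Local Notation s := (inner_shift l).
Local Notation ncov h M m n := (noncov C Y h (w h) (s h) M m n).

Let wH h k : (w h k <= h.+1)%N := inner_width_ltH l_pos l_decr l_half h k.
Let p_half h k : (w h k)%:R / h.+1%:R <= 1 / 2 := inner_half l_pos l_decr l_half h k.
Let l1 k : 0 <= 1 - l k.
Proof. by have := le_half l_decr l_half k; lra. Qed.

Lemma noncov_le h M m n n' : (n <= n')%N -> Pr (ncov h M m n') <= Pr (ncov h M m n).
Proof.
move=> nn'; apply: le_pr; try exact: measurable_noncov.
move=> om [i iM [y u]]; exists i => //; exists y => k /andP[mk kn].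
by apply: u; rewrite mk (leq_trans kn).
Qed.

(** In the constant [3 * expR 3], the 3 bounds [1 + 2 r (n - m) / h.+1], the maximal inequality
    costs [expR 2] by [stay_ge], and the rounding of the lengths costs [expR 1]. *)
Lemma sum_block_le h M m n A G g : (m <= n)%N -> (0 < n)%N -> (0 < M)%N -> (0 < A)%N ->
  (6 * n <= h.+1)%N -> G = (A * n)%N -> partial_sum l n <= g%:R ->
  \sum_(ab : 'I_G * 'I_g) Pr (block C Y h (w h) (s h) M m n (h.+1 %/ G) (M %/ g) ab.1 ab.2)
  <= (A * n)%:R * g%:R * (3 * expR 3) * \prod_(m <= k < n) (1 - l k).
Proof.
move=> mn n0 M0' A0 nH GE Lg; set r := (_ %/ _)%N; set q := (_ %/ _)%N.
set U := \prod_(m <= k < n) (1 - l k).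
have U0 : 0 <= U by apply: prodr_ge0.
have H0 : 0 < h.+1%:R :> R by rewrite ltr0n.
have G0 : (0 < G)%N by rewrite GE muln_gt0 A0.
have one a b : Pr (block C Y h (w h) (s h) M m n r q a b) <= 3 * expR 3 * U.
  have st := stay_ge l_pos l_decr l_half h m M0' Lg (leq_trunc_div M g).
  have pb := pr_block model (s h) (wH h) (p_half h) M r q a b mn.
  have pi := prod_inner_le l_pos l_decr M0_pos l_half m nH.
  have p1 : 0 <= \prod_(m <= i < n) (1 - (w h i)%:R / h.+1%:R) :> R.
    by apply: prodr_ge0 => k _; rewrite subr_ge0 (le_trans (p_half h k))//; lra.
  have r2 : 1 + r%:R * (n - m)%:R * (2 / h.+1%:R) <= 3 :> R.
    have : r%:R * (n - m)%:R <= h.+1%:R :> R.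
      rewrite -natrM ler_nat; apply: leq_trans (leq_trunc_div h.+1 G).
      by rewrite leq_mul2l (leq_trans (leq_subr m n)) ?orbT// GE leq_pmull.
    move=> rn; rewrite mulrA -(ler_pM2r H0) mulrDl divfK ?gt_eqF//.
    by move: (_ * (n - m)%:R) (h.+1%:R) H0 rn => x1 x2; lra.
  have : expR (- 2) * Pr (block C Y h (w h) (s h) M m n r q a b) <= 3 * (expR 1 * U).
    apply: (le_trans (ler_wpM2r (pr_ge0 _) st)); apply: (le_trans pb).
    apply: (@le_trans _ _ (3 * \prod_(m <= i < n) (1 - (w h i)%:R / h.+1%:R))).
      by rewrite ler_wpM2r.
    by rewrite ler_wpM2l.
  move=> hb; rewrite -(ler_pM2l (expR_gt0 (- 2))); apply: (le_trans hb).
  have e21 : expR (- 2) * expR 3 = expR 1 :> R by rewrite -expRD; congr expR; lra.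
  rewrite le_eqVlt -e21; apply/orP; left; apply/eqP; ring.
apply: (@le_trans _ _ (\sum_(ab : 'I_G * 'I_g) 3 * expR 3 * U)).
  by apply: ler_sum => ab _; exact: one.
rewrite -GE sumr_const card_prod !card_ord -[leLHS]mulr_natl natrM.
by apply: le_of_eq; ring.
Qed.

(** With [4 <= A * M0] a block is at most half as long as any arc of index below [2 n]. The factor
    [expR (- 1)] is the price of not moving during a time [q / M <= 1]. *)
Lemma pr_cover_ge h M n A k t (a : 'I_h.+1) q : (k < n + n)%N ->
  4 <= A%:R * M0 -> 24 * n%:R <= M0 * h.+1%:R -> (0 < M)%N -> (q <= M)%N -> 0 <= t ->
  M0 / (8 * n%:R) * expR (- 1) <=
  Pr (cover_block C Y (w h) (s h) k t (M%:R^-1) q a (h.+1 %/ (A * n))).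
Proof.
move=> kn AM nH M0' qM t0.
have n0 : (0 < n)%N by case: n kn {nH} => //.
have nr : 0 < n%:R :> R by rewrite ltr0n.
have H0 : 0 < h.+1%:R :> R by rewrite ltr0n.
have A0 : 0 < A%:R :> R.
  by rewrite ltr0n lt0n; apply/eqP => A0; move: AM; rewrite A0 mul0r; lra.
have d0 : 0 <= M%:R^-1 :> R by rewrite invr_ge0.
apply: le_trans (pr_cover_block model (s h) (wH h) k q a _ t0 d0).
apply: ler_pM; [by rewrite divr_ge0// ?mulr_ge0// ltW|exact: expR_ge0| |].
- set r := (_ %/ _)%N.
  have rb : r%:R <= h.+1%:R / (A * n)%:R :> R.
    by apply: natr_divn_le; rewrite muln_gt0 n0 andbT -(ltr0n R).
  have wb := inner_width_ge M0_pos l_half h k.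
  have [lb _] := andP (l_bounds k).
  have sb : (w h k)%:R - r%:R <= (w h k - r)%:R :> R.
    have [rw|rw] := leqP r (w h k); first by rewrite natrB.
    by move/ltnW: (rw) => /eqP ->; rewrite subr_le0 ler_nat ltnW.
  rewrite ler_pdivlMr//; apply: (le_trans _ sb).
  (* [w - r >= H M0 / (2 n) - 3 - H M0 / (4 n)] *)
  have e1 : h.+1%:R * (M0 / (2 * n%:R)) <= h.+1%:R * l k.
    rewrite ler_wpM2l//; apply: le_trans lb; rewrite ler_wpM2l ?(ltW M0_pos)//.
    by rewrite lef_pV2 ?posrE ?mulr_gt0 ?ltr0n// -natrM ler_nat mul2n -addnn.
  have e2 : h.+1%:R / (A * n)%:R <= h.+1%:R * (M0 / (4 * n%:R)).
    rewrite ler_wpM2l// natrM invfM ler_pdivlMr ?mulr_gt0//.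
    rewrite mulrC -mulrA [n%:R * _]mulrCA mulfV ?gt_eqF// mulr1.
    by rewrite ler_pdivrMr// mulrC.
  have e3 : 3 <= h.+1%:R * (M0 / (8 * n%:R)).
    rewrite mulrA ler_pdivlMr ?mulr_gt0//; move: nH; rewrite [M0 * _]mulrC.
    by move: (h.+1%:R * M0) n%:R => x1 x2; lra.
  have f2 : h.+1%:R * (M0 / (2 * n%:R)) = 4 * (h.+1%:R * (M0 / (8 * n%:R))).
    by field; rewrite gt_eqF.
  have f4 : h.+1%:R * (M0 / (4 * n%:R)) = 2 * (h.+1%:R * (M0 / (8 * n%:R))).
    by field; rewrite gt_eqF.
  rewrite f2 in e1; rewrite f4 in e2; move: e1 e2 e3 wb rb.
  rewrite [M0 / _ * h.+1%:R]mulrC.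
  move: (h.+1%:R * (M0 / (8 * n%:R))) (h.+1%:R * l k) (_ / (A * n)%:R) (w h k)%:R r%:R.
  by move=> x1 x2 x3 x4 x5; lra.
- rewrite -expRM_natl ler_expR mulrN lerN2 ler_pdivrMr ?ltr0n// mul1r ler_nat//.
Qed.

(** A group has at least [n / (2 K)] arcs, each covering a given block with probability at least
    [M0 / (8 n)] times [expR (- 1)]; the product of the two does not depend on [n]. *)
Definition cover_rate (K : nat) : R := 1 - expR (- (M0 / (16 * K%:R) * expR (- 1))).

Lemma cover_rate_gt0 K : (0 < K)%N -> 0 < cover_rate K <= 1.
Proof.
move=> K0; rewrite /cover_rate subr_gt0 gerBl expR_ge0 andbT.
rewrite -[ltRHS]expR0 ltr_expR oppr_lt0 mulr_gt0 ?expR_gt0// divr_gt0//.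
by rewrite mulr_gt0// ltr0n.
Qed.

Lemma pr_cover_group h M n A K n' t (a : 'I_h.+1) q : (0 < K)%N -> (K <= n)%N ->
  (n' + n %/ K <= n + n)%N ->
  4 <= A%:R * M0 -> 24 * n%:R <= M0 * h.+1%:R -> (0 < M)%N -> (q <= M)%N -> 0 <= t ->
  cover_rate K <= Pr [set om | exists2 k, (n' <= k < n' + n %/ K)%N &
    cover_block C Y (w h) (s h) k t (M%:R^-1) q a (h.+1 %/ (A * n)) om].
Proof.
move=> K0 Kn n'n AM nH M0' qM t0.
set g' := (n %/ K)%N; set r := (_ %/ _)%N.
pose B k := cover_block C Y (w h) (s h) k t (M%:R^-1) q a r.
have sB k : sig (resampling_family C Y) (arcs_index (@set1 nat k)) (B k).
  exact: sig_cover_block.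
have mB k : measurable (B k) := sig_measurable (sB k).
have mE : measurable [set om | exists2 k, (n' <= k < n' + g')%N & B k om].
  have -> : [set om | exists2 k, (n' <= k < n' + g')%N & B k om] =
    \bigcup_(k in [set k | (n' <= k < n' + g')%N]) B k by [].
  by apply: bigcup_measurable => k _.
have n0 : (0 < n)%N := leq_trans K0 Kn.
have nr : 0 < n%:R :> R by rewrite ltr0n.
have Kr : 0 < K%:R :> R by rewrite ltr0n.
pose x := M0 / (8 * n%:R) * expR (- 1).
have x0 : 0 <= x by rewrite mulr_ge0 ?expR_ge0// divr_ge0 ?(ltW M0_pos)// mulr_ge0.
suff nc : Pr (~` [set om | exists2 k, (n' <= k < n' + g')%N & B k om]) <=
    expR (- (M0 / (16 * K%:R) * expR (- 1))).
  by move: nc; rewrite prC// /cover_rate; move: (Pr _) (expR _) => x1 x2; lra.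
have -> : ~` [set om | exists2 k, (n' <= k < n' + g')%N & B k om] =
    [set om | forall k, (n' <= k < n' + g')%N -> (~` B k) om].
  apply/seteqP; split => om /=; first by move=> nE k nk Bk; apply: nE; exists k.
  by move=> h1 [k nk Bk]; exact: h1 nk Bk.
rewrite (pr_arcs model (leq_addr g' n')); last by move=> k _; exact: sigC.
apply: (@le_trans _ _ (\prod_(n' <= k < n' + g') expR (- x))).
  rewrite big_nat_cond [leRHS]big_nat_cond; apply: ler_prod => k /andP[/andP[nk kn'] _].
  rewrite pr_ge0 prC//=; apply: le_trans (le_oneB_expR x).
  rewrite lerD2l lerN2; apply: pr_cover_ge => //.
  exact: leq_trans kn' n'n.
rewrite prodr_const_nat addKn -expRM_natl ler_expR mulrN lerN2 /x.
rewrite mulrA ler_wpM2r ?expR_ge0//.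
have g2 : n%:R <= 2 * K%:R * g'%:R :> R.
  rewrite -!natrM ler_nat -mulnA mul2n -addnn.
  rewrite {1}(divn_eq n K) -/g' mulnC leq_add2l.
  apply: leq_trans (ltnW (ltn_pmod n K0)) _.
  by rewrite leq_pmulr// divn_gt0.
have -> : M0 / (16 * K%:R) = (M0 / (8 * n%:R)) * (n%:R / (2 * K%:R)).
  by field; rewrite !gt_eqF.
rewrite [leRHS]mulrC ler_wpM2l ?divr_ge0 ?(ltW M0_pos) ?mulr_ge0//.
by rewrite ler_pdivrMr ?mulr_gt0// mulrC.
Qed.

Lemma covering_step h M m n A K : (m <= n)%N -> (0 < K)%N -> (K <= n)%N -> (0 < M)%N ->
  4 <= A%:R * M0 -> (6 * n <= h.+1)%N -> 24 * n%:R <= M0 * h.+1%:R ->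
  Pr (ncov h M m (n + n)) <= (1 - cover_rate K ^+ K) * Pr (ncov h M m n) +
    cover_rate K ^+ K * ((A * n)%:R * (Num.truncn (partial_sum l n)).+1%:R *
      (3 * expR 3) * \prod_(m <= k < n) (1 - l k) / K%:R).
Proof.
move=> mn K0 Kn M0' AM nH nH'.
have n0 : (0 < n)%N := leq_trans K0 Kn.
have A0 : (0 < A)%N.
  by rewrite lt0n; apply/eqP => A0; move: AM; rewrite A0 mul0r; lra.
have /andP[e0 e1] := cover_rate_gt0 K0.
set g := (Num.truncn (partial_sum l n)).+1.
have G0 : (0 < A * n)%N by rewrite muln_gt0 A0.
apply: le_trans (noncov_recursion (r := h.+1 %/ (A * n)) (q := M %/ g)
  (G := (A * n)%N) (g := g) (g' := n %/ K) (e := cover_rate K) model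
  mn _ _ K0 _ _ _) _.
- by rewrite mulnC ltnW// ltn_ceil.
- by rewrite mulnC ltn_ceil.
- by rewrite mulnC leq_trunc_div.
- by rewrite (ltW e0).
- move=> n' a b n'n; apply: pr_cover_group => //; first exact: leq_div.
rewrite lerD2l ler_wpM2l ?exprn_ge0 ?(ltW e0)//.
rewrite ler_wpM2r ?invr_ge0//.
by apply: sum_block_le => //; rewrite ltW// truncnS_gt.
Qed.

Lemma gap_product_gt0 n : 0 < gap_product l n.
Proof.
apply: prodr_gt0 => k _; have := le_half l_decr l_half k; lra.
Qed.

Variable c0 : R.
Hypothesis sub : forall N, exists2 n, (N <= n)%N &
  n%:R * ln n%:R * gap_product l n <= c0.

Lemma block_count_bound m : exists B : R, forall A N : nat, exists n, [/\ (N <= n)%N, (m <= n)%N &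
  (A * n)%:R * (Num.truncn (partial_sum l n)).+1%:R * (3 * expR 3) *
    \prod_(m <= k < n) (1 - l k) <= A%:R * B].
Proof.
have M1_pos : 0 < M1 := M1_gt0 M0_pos l_bounds.
have ln2 : 0 < ln 2 :> R by rewrite ln_gt0// ltr1n.
have um := gap_product_gt0 m.
exists ((M1 + 1) * (1 + (ln 2)^-1) * (3 * expR 3) / gap_product l m * c0) => A N.
have [n nN cn] := sub (maxn N (maxn m 2)).
move: nN; rewrite !geq_max => /and3P[Nn mn n2].
exists n; split => //.
have n0 : (0 < n)%N by apply: leq_trans n2.
have nr : 0 < n%:R :> R by rewrite ltr0n.
have prodE : \prod_(m <= k < n) (1 - l k) = gap_product l n / gap_product l m.
  rewrite /gap_product -!(big_mkord xpredT (fun k => 1 - l k)) (@big_cat_nat _ _ _ m 0 n)//=.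
  by rewrite mulrC mulKf// gt_eqF// big_mkord.
rewrite prodE; set g := (Num.truncn _).+1%:R.
have lnn : ln 2 <= ln n%:R :> R by rewrite ler_ln ?posrE ?ltr0n// ler_nat.
(* The term [1 / ln 2] absorbs the additive constants, as [ln n >= ln 2]. *)
have gb : g <= (M1 + 1) * (1 + (ln 2)^-1) * ln n%:R.
  have : g <= partial_sum l n + 1.
    by rewrite /g -natr1 lerD2r truncn_le partial_sum_ge0.
  move/le_trans; apply.
  have := partial_sum_le M0_pos l_bounds n0 => /(lerD) /(_ (lexx 1)) /le_trans; apply.
  have h1 : 1 <= (ln 2)^-1 * ln n%:R :> R by rewrite mulrC ler_pdivlMr// mul1r.
  move: M1_pos h1; move: (ln n%:R) (lnn) ln2 ((ln 2)^-1) => x1 h2 h3 x2 h4 h5.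
  nra.
rewrite natrM.
have -> : A%:R * ((M1 + 1) * (1 + (ln 2)^-1) * (3 * expR 3) / gap_product l m * c0) =
    A%:R * (3 * expR 3) / gap_product l m * ((M1 + 1) * (1 + (ln 2)^-1) * c0) by ring.
have -> : A%:R * n%:R * g * (3 * expR 3) * (gap_product l n / gap_product l m) =
    A%:R * (3 * expR 3) / gap_product l m * (g * (n%:R * gap_product l n)) by ring.
rewrite ler_wpM2l//; first by rewrite divr_ge0 ?(ltW um)// !mulr_ge0// expR_ge0.
apply: (@le_trans _ _ ((M1 + 1) * (1 + (ln 2)^-1) * ln n%:R * (n%:R * gap_product l n))).
  by rewrite ler_wpM2r// mulr_ge0// ltW// gap_product_gt0.
rewrite (_ : _ * (n%:R * _) = (M1 + 1) * (1 + (ln 2)^-1) *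
  (n%:R * ln n%:R * gap_product l n)); last by ring.
rewrite ler_wpM2l// mulr_ge0// ?addr_ge0 ?(ltW M1_pos)// invr_ge0 ltW//.
Qed.

(** The recursion [x' <= (1 - e) x + e b] contracts to its fixed point [b = B / K]. Between two
    steps monotonicity in the number of arcs allows a jump to the next suitable [n]; the threshold
    [h0] does not depend on the time grid. *)
Lemma noncov_iterate m (K : nat) (A : nat) (B : R) : (0 < K)%N ->
  4 <= A%:R * M0 ->
  (forall N : nat, exists n, [/\ (N <= n)%N, (m <= n)%N &
    (A * n)%:R * (Num.truncn (partial_sum l n)).+1%:R * (3 * expR 3) *
    \prod_(m <= k < n) (1 - l k) <= B]) ->
  forall J : nat, exists n, exists h0, forall h M, (h0 <= h)%N -> (0 < M)%N ->
    Pr (ncov h M m n) <= (1 - cover_rate K ^+ K) ^+ J + B / K%:R.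
Proof.
move=> K0 AM hB; have /andP[e0 e1] := cover_rate_gt0 K0.
set e := cover_rate K ^+ K.
have e01 : 0 <= e <= 1 by rewrite exprn_ge0 ?(ltW e0)//= exprn_ile1// ltW.
have Kr : 0 < K%:R :> R by rewrite ltr0n.
have B0 : 0 <= B / K%:R.
  have [n [_ _ nB]] := hB 0%N; rewrite divr_ge0 ?(ltW Kr)//; apply: le_trans nB.
  rewrite !mulr_ge0 ?expR_ge0//; apply: prodr_ge0 => k _.
  have := le_half l_decr l_half k; lra.
elim=> [|J [n [h0 IH]]].
  exists m, 0%N => h M _ M0'; rewrite expr0.
  apply: (@le_trans _ _ 1); first by apply: pr_le1; exact: measurable_noncov.
  by rewrite lerDl.
have [n' [nn' mn' nB]] := hB (maxn n K).
move: nn'; rewrite geq_max => /andP[nn' Kn'].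
exists (n' + n')%N, (maxn h0 (maxn (6 * n') (Num.truncn (24 * n'%:R / M0)))) => h M.
rewrite !geq_max => /and3P[h0h h6 h24] M0'.
have nH' : 24 * n'%:R <= M0 * h.+1%:R.
  have : 24 * n'%:R / M0 < (Num.truncn (24 * n'%:R / M0)).+1%:R by exact: truncnS_gt.
  rewrite ltr_pdivrMr// => /ltW /le_trans; apply.
  by rewrite mulrC ler_wpM2l ?(ltW M0_pos)// ler_nat ltnS.
have st := covering_step mn' K0 Kn' M0' AM (leqW h6) nH'.
apply: (le_trans st); rewrite -/e.
have p1 : Pr (ncov h M m n') <= (1 - e) ^+ J + B / K%:R.
  by apply: le_trans (IH h M h0h M0'); exact: noncov_le.
have p2 : forall x, x <= B -> x / K%:R <= B / K%:R.
  by move=> x xB; rewrite ler_wpM2r// invr_ge0 ltW.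
have aux (x y b t : R) : x <= y + b -> t <= b -> 0 <= b ->
    (1 - e) * x + e * t <= (1 - e) * y + b.
  by move: e01 => /andP[f0 f1] h1 h2 h3; nra.
by rewrite exprS; apply: aux => //; exact: p2.
Qed.

Lemma noncov_small m (eta : R) : 0 < eta ->
  exists n, forall M, (0 < M)%N -> exists h, Pr (ncov h M m n) <= eta.
Proof.
move=> eta0.
pose A := (Num.truncn (4 / M0)).+1.
have AM : 4 <= A%:R * M0.
  by rewrite -ler_pdivrMr// ltW// truncnS_gt.
have [B hB] := block_count_bound m.
(* The order of choices matters: [B] does not depend on [K], so [K] can make the fixed point small;
   [J] comes last because the rate of contraction depends on [K]. *)
pose K := (Num.truncn (2 * (A%:R * B) / eta)).+1.
have KB : A%:R * B / K%:R <= eta / 2.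
  rewrite ler_pdivrMr ?ltr0n//.
  have : 2 * (A%:R * B) / eta < K%:R by exact: truncnS_gt.
  rewrite ltr_pdivrMr//; move: (A%:R * B) K%:R => x1 x2; nra.
have /andP[e0 e1] := cover_rate_gt0 (isT : (0 < K)%N).
have e0' : 0 < cover_rate K ^+ K by exact: exprn_gt0.
have [J hJ] : exists J, (1 - cover_rate K ^+ K) ^+ J <= eta / 2.
  have cv : (fun J => (1 - cover_rate K ^+ K) ^+ J) @ \oo --> 0.
    apply: cvg_expr; rewrite ger0_norm; first by rewrite ltrBlDr ltrDl.
    by rewrite subr_ge0 exprn_ile1// ltW.
  have /cvgrPdist_le /(_ (eta / 2)) := cv.
  rewrite divr_gt0// => /(_ isT) [J _ hJ]; exists J.
  by have := hJ J (leqnn J); rewrite /= sub0r normrN; apply: le_trans; exact: ler_norm.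
have [n [h0 hn]] := noncov_iterate (isT : (0 < K)%N) AM (hB A) J.
exists n => M M0'; exists h0; apply: (le_trans (hn h0 M (leqnn _) M0')).
by rewrite (splitr eta) lerD.
Qed.

End covering_step.

(** * From the grids to all points and times *)

Section geometry.
Context {R : realType}.
Variable h : nat.
Local Notation H := (h.+1%:R : R).

Lemma offsetE (y c : 'I_h.+1) (s : nat) : exists z : int,
  ((y - c + inZp s : 'I_h.+1)%R : nat)%:R = y%:R - c%:R + s%:R + z%:~R * H :> R.
Proof.
have e : ((y - c + inZp s : 'I_h.+1)%R : nat) = ((y + (h.+1 - c) + s) %% h.+1)%N.
  by rewrite /= modnDm -modnDml modnDmr modnDml.
pose N := (y + (h.+1 - c) + s)%N.
exists (1 - (N %/ h.+1)%:Z); rewrite e -/N.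
have : N%:R = (N %/ h.+1)%:R * H + (N %% h.+1)%:R :> R.
  by rewrite -natrM -natrD -divn_eq.
have : N%:R = y%:R + (H - c%:R) + s%:R :> R.
  by rewrite /N !natrD natrB// ltnW.
rewrite intrB -pmulrn mulr1z => -> e2; rewrite mulrBl mul1r.
have -> : (N %% h.+1)%:R = y%:R + (H - c%:R) + s%:R - (N %/ h.+1)%:R * H :> R.
  by rewrite e2 addrC addKr.
ring.
Qed.

Lemma cell_dist (x u : R) (z : int) : 0 <= x < 1 -> 0 <= u < 1 ->
  `|(x - u - z%:~R) * H - ((cell h x)%:R - (cell h u)%:R - z%:~R * H)| < 1.
Proof.
have H0 : 0 < H by rewrite ltr0n.
move=> /(cell_bounds h); rewrite ler_pdivrMr// ltr_pdivlMr// -[(cell h x).+1%:R]natr1 => /andP[x1 x2].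
move=> /(cell_bounds h); rewrite ler_pdivrMr// ltr_pdivlMr// -[(cell h u).+1%:R]natr1 => /andP[u1 u2].
rewrite (_ : _ - _ = (x * H - (cell h x)%:R) - (u * H - (cell h u)%:R)); last by ring.
rewrite ltr_norml; move: (x * H) (u * H) (cell h x)%:R (cell h u)%:R x1 x2 u1 u2.
by move=> ? ? ? ? ? ? ? ?; lra.
Qed.

(** If the radius is [s.+1] cells, the discrete arc consists of the cells at distance at most [s]
    from that of [u], and rounding adds less than one cell. *)
Lemma inner_cov_arc (l : R^nat) k (x u : R) : (forall n, 0 < l n) ->
  0 <= x < 1 -> 0 <= u < 1 ->
  cov (inner_width l h k) (inner_shift l h k) (cell h u) (cell h x) -> Defs.arc u (l k) x.
Proof.
move=> l_pos x01 u01; have H0 : 0 < H by rewrite ltr0n.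
have := inner_radius_le l_pos h k.
rewrite /cov /inner_width /inner_shift; case: inner_radius => [//|s] rs.
have -> : ((2 * s.+1).-1 = (2 * s).+1)%N by lia.
have [z ez] := offsetE (cell h x) (cell h u) s; rewrite ltnS /= => ds.
split; first by rewrite /circle /= in_itv.
exists (- z); have cd := cell_dist (- z) x01 u01.
rewrite -(ltr_pM2r H0) -[X in `|_| * X](ger0_norm (ltW H0)) -normrM.
set q := (x - u - _) * H in cd *.
have d0 : 0 <= (((cell h x - cell h u + inZp s : 'I_h.+1)%R : nat))%:R :> R by [].
rewrite -(ler_nat R) natrM ez in ds; rewrite ez in d0.
rewrite intrN mulNr opprK ltr_norml in cd; rewrite ltr_norml.
rewrite -[s.+1%:R]natr1 (_ : H * l k / 2 = l k / 2 * H) in rs; last by ring.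
move: d0 ds rs cd.
move: (l k / 2 * H) (z%:~R * H) (cell h x)%:R (cell h u)%:R s%:R q.
move=> x6 x5 x4 x3 x2 x1 ? ? ? /andP[? ?]; apply/andP; split; lra.
Qed.

End geometry.

Section right_continuity.
Context {R : realType} {d : measure_display} {Omega : measurableType d}
  {P : probability Omega R}.
Variables (C Y : nat -> nat -> {RV P >-> R}).
Local Notation T := (resample_time Y).

Lemma resample_time_ge0 i j w : regular Y i w -> 0 <= T i j w.
Proof. by move=> [Y0 _]; apply: sumr_ge0 => k _; exact: Y0. Qed.

Lemma resample_time_le i j j' w : regular Y i w -> (j <= j')%N -> T i j w <= T i j' w.
Proof.
move=> [Y0 _]; elim: j' => [|j' IH]; first by rewrite leqn0 => /eqP ->.
rewrite leq_eqVlt => /predU1P[->//|]; rewrite ltnS => /IH /le_trans; apply.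
by rewrite resample_timeS lerDl.
Qed.

Lemma at_indexE i t j w : regular Y i w ->
  at_index Y i t j w <-> T i j w <= t < T i j.+1 w.
Proof.
move=> r; split.
  move=> [pj tj]; apply/andP; split => //.
  by have /andP[] := pj j (leqnn _).
move=> /andP[jt tj]; split => // k kj; rewrite resample_time_ge0//=.
by apply: le_trans jt; exact: resample_time_le.
Qed.

Lemma center_jumps i t w : regular Y i w ->
  Defs.center C Y i t w = C i (jumps Y i t w) w.
Proof.
move=> r; rewrite /Defs.center /jumps; congr (C i (xget 0%N _) w).
by apply/seteqP; split => j /(at_indexE _ _ r).
Qed.

Lemma jumps_right i t w : 0 <= t -> regular Y i w ->
  exists2 e : R, 0 < e & forall t', t <= t' < t + e -> jumps Y i t' w = jumps Y i t w.
Proof.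
move=> t0 r; have [j aj] := regular_at_index t0 r.
have /(at_indexE t j r)/andP[jt tj] := aj.
exists (T i j.+1 w - t); first by rewrite subr_gt0.
move=> t' /andP[tt' t'j]; rewrite (jumps_at aj); apply: jumps_at.
apply/(at_indexE _ _ r); rewrite (le_trans jt tt') /=.
by move: t'j; rewrite addrC subrK.
Qed.

Lemma jumps_right_all n t w : 0 <= t -> (forall i, regular Y i w) ->
  exists2 e : R, 0 < e & forall i, (i < n)%N ->
    forall t', t <= t' < t + e -> jumps Y i t' w = jumps Y i t w.
Proof.
move=> t0 r; elim: n => [|n [e e0 IH]]; first by exists 1.
have [e' e'0 h'] := jumps_right t0 (r n).
exists (Num.min e e'); first by rewrite lt_min e0.
move=> i; rewrite ltnS leq_eqVlt => /predU1P[->|iin] t' /andP[tt' t'e].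
  apply: h'; rewrite tt' /=; apply: lt_le_trans t'e _.
  by rewrite lerD2l ge_min lexx orbT.
apply: IH => //; rewrite tt' /=; apply: lt_le_trans t'e _.
by rewrite lerD2l ge_min lexx.
Qed.

(** Dyadic grids are nested, which later makes the grid events increasing in [r]. *)
Lemma dyadic_grid (t e : R) : 0 <= t <= 1 -> 0 < e ->
  exists r i : nat, (i <= 2 ^ r)%N /\ t <= i%:R * ((2 ^ r)%:R^-1) < t + e.
Proof.
move=> /andP[t0 t1] e0.
pose r := (Num.truncn e^-1).+1.
have r2 : e^-1 < (2 ^ r)%:R.
  apply: lt_le_trans (truncnS_gt _) _; rewrite ler_nat -/r.
  by rewrite ltnW// ltn_expl.
have M0 : 0 < (2 ^ r)%:R :> R by rewrite ltr0n expn_gt0.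
(* The time 1 is its own grid time: the next one, used for the other [t], would lie outside
   [[0, 1]]. *)
exists r; have [t1'|t1'] := eqVneq t 1.
  exists (2 ^ r)%N; split => //.
  by rewrite divff ?gt_eqF// t1' lexx ltrDl.
exists (Num.truncn (t * (2 ^ r)%:R)).+1; split.
  rewrite truncn_lt_nat ?mulr_ge0//.
  by rewrite gtr_pMl// lt_neqAle t1' t1.
have /truncn_itv /andP[a b] : 0 <= t * (2 ^ r)%:R by rewrite mulr_ge0.
apply/andP; split; first by rewrite ler_pdivlMr// ltW.
rewrite ltr_pdivrMr// mulrDl -natr1 ler_ltD//.
by rewrite -ltr_pdivrMl// mulr1.
Qed.

End right_continuity.

Section part_one.
Context {R : realType} {d : measure_display} {Omega : measurableType d}
  {P : probability Omega R}.
Variables (l : R^nat) (C Y : nat -> nat -> {RV P >-> R}) (M0 M1 : R).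
Hypothesis model : poisson_covering_model l C Y 0.
Hypothesis l_pos : forall n, 0 < l n.
Local Notation Pr := (pr P).

Definition good : set Omega :=
  [set w | (forall i, regular Y i w) /\ (forall i j, 0 <= C i j w < 1)].

Lemma negligible_not_good : P.-negligible (~` good).
Proof.
pose N1 := \bigcup_i (~` regular Y i).
pose N2 := \bigcup_i \bigcup_j (C i j @^-1` (~` `[0, 1[)).
have n1 : P.-negligible N1.
  by apply: negligible_bigcup => i; exact: negligible_not_regular model i.
have n2 : P.-negligible N2.
  apply: negligible_bigcup => i; apply: negligible_bigcup => j.
  have mI : measurable (C i j @^-1` (~` `[0, 1[)).
    by apply: measurable_rv; apply: measurableC; exact: measurable_itv.
  exists (C i j @^-1` (~` `[0, 1[)); split => //.
  by apply: etrans (prE mI) _; rewrite (C_unit_interval model).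
apply: negligibleS (negligibleU n1 n2) => w nG.
apply: contrapT => /not_orP[h1 h2]; apply: nG; split => [i|i j].
  by apply: contrapT => nr; apply: h1; exists i.
apply: contrapT => nc; by apply: h2; exists i => //; exists j.
Qed.

(** A point not covered infinitely often is missed by all arcs from some [m] on, and at a grid time
    just after [t] the arcs of index below [n] have not yet moved. The grid time does not depend on
    [h]. *)
Lemma uncovered_noncov t w : good w -> 0 <= t <= 1 -> uncovered l C Y t w !=set0 ->
  exists m, forall n, exists r, forall h,
    noncov C Y h (inner_width l h) (inner_shift l h) (2 ^ r) m n w.
Proof.
move=> [reg c01] t01 [x [x01]].
rewrite /covered_io /lim_sup_set => nx.
have [m nm] : exists m, ~ (\bigcup_(j >= m) moving_arc l C Y j t w) x.
  apply: contrapT => /forallNP nn; apply: nx => m _.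
  by apply: contrapT; exact: nn.
have t0 : 0 <= t by case/andP: t01.
exists m => n; have [e e0 je] := jumps_right_all n t0 reg.
have [r [i [iM ti]]] := dyadic_grid t01 e0.
exists r => h; exists i => //; exists (cell h x) => k /andP[mk kn].
rewrite /state (je k kn _ ti) -center_jumps//.
apply/negP => cv; apply: nm; exists k => //.
apply: inner_cov_arc cv => //; last by rewrite center_jumps.
Qed.

Hypothesis l_decr : nonincreasing_seq l.
Hypothesis M0_pos : 0 < M0.
Hypothesis l_bounds : forall n, M0 / n.+1%:R <= l n <= M1 / n.+1%:R.
Hypothesis l_half : l 0%N <= 1 / 2.

(** Intersecting over [h] leaves one good [h] to be found for each [r]; the union over [r] is
    increasing, so the bound of [noncov_small], uniform in the time grid, survives the limit;
    finally [n] is chosen for each [eta]. *)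
Lemma negligible_uncovered (c0 : R) :
  (forall N, exists2 n, (N <= n)%N & n%:R * ln n%:R * gap_product l n <= c0) ->
  P.-negligible [set w | exists t : R, 0 <= t <= 1 /\ uncovered l C Y t w !=set0].
Proof.
move=> sub.
pose ncov h r m n := noncov C Y h (inner_width l h) (inner_shift l h) (2 ^ r) m n.
have mn h r m n : measurable (ncov h r m n) by exact: measurable_noncov.
pose Nt m n r := \bigcap_h ncov h r m n.
have mNt m n r : measurable (Nt m n r) by exact: bigcapT_measurable.
have incr m n : {homo Nt m n : r r' / (r <= r')%N >-> (r <= r')%O}.
  apply: homo_leq => [A|A B D|r]; [exact: lexx|exact: le_trans|].
  apply/subsetPset => w Nw h _; have [i iM [y u]] := Nw h Logic.I.
  exists (2 * i)%N; first by rewrite expnS leq_mul2l.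
  exists y; suff -> : (2 * i)%:R * (2 ^ r.+1)%:R^-1 = i%:R * (2 ^ r)%:R^-1 :> R by [].
  by rewrite expnS !natrM invfM mulrACA divff ?mul1r.
pose B m := \bigcap_n \bigcup_r Nt m n r.
have mB m : measurable (B m).
  by apply: bigcapT_measurable => n; exact: bigcupT_measurable.
have B0 m : P (B m) = 0%E.
  rewrite (prE (mB m)); congr _%:E; apply/eqP; rewrite eq_le pr_ge0 andbT.
  apply/ler_addgt0Pl => eta eta0; rewrite addr0.
  have [n hn] := noncov_small model l_pos l_decr M0_pos l_bounds l_half sub m eta0.
  have mU : measurable (\bigcup_r Nt m n r) by exact: bigcupT_measurable.
  apply: (@le_trans _ _ (Pr (\bigcup_r Nt m n r))).
    by apply: le_pr => // w; apply.
  rewrite -lee_fin -prE//.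
  have cv := nondecreasing_cvg_mu (mu := P) (mNt m n) mU (incr m n).
  apply: (cvge_to_le cv); apply: nearW => r /=.
  have [h hh] := hn (2 ^ r)%N (expn_gt0 2 r).
  rewrite prE// lee_fin; apply: le_trans hh.
  apply: le_pr; [exact: mNt| |by move=> w; apply].
  exact: measurable_noncov.
have nB : P.-negligible (\bigcup_m B m).
  by apply: negligible_bigcup => m; exists (B m); split => //; exact: B0.
apply: negligibleS (negligibleU negligible_not_good nB).
move=> w [t [t01 ux]]; have [gw|] := pselect (good w); last by left.
right; have [m hm] := uncovered_noncov gw t01 ux.
by exists m => // n _; have [r hr] := hm n; exists r => // h _; exact: hr.
Qed.

End part_one.

(** * Second moment of the number of uncovered sites *)

Section pair_factor.
Context {R : realType}.

(** In this section [p] is the density of an arc, [g] bounds the probability that one position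
    covers both sites, and [e] is the probability of no resampling between the two times. The
    expression then bounds the probability that the arc misses the first site at the first time and
    the second site at the second. *)
Lemma pair_factor_ge0 (e g p : R) : 0 <= e -> e <= 1 -> 0 <= p -> p <= 1 / 2 ->
  0 <= g -> 0 <= (1 - p) ^+ 2 + e * (g - p ^+ 2).
Proof.
move=> e0 e1 p0 ph g0; have h1 : e * p ^+ 2 <= p ^+ 2 by rewrite ler_piMl ?sqr_ge0.
have h2 : 0 <= e * g by rewrite mulr_ge0.
rewrite mulrBr sqrrB expr1n mul1r; lra.
Qed.

Lemma pair_factor_far (e p : R) : 0 <= e ->
  (1 - p) ^+ 2 + e * (0 - p ^+ 2) <= (1 - p) ^+ 2.
Proof. by move=> e0; rewrite sub0r mulrN gerDl oppr_le0 mulr_ge0 ?sqr_ge0. Qed.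

(* [1 <= (1 + 6 p) (1 - p) ^+ 2] for [p <= 1 / 2] *)
Lemma pair_factor_near (e g p : R) : 0 <= e -> 0 <= p -> p <= 1 / 2 -> g <= p ->
  (1 - p) ^+ 2 + e * (g - p ^+ 2) <= (1 - p) ^+ 2 * (1 + (p + 6 * p ^+ 2) * e).
Proof.
move=> e0 p0 ph gp; have h1 : p <= (1 - p) ^+ 2 * (p + 6 * p ^+ 2).
  rewrite (_ : p + _ = p * (1 + 6 * p)); last by ring.
  rewrite mulrCA -[leLHS]mulr1 ler_wpM2l// -subr_ge0.
  rewrite (_ : _ - 1 = p * ((1 - 2 * p) * (4 - 3 * p))); last by ring.
  by rewrite mulr_ge0// mulr_ge0//; lra.
rewrite [leRHS]mulrDr mulr1 lerD2l [(p + _) * e]mulrC mulrCA ler_wpM2l//.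
by apply: le_trans h1; have := sqr_ge0 p; lra.
Qed.

End pair_factor.

Section two_points.
Context {R : realType} {d : measure_display} {Omega : measurableType d}
  {P : probability Omega R}.
Variables (l : R^nat) (C Y : nat -> nat -> {RV P >-> R}).
Hypothesis model : poisson_covering_model l C Y 0.
Local Notation Pr := (pr P).
Variable h : nat.
Local Notation st := (state C Y h).
Local Notation H := (h.+1%:R : R).

Lemma pr_two_times k t t' (phi phi' : pred 'I_h.+1) : 0 <= t -> t <= t' ->
  Pr [set om | phi (st k t om) && phi' (st k t' om)] =
  expR (- (t' - t)) * ((\sum_c (phi c && phi' c)%:R) / H) +
  (1 - expR (- (t' - t))) * ((\sum_c (phi c)%:R) / H) * ((\sum_c (phi' c)%:R) / H).
Proof.
move=> t0 tt'; set e := expR _.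
have mS u c : measurable (st k u @^-1` [set c]) by exact: measurable_state.
have mphi : measurable [set om | phi (st k t om)].
  by apply: measurable_fibres => c; exact: mS.
have -> : [set om | phi (st k t om) && phi' (st k t' om)] =
    [set om | phi (st k t om)] `&` [set om | phi' (st k t' om)].
  by apply/seteqP; split => om /= => [/andP//|[-> ->]].
rewrite (@pr_fibres _ _ _ P _ (st k t') _ mphi (mS t')).
have one c' : Pr ([set om | phi (st k t om)] `&` st k t' @^-1` [set c']) =
    \sum_c (phi c)%:R * (kernel (t' - t) c c' / H).
  rewrite setIC (@pr_fibres _ _ _ P _ (st k t) _ (mS t' c') (mS t)) big_mkcond /=.
  apply: eq_bigr => c _; case: (phi c); rewrite ?mul0r// mul1r setIC.
  have am := @adapted_state _ _ _ P C Y h k t t c t0 (lexx t).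
  by rewrite (markov model c' t0 tt' (mS t c) am (@subset_refl _ _)) (pr_state model).
under eq_bigr do rewrite one.
transitivity (\sum_c' \sum_c (phi' c')%:R * ((phi c)%:R * (kernel (t' - t) c c' / H))).
  rewrite big_mkcond /=; apply: eq_bigr => c' _; rewrite -mulr_sumr.
  by case: (phi' c'); rewrite ?mul1r ?mul0r.
rewrite exchange_big /=.
transitivity (\sum_c (e * ((phi c && phi' c)%:R / H) +
    (1 - e) / H * (phi c)%:R * ((\sum_c' (phi' c')%:R) / H))).
  apply: eq_bigr => c _.
  transitivity (\sum_c' ((phi' c')%:R * ((phi c)%:R * (e * (c == c')%:R / H)) +
      (1 - e) / H * (phi c)%:R * ((phi' c')%:R / H))).
    by apply: eq_bigr => c' _; rewrite /kernel -/e; ring.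
  rewrite big_split /= -mulr_sumr -mulr_suml; congr (_ + _).
  rewrite (bigD1 c)//= big1 ?addr0; last first.
    by move=> c' /negbTE; rewrite eq_sym => ->; rewrite mulr0 !mul0r !mulr0.
  by rewrite eqxx mulr1; case: (phi c); case: (phi' c); rewrite /= ?mul0r ?mulr0 ?mul1r.
rewrite big_split /=; congr (_ + _); first by rewrite -mulr_sumr -mulr_suml.
by rewrite -mulr_suml -mulr_sumr; ring.
Qed.

(** Both lengths being at most half the circle, there is no wrap-around: the second site is [D]
    cells after the first, so a position covering both covers the first with a width of only
    [w - D]. *)
Lemma sum_both_cov_half (w s : nat) (y y' : 'I_h.+1) : (2 * w <= h.+1)%N ->
  (2 * (y' - y : 'I_h.+1)%R <= h.+1)%N ->
  \sum_c ((cov w s c y && cov w s c y')%:R : R) <= (w - (y' - y : 'I_h.+1)%R)%:R.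
Proof.
move=> wh; set D := (y' - y : 'I_h.+1)%R => Dh.
have wD : (w - D <= h.+1)%N by lia.
rewrite -(sum_cov (R := R) s y wD); apply: ler_sum => c _.
rewrite ler_nat; suff : cov w s c y && cov w s c y' -> cov (w - D) s c y.
  by case: (_ && _) => //= ->.
rewrite /cov; move=> /andP[]; rewrite (_ : y' - c + inZp s = y - c + inZp s + D); last first.
  by rewrite /D [RHS]addrC [RHS]addrA subrKA.
set e := (y - c + inZp s)%R; clearbody e => ew.
have -> : (nat_of_ord (e + D)%R = (e + D) %% h.+1)%N by [].
by rewrite modn_small; lia.
Qed.

Definition circ_dist (y y' : 'I_h.+1) : nat :=
  minn (y' - y : 'I_h.+1)%R (h.+1 - (y' - y : 'I_h.+1)%R).

Lemma sum_both_cov (w s : nat) (y y' : 'I_h.+1) : (2 * w <= h.+1)%N ->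
  \sum_c ((cov w s c y && cov w s c y')%:R : R) <= (w - circ_dist y y')%:R.
Proof.
move=> wh; have e : (nat_of_ord (y - y')%R = (h.+1 - (y' - y : 'I_h.+1)%R) %% h.+1)%N.
  by rewrite -opprB.
rewrite /circ_dist; set D := (y' - y : 'I_h.+1)%R in e *.
have [Dh|Dh] := leqP D (h.+1 - D).
  by rewrite sum_both_cov_half// -/D; lia.
have DH := ltn_ord D.
have e' : (nat_of_ord (y - y')%R = h.+1 - D)%N by rewrite e modn_small//; lia.
under eq_bigr do rewrite andbC; rewrite -e'.
by apply: sum_both_cov_half => //; rewrite e'; lia.
Qed.

Variables (w s : nat -> nat).
Hypothesis wH : forall k, (w k <= h.+1)%N.
Local Notation p k := ((w k)%:R / H).
Local Notation uncov := (@uncov _ _ _ _ C Y h w s).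

Lemma pr_pair_arc k t t' (y y' : 'I_h.+1) : 0 <= t -> t <= t' ->
  (2 * w k <= h.+1)%N ->
  Pr [set om | ~~ cov (w k) (s k) (st k t om) y && ~~ cov (w k) (s k) (st k t' om) y'] <=
  (1 - p k) ^+ 2 + expR (- (t' - t)) *
    ((w k - circ_dist y y')%:R / H - (p k) ^+ 2).
Proof.
move=> t0 tt' w2.
have H0 : 0 < H by rewrite ltr0n.
rewrite (pr_two_times k (fun c => ~~ cov (w k) (s k) c y) (fun c => ~~ cov (w k) (s k) c y') t0 tt').
rewrite !sum_not_cov//.
have both := sum_both_cov (s k) y y' w2.
have -> : \sum_c ((~~ cov (w k) (s k) c y && ~~ cov (w k) (s k) c y')%:R : R) =
    H - (w k)%:R - (w k)%:R + \sum_c ((cov (w k) (s k) c y && cov (w k) (s k) c y')%:R : R).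
  rewrite -{1}(sum_cov (R := R) (s k) y (wH k)) -(sum_cov (R := R) (s k) y' (wH k)).
  have -> : H = \sum_(c < h.+1) 1 by rewrite sumr_const card_ord.
  rewrite -!sumrB -big_split /=; apply: eq_bigr => c _.
  by do 2 case: cov; rewrite /= ?subr0 ?subrr ?addr0 ?sub0r ?addNr.
have e0 : 0 <= expR (- (t' - t)) := expR_ge0 _.
set e := expR _ in e0 *; set g := \sum_c _ in both *.
have gb : g / H <= (w k - circ_dist y y')%:R / H by rewrite ler_pM2r// invr_gt0.
have -> : (H - (w k)%:R - (w k)%:R + g) / H = 1 - p k - p k + g / H.
  by rewrite mulrDl !mulrBl divff ?gt_eqF.
move: (g / H) ((_ - _)%:R / H) gb (p k) => x1 x2 gb x3.
by have := ler_wpM2l e0 gb; nra.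
Qed.

Lemma pr_pair m n t t' (y y' : 'I_h.+1) : (m <= n)%N -> 0 <= t -> t <= t' ->
  (forall k, (m <= k)%N -> (2 * w k <= h.+1)%N) ->
  Pr (uncov m n t y `&` uncov m n t' y') <=
  \prod_(m <= k < n) ((1 - p k) ^+ 2 + expR (- (t' - t)) *
    ((w k - circ_dist y y')%:R / H - (p k) ^+ 2)).
Proof.
move=> mn t0 tt' w2.
pose E k := [set om | ~~ cov (w k) (s k) (st k t om) y && ~~ cov (w k) (s k) (st k t' om) y'].
have -> : uncov m n t y `&` uncov m n t' y' = [set om | forall k, (m <= k < n)%N -> E k om].
  apply/seteqP; split => om /=.
    by move=> [u u'] k mk; rewrite /E /= u// u'.
  by move=> Eo; split => k mk; have /andP[] := Eo k mk.
rewrite (pr_arcs model mn); last first.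
  move=> k _; have -> : E k = [set om | ~~ cov (w k) (s k) (st k t om) y] `&`
      [set om | ~~ cov (w k) (s k) (st k t' om) y'].
    by apply/seteqP; split => om /= => [/andP//|[]]; rewrite /E /= => -> ->.
  apply: sigI.
    exact: (@sig_state_pred _ _ _ P C Y h k t (fun c => ~~ cov (w k) (s k) c y)).
  exact: (@sig_state_pred _ _ _ P C Y h k t' (fun c => ~~ cov (w k) (s k) c y')).
rewrite big_nat_cond [leRHS]big_nat_cond; apply: ler_prod => k /andP[/andP[mk kn] _].
by rewrite pr_ge0 pr_pair_arc// w2.
Qed.

Hypothesis p_half : forall k, p k <= 1 / 2.

(** An arc too short to cover both sites makes the two events of being missed negatively
    correlated. *)
Lemma pr_pair_far m n t t' (y y' : 'I_h.+1) : (m <= n)%N -> 0 <= t -> t <= t' ->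
  (forall k, (m <= k)%N -> (2 * w k <= h.+1)%N) ->
  (forall k, (m <= k)%N -> (w k <= circ_dist y y')%N) ->
  Pr (uncov m n t y `&` uncov m n t' y') <= (\prod_(m <= k < n) (1 - p k)) ^+ 2.
Proof.
move=> mn t0 tt' w2 far; apply: (le_trans (pr_pair y y' mn t0 tt' w2)).
rewrite -prodrXl big_nat_cond [leRHS]big_nat_cond; apply: ler_prod => k /andP[/andP[mk _] _].
have -> : (w k - circ_dist y y' = 0)%N by apply/eqP; rewrite subn_eq0 far.
rewrite mul0r sub0r.
have e0 : 0 <= expR (- (t' - t)) := expR_ge0 _.
have e1 : expR (- (t' - t)) <= 1 :> R.
  by rewrite -[leRHS]expR0 ler_expR oppr_le0 subr_ge0.
have p0 : 0 <= p k by rewrite divr_ge0.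
have ph := p_half k; have := pair_factor_ge0 e0 e1 p0 ph (lexx 0).
by rewrite sub0r => -> /=; have := pair_factor_far (p k) e0; rewrite sub0r.
Qed.

(** Only the arcs longer than the distance create positive correlation, each through a factor
    [1 + x], bounded by [expR x]. *)
Lemma pr_pair_near m n t t' (y y' : 'I_h.+1) (S : R) : (m <= n)%N -> 0 <= t -> t <= t' ->
  (forall k, (m <= k)%N -> (2 * w k <= h.+1)%N) ->
  \sum_(m <= k < n) (if (circ_dist y y' < w k)%N then p k + 6 * (p k) ^+ 2 else 0) <= S ->
  Pr (uncov m n t y `&` uncov m n t' y') <=
  (\prod_(m <= k < n) (1 - p k)) ^+ 2 * expR (S * expR (- (t' - t))).
Proof.
move=> mn t0 tt' w2 hS; apply: (le_trans (pr_pair y y' mn t0 tt' w2)).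
have e0 : 0 <= expR (- (t' - t)) := expR_ge0 _.
have e1 : expR (- (t' - t)) <= 1 :> R.
  by rewrite -[leRHS]expR0 ler_expR oppr_le0 subr_ge0.
apply: (@le_trans _ _ ((\prod_(m <= k < n) (1 - p k)) ^+ 2 *
    expR (\sum_(m <= k < n) (if (circ_dist y y' < w k)%N then p k + 6 * (p k) ^+ 2 else 0)
      * expR (- (t' - t))))); last first.
  by rewrite -mulr_suml ler_wpM2l ?sqr_ge0// ler_expR ler_wpM2r.
rewrite -prodrXl expR_sum -big_split /= big_nat_cond [leRHS]big_nat_cond.
apply: ler_prod => k /andP[/andP[mk _] _].
have p0 : 0 <= p k by rewrite divr_ge0.
have ph := p_half k; set g := (w k - circ_dist y y')%:R / H.
have g0 : 0 <= g by rewrite divr_ge0.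
rewrite (pair_factor_ge0 e0 e1 p0 ph g0) /=.
case: ifPn => [cw|]; last first.
  rewrite -leqNgt => wc; have -> : g = 0.
    by rewrite /g (_ : (w k - circ_dist y y' = 0)%N) ?mul0r//; apply/eqP; rewrite subn_eq0.
  by rewrite mul0r expR0 mulr1; exact: pair_factor_far.
have gp : g <= p k by rewrite /g ler_pM2r ?invr_gt0 ?ltr0n// ler_nat leq_subr.
apply: le_trans (pair_factor_near e0 p0 ph gp) _.
by rewrite ler_wpM2l ?sqr_ge0// expR_ge1Dx.
Qed.

End two_points.

Section second_moment.
Context {R : realType} {d : measure_display} {Omega : measurableType d}
  {P : probability Omega R}.
Local Notation Pr := (pr P).

(** For the number [N] of events that occur, [2 a N - a^2 N^2] is at most 1 and vanishes at [N = 0].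
    The free parameter [a] avoids a quotient of moments. *)
Lemma second_moment (T : finType) (A : T -> set Omega) (a : R) :
  (forall x, measurable (A x)) ->
  2 * a * \sum_x Pr (A x) - a ^+ 2 * \sum_x \sum_x' Pr (A x `&` A x') <=
  Pr [set om | exists x, A x om].
Proof.
move=> mA; pose q (S : {set T}) := Pr (pattern A @^-1` [set S]).
have q0 S : 0 <= q S by exact: pr_ge0.
have -> : Pr [set om | exists x, A x om] = \sum_(S | S != finset.set0) q S.
  have := @pr_pattern _ _ _ P T A mA setT (fun S => S != finset.set0) measurableT.
  rewrite setTI; under [in X in _ = X -> _]eq_bigr do rewrite setTI.
  move=> <-; congr Pr; apply/seteqP; split => om /=.
    by move=> [x Ax]; apply/set0Pn; exists x; rewrite inE; apply/asboolP.
  by move=> /set0Pn[x]; rewrite inE => /asboolP; exists x.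
have -> : \sum_x \sum_x' Pr (A x `&` A x') = \sum_(S : {set T}) #|S|%:R ^+ 2 * q S.
  transitivity (\sum_x \sum_x' \sum_(S : {set T} | (x \in S) && (x' \in S)) q S).
    apply: eq_bigr => x _; apply: eq_bigr => x' _.
    have := @pr_pattern _ _ _ P T A mA setT (fun S => (x \in S) && (x' \in S)) measurableT.
    rewrite setTI; under [in X in _ = X -> _]eq_bigr do rewrite setTI.
    move=> <-; congr Pr; apply/seteqP; split => om /=; rewrite !inE.
      by move=> [a1 a2]; apply/andP; split; apply/asboolP.
    by move=> /andP[/asboolP a1 /asboolP a2].
  transitivity (\sum_x \sum_(S : {set T}) \sum_(x' | (x \in S) && (x' \in S)) q S).
    apply: eq_bigr => x _; exact: (exchange_big_dep xpredT).
  rewrite exchange_big /=; apply: eq_bigr => S _.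
  transitivity (\sum_(x in S) \sum_(x' in S) q S).
    rewrite [RHS]big_mkcond /=; apply: eq_bigr => x _.
    by case: ifP => _ //; rewrite big_pred0.
  by rewrite !sumr_const -mulrnA -[LHS]mulr_natl natrM expr2.
rewrite (sum_pr_pattern mA) !mulr_sumr -sumrB [leRHS]big_mkcond /=.
apply: ler_sum => S _; rewrite -/(q S).
have [->|S0] := eqVneq S finset.set0.
  by rewrite cards0 mul0r expr0n /= mul0r !mulr0 subrr.
rewrite !mulrA -mulrBl ler_piMl//.
have := sqr_ge0 (a * #|S|%:R - 1); nra.
Qed.

End second_moment.

Section sums.
Context {R : realType}.

Lemma expRN_half (t : R) : 0 <= t -> t <= 1 -> expR (- t) <= 1 - t / 2.
Proof.
move=> t0 t1; rewrite expRN -[leLHS]mul1r ler_pdivrMr ?expR_gt0//.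
apply: (@le_trans _ _ ((1 - t / 2) * (1 + t))); first by nra.
by rewrite ler_wpM2l ?expR_ge1Dx//; lra.
Qed.

(** On [[0, 1]] the exponent is at most [S - S t / 2], so the sum is dominated by a geometric series
    of ratio [expR (- y)], whose sum is at most [1 + 1 / y = 1 + 2 M / S]. *)
Lemma sum_exp_decay (S : R) (M : nat) : 0 < S -> (0 < M)%N ->
  \sum_(i < M) expR (S * expR (- (i%:R / M%:R))) <=
  M%:R * (expR S * (M%:R^-1 + 2 / S)).
Proof.
move=> S0 M0; have Mr : 0 < M%:R :> R by rewrite ltr0n.
pose y := S / (2 * M%:R); have y0 : 0 < y by rewrite divr_gt0// mulr_gt0.
pose rho := expR (- y).
have rho1 : rho < 1 by rewrite -[ltRHS]expR0 ltr_expR oppr_lt0.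
apply: (@le_trans _ _ (\sum_(i < M) expR S * rho ^+ i)).
  apply: ler_sum => i _; rewrite -expRM_natl -expRD ler_expR.
  have iM : i%:R / M%:R <= 1 :> R by rewrite ler_pdivrMr// mul1r ler_nat ltnW.
  have i0 : 0 <= i%:R / M%:R :> R by rewrite divr_ge0.
  apply: le_trans (ler_wpM2l (ltW S0) (expRN_half i0 iM)) _.
  apply: le_of_eq; rewrite /y.
  by field; rewrite gt_eqF.
rewrite -mulr_sumr mulrCA ler_wpM2l ?expR_ge0//.
have geo : (1 - rho) * \sum_(i < M) rho ^+ i = 1 - rho ^+ M.
  by rewrite -[in RHS](expr1n _ M) subrXX; congr (_ * _); apply: eq_bigr => i _;
    rewrite expr1n mul1r.
have r1 : 0 < 1 - rho by rewrite subr_gt0.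
apply: (@le_trans _ _ ((1 - rho)^-1)).
  by rewrite -[leRHS]mulr1 ler_pdivlMl// geo gerBl exprn_ge0// expR_ge0.
have rb : y / (1 + y) <= 1 - rho.
  have : rho <= (1 + y)^-1.
    by rewrite /rho expRN lef_pV2 ?posrE ?expR_gt0 ?expR_ge1Dx// addr_gt0.
  have e1 : (1 + y)^-1 = 1 - y / (1 + y) by field; rewrite gt_eqF// addr_gt0.
  by rewrite {1}e1 => hr; rewrite lerBrDr addrC -lerBrDr.
apply: (@le_trans _ _ ((y / (1 + y))^-1)).
  by rewrite lef_pV2 ?posrE// divr_gt0// addr_gt0.
apply: le_of_eq; rewrite /y.
by field; rewrite !gt_eqF// addr_gt0// mulr_gt0.
Qed.

Lemma sum_dist_le (f : nat -> R) (M q : nat) : (forall i, 0 <= f i) -> (q < M)%N ->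
  \sum_(q' < M) f ((q - q') + (q' - q))%N <= 2 * \sum_(i < M) f i.
Proof.
move=> f0 qM; rewrite mulr2n mulrDl !mul1r.
rewrite -(big_mkord xpredT (fun q' => f ((q - q') + (q' - q))%N)) -(big_mkord xpredT f).
rewrite (@big_cat_nat _ _ _ q 0 M)//=; last exact: ltnW.
apply: lerD.
  rewrite big_nat_rev add0n /=.
  rewrite [leRHS](@big_cat_nat _ _ _ q.+1 0 M)//=.
  rewrite big_nat_recl//=.
  apply: (@le_trans _ _ (\sum_(0 <= i < q) f i.+1)).
    apply: le_of_eq; apply: eq_big_nat => i /andP[_ iq].
    by congr f; lia.
  have s1 : 0 <= \sum_(q.+1 <= i < M) f i by apply: sumr_ge0.
  by move: (f0 0%N); lra.
rewrite -{1}[q]add0n big_addn; apply: (@le_trans _ _ (\sum_(0 <= i < M - q) f i)).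
  apply: le_of_eq; apply: eq_big_nat => i _.
  by congr f; lia.
rewrite [leRHS](@big_cat_nat _ _ _ (M - q) 0 M)//= ?leq_subr// lerDl.
exact: sumr_ge0.
Qed.

Lemma sum_circ_dist (h : nat) (y : 'I_h.+1) (G : nat -> R) (W : nat) :
  (forall j, 0 <= G j) -> (forall j, (W <= j)%N -> G j = 0) -> (W <= h.+1)%N ->
  \sum_y' G (circ_dist y y') <= 2 * \sum_(j < W) G j.
Proof.
move=> G0 GW Wh.
have full : \sum_(j < h.+2) G j = \sum_(j < W) G j.
  rewrite [RHS](big_ord_widen h.+2 G); last exact: leqW.
  rewrite [RHS]big_mkcond /=; apply: eq_bigr => j _.
  by case: ltnP => // /GW.
pose F (D : 'I_h.+1) := G (minn D (h.+1 - D)).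
have -> : \sum_y' G (circ_dist y y') = \sum_D F D.
  rewrite [RHS](reindex_inj (fun a b => @addIr _ (- y) a b)) /=.
  by apply: eq_bigr.
apply: (@le_trans _ _ (\sum_(D < h.+1) (G D + G (h.+1 - D)%N))).
  apply: ler_sum => D _; rewrite /F; case: leqP => _; first by rewrite lerDl.
  by rewrite lerDr.
rewrite big_split /= mulr2n mulrDl !mul1r -full; apply: lerD.
  by rewrite [leRHS]big_ord_recr /= lerDl.
rewrite [leRHS]big_ord_recl /=; apply: (@le_trans _ _ (\sum_(j < h.+1) G j.+1)).
  rewrite (reindex_inj rev_ord_inj) /=; apply: ler_sum => j _.
  by rewrite subKn// ltnW.
by rewrite lerDr.
Qed.

End sums.

Section second_core.
Context {R : realType} {d : measure_display} {Omega : measurableType d}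
  {P : probability Omega R}.
Variables (l : R^nat) (C Y : nat -> nat -> {RV P >-> R}).
Hypothesis model : poisson_covering_model l C Y 0.
Local Notation Pr := (pr P).
Variable h : nat.
Local Notation H := (h.+1%:R : R).
Variables (w s : nat -> nat).
Hypothesis wH : forall k, (w k <= h.+1)%N.
Local Notation p k := ((w k)%:R / H).
Local Notation uncov := (@uncov _ _ _ _ C Y h w s).
Hypothesis p_half : forall k, p k <= 1 / 2.
Variables (m n M : nat) (S : nat -> R).
Hypothesis mn : (m <= n)%N.
Hypothesis M_gt0 : (0 < M)%N.
Hypothesis w2 : forall k, (m <= k)%N -> (2 * w k <= h.+1)%N.
Hypothesis w_decr : forall k, (m <= k)%N -> (w k <= w m)%N.
Hypothesis S_gt0 : forall j, (j < w m)%N -> 0 < S j.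
Hypothesis S_ge : forall j, (j < w m)%N ->
  \sum_(m <= k < n) (if (j < w k)%N then p k + 6 * (p k) ^+ 2 else 0) <= S j.

(* Two sites at distance [j < w m], at times [t] apart, are simultaneously
   uncovered with at most [expR (S j * expR (- t))] times the probability they
   would have if independent; summing over the times yields the weight
   [expR (S j) * (1 / M + 2 / S j)] of the distance [j]. *)
Lemma pr_exists_uncov :
  1 - 4 / H * (\sum_(j < w m) expR (S j) * (M%:R^-1 + 2 / S j)) <=
  Pr [set om | exists x : 'I_h.+1 * 'I_M, uncov m n (x.2%:R / M%:R) x.1 om].
Proof.
have H0 : 0 < H by rewrite ltr0n.
have Mr : 0 < M%:R :> R by rewrite ltr0n.
set U := \prod_(m <= k < n) (1 - p k).
have U0 : 0 < U by apply: prodr_gt0 => k _; rewrite subr_gt0 (le_lt_trans (p_half k))//; lra.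
pose A (x : 'I_h.+1 * 'I_M) := uncov m n (x.2%:R / M%:R) x.1.
have t0 (q : nat) : 0 <= q%:R / M%:R :> R by rewrite divr_ge0.
pose N (j i : nat) : R := if (j < w m)%N then expR (S j * expR (- (i%:R / M%:R))) else 0.
pose G (j : nat) : R := if (j < w m)%N then expR (S j) * (M%:R^-1 + 2 / S j) else 0.
have N0 j i : 0 <= N j i by rewrite /N; case: ifP => // _; exact: expR_ge0.
have G0 j : 0 <= G j.
  rewrite /G; case: ifP => // jw; rewrite mulr_ge0 ?expR_ge0// addr_ge0 ?invr_ge0//.
  by rewrite divr_ge0// ltW// S_gt0.
have pair_le (y y' : 'I_h.+1) (q q' : nat) : (q <= q')%N ->
    Pr (uncov m n (q%:R / M%:R) y `&` uncov m n (q'%:R / M%:R) y') <=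
    U ^+ 2 * (1 + N (circ_dist y y') (q' - q)%N).
  move=> qq'; have tt : q%:R / M%:R <= q'%:R / M%:R :> R.
    by rewrite ler_pM2r ?invr_gt0// ler_nat.
  rewrite /N; case: ifPn => [cw|].
    apply: le_trans (pr_pair_near model s wH p_half mn (t0 q) tt w2 (S_ge cw)) _.
    by rewrite ler_wpM2l ?sqr_ge0// -mulrBl -natrB// lerDr.
  rewrite -leqNgt => wc; rewrite addr0 mulr1.
  by apply: (pr_pair_far model) => // k mk; exact: leq_trans (w_decr mk) wc.
have cdC (y y' : 'I_h.+1) : circ_dist y y' = circ_dist y' y.
  rewrite /circ_dist -[y - y']opprB; set D := (y' - y)%R.
  have -> : (nat_of_ord (- D)%R = (h.+1 - D) %% h.+1)%N by [].
  have := ltn_ord D; case: (nat_of_ord D) => [|e] De.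
    by rewrite subn0 modnn subn0.
  by rewrite modn_small; lia.
have pair_le' x x' : Pr (A x `&` A x') <=
    U ^+ 2 * (1 + N (circ_dist x.1 x'.1) ((x.2 - x'.2) + (x'.2 - x.2))%N).
  have [q12|q21] := leqP x.2 x'.2.
    by have := pair_le x.1 x'.1 _ _ q12; rewrite (_ : (x.2 - x'.2 = 0)%N)//; apply/eqP.
  have := pair_le x'.1 x.1 _ _ (ltnW q21); rewrite setIC cdC.
  by rewrite [X in (_ + X)%N](_ : _ = 0%N) ?addn0//; apply/eqP; exact: ltnW.
(* The factor 4: each time lag and each circular distance is attained at most twice. *)
have inner (x : 'I_h.+1 * 'I_M) : \sum_(x' : 'I_h.+1 * 'I_M) N (circ_dist x.1 x'.1) ((x.2 - x'.2) + (x'.2 - x.2))%N <=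
    4 * M%:R * \sum_(j < w m) G j.
  rewrite -(pair_bigA _ (fun (y' : 'I_h.+1) (q' : 'I_M) => N (circ_dist x.1 y') ((x.2 - q') + (q' - x.2))%N)) /=.
  apply: (@le_trans _ _ (\sum_y' 2 * (M%:R * G (circ_dist x.1 y')))).
    apply: ler_sum => y' _.
    apply: le_trans (sum_dist_le (N0 (circ_dist x.1 y')) (ltn_ord x.2)) _.
    rewrite ler_wpM2l// /N /G; case: ifPn => cw; last by rewrite big1 ?mulr0.
    by apply: sum_exp_decay => //; exact: S_gt0.
  rewrite -!mulr_sumr.
  have Gc := @sum_circ_dist _ h x.1 G (w m) G0 _ (wH m).
  apply: (@le_trans _ _ (2 * (M%:R * (2 * \sum_(j < w m) G j)))).
    rewrite ler_wpM2l// ler_wpM2l//; apply: Gc => j wj.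
    by rewrite /G ltnNge wj.
  by apply: le_of_eq; ring.
have cardT : (\sum_(x : 'I_h.+1 * 'I_M) 1 : R) = H * M%:R.
  by rewrite sumr_const card_prod !card_ord natrM.
(* The inverse of the expected number of uncovered pairs: [second_moment] then gives 2 minus the
   normalised second moment. *)
pose a := (H * M%:R * U)^-1.
have s1 : \sum_x Pr (A x) = H * M%:R * U.
  rewrite -cardT mulr_suml; apply: eq_bigr => x _; rewrite mul1r.
  exact: (pr_uncov model).
have s2 : \sum_x \sum_x' Pr (A x `&` A x') <=
    U ^+ 2 * (H * M%:R * (H * M%:R + 4 * M%:R * \sum_(j < w m) G j)).
  apply: (@le_trans _ _ (\sum_(x : 'I_h.+1 * 'I_M) U ^+ 2 *
      (H * M%:R + 4 * M%:R * \sum_(j < w m) G j))).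
    apply: ler_sum => x _.
    apply: le_trans (ler_sum _ (fun x' _ => pair_le' x x')) _.
    rewrite -mulr_sumr ler_wpM2l ?sqr_ge0// big_split /= cardT lerD2l.
    exact: inner.
  rewrite sumr_const card_prod !card_ord -[leLHS]mulr_natl natrM.
  by apply: le_of_eq; ring.
have mA x : measurable (A x) by exact: measurable_uncov.
apply: le_trans (second_moment a mA).
rewrite s1; apply: (@le_trans _ _ (2 * a * (H * M%:R * U) -
    a ^+ 2 * (U ^+ 2 * (H * M%:R * (H * M%:R + 4 * M%:R * \sum_(j < w m) G j))))); last first.
  by rewrite lerD2l lerN2 ler_wpM2l ?sqr_ge0.
have -> : \sum_(j < w m) G j = \sum_(j < w m) expR (S j) * (M%:R^-1 + 2 / S j).
  by apply: eq_bigr => j _; rewrite /G ltn_ord.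
apply: le_of_eq; rewrite /a.
move: (\sum_(j < _) _) => E; field.
by rewrite !gt_eqF.
Qed.

End second_core.

(** * Bounding the correlations by the series *)

Section outer_discretisation.
Context {R : realType}.
Variables (l : R^nat) (M0 M1 : R).
Hypothesis l_pos : forall n, 0 < l n.
Hypothesis l_decr : nonincreasing_seq l.
Hypothesis M0_pos : 0 < M0.
Hypothesis l_bounds : forall n, M0 / n.+1%:R <= l n <= M1 / n.+1%:R.
Local Notation L := (partial_sum l).

Let M1_pos : 0 < M1 := M1_gt0 M0_pos l_bounds.

(* An arc of length [l k] meets at most [2 * s + 2] sites, where [s] is the
   number of cells in half its length; the arcs of index less than [m] are
   ignored. *)
Definition outer_width (m h k : nat) : nat :=
  if (k < m)%N then 0%N else minn (2 * inner_radius l h k + 2) h.+1.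

Lemma outer_width_ltH m h k : (outer_width m h k <= h.+1)%N.
Proof. by rewrite /outer_width; case: ifP => // _; exact: geq_minr. Qed.

Lemma outer_width_le m h k : (outer_width m h k)%:R <= h.+1%:R * l k + 2 :> R.
Proof.
have := inner_radius_le l_pos h k; have lk := l_pos k.
have H0 : 0 < h.+1%:R :> R by rewrite ltr0n.
have x0 : 0 < h.+1%:R * l k by exact: mulr_gt0.
rewrite /outer_width; case: ifP => [_ _|_ hr]; first by rewrite ler_wpDr// ltW.
apply: (@le_trans _ _ (2 * inner_radius l h k + 2)%:R); first by rewrite ler_nat geq_minl.
by rewrite natrD natrM; move: hr; move: (_ * l k) (inner_radius _ _ _)%:R => x1 x2; lra.
Qed.

Lemma outer_width_decr m h k : (m <= k)%N -> (outer_width m h k <= outer_width m h m)%N.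
Proof.
move=> mk; rewrite /outer_width ltnn ltnNge mk /= leq_min geq_minr andbT.
apply: (leq_trans (geq_minl _ _)); rewrite leq_add2r leq_mul2l /=.
apply: le_truncn; rewrite ler_wpM2r// ler_wpM2l//; exact: l_decr.
Qed.

Definition expo (J : nat) : R := expR (L J) / (J%:R ^+ 2 * ln J%:R).

Lemma expo_ge0 J : 0 <= expo J.
Proof.
case: J => [|J]; first by rewrite /expo ln0 ?mulr0 ?invr0 ?mulr0.
by rewrite divr_ge0 ?expR_ge0// mulr_ge0 ?sqr_ge0// ln_ge0// ler1n.
Qed.

Lemma sum_inv_sqr (n : nat) : \sum_(k < n) (k.+1%:R^-1) ^+ 2 <= 2 :> R.
Proof.
suff : \sum_(k < n.+1) (k.+1%:R^-1) ^+ 2 <= 2 - n.+1%:R^-1 :> R.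
  rewrite big_ord_recr /= => hs.
  have i0 : 0 <= n.+1%:R^-1 :> R by rewrite invr_ge0.
  by have := sqr_ge0 (n.+1%:R^-1 : R); move: hs i0; move: (\sum_(_ < _) _) (_^-1) => x1 x2; lra.
elim: n => [|n IH]; first by rewrite big_ord_recr big_ord0 /= invr1; lra.
rewrite big_ord_recr /=; apply: (le_trans (lerD IH (lexx _))).
have a0 : 0 < n.+1%:R :> R by rewrite ltr0n.
rewrite -[n.+2%:R]natr1; move: (n.+1%:R) a0 => a a0.
have a1 : 0 < a + 1 by lra.
have -> : 2 - a^-1 + (a + 1)^-1 ^+ 2 = 2 - (a + 1)^-1 - (a * (a + 1) ^+ 2)^-1.
  by field; rewrite !gt_eqF.
by rewrite gerBl invr_ge0 mulr_ge0 ?sqr_ge0// ltW.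
Qed.

Definition block_factor : nat := (Num.truncn (4 * M1)).+1.

(** The first term pays for passing from [L (block_factor * J)] to [L J], the 2 for rounding the
    densities of [n] arcs, and the last term for the squares in the exponent of [pr_pair_near]. *)
Definition exponent_const : R := block_factor%:R * M1 + 2 + 6 * (4 * M1 ^+ 2 + 8).

Lemma exponent_const_gt0 : 0 < exponent_const.
Proof.
rewrite /exponent_const; have := sqr_ge0 M1.
have : 0 < block_factor%:R * M1 by rewrite mulr_gt0// ltr0n.
by move: (_ * M1) (M1 ^+ 2) => x1 x2; lra.
Qed.

Lemma partial_sum_mul (J A : nat) : (0 < J)%N -> (0 < A)%N ->
  L (A * J) <= L J + A%:R * M1.
Proof.
move=> J0 A0; have JA : (J <= A * J)%N by rewrite leq_pmull.
rewrite /partial_sum -!(big_mkord xpredT l) (@big_cat_nat _ _ _ J 0)//= lerD2l.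
have Jr : 0 < J%:R :> R by rewrite ltr0n.
apply: (@le_trans _ _ (\sum_(J <= k < A * J) M1 / J%:R)).
  rewrite big_nat_cond [leRHS]big_nat_cond; apply: ler_sum => k /andP[/andP[Jk _] _].
  have /andP[_ lk] := l_bounds k; apply: (le_trans lk).
  by rewrite ler_wpM2l ?(ltW M1_pos)// lef_pV2 ?posrE ?ltr0n// ler_nat leqW.
rewrite sumr_const_nat -[leLHS]mulr_natl.
apply: (@le_trans _ _ ((A * J)%:R * (M1 / J%:R))).
  by rewrite ler_wpM2r ?divr_ge0 ?(ltW M1_pos)// ler_nat leq_subr.
by rewrite natrM; apply: le_of_eq; field; rewrite gt_eqF.
Qed.

Lemma partial_sum_homo a b : (a <= b)%N -> L a <= L b.
Proof.
move=> ab; rewrite /partial_sum -!(big_mkord xpredT l) (@big_cat_nat _ _ _ a 0 b)//= lerDl.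
by apply: sumr_ge0 => k _; exact: ltW.
Qed.

Section fixed_scale.
Variables (m n h : nat).
Hypothesis n2 : (2 <= n)%N.
Hypothesis mn : (m <= n)%N.
Hypothesis hn : (h.+1 = 4 * n ^ 2)%N.
Local Notation H := (h.+1%:R : R).
Local Notation w := (outer_width m h).

(** Up to a constant factor, the number of arcs longer than [j] cells, capped at the number [n] of
    arcs considered. *)
Definition scale (j : nat) : nat := if (j * n <= h.+1)%N then n else (h.+1 %/ j)%N.

Lemma nH : (4 * n <= h.+1)%N. Proof. by rewrite hn leq_mul2l /= expnS expn1 leq_pmulr//; lia. Qed.

(** An arc wider than [j] satisfies [j <= H M1 / k.+1 + 2] with [H = h.+1]; the 2 is absorbed
    because [j > 4], so [k.+1 <= 2 H M1 / j], and [H < 2 J j] for the scale [J]. Hence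
    [block_factor > 4 M1]. *)
Lemma close_arcs (j k : nat) : (h.+1 < j * n)%N -> (m <= k)%N -> (j < w k)%N ->
  (k < block_factor * scale j)%N.
Proof.
move=> jn mk jw; rewrite /scale [(j * n <= _)%N]leqNgt jn /=; have h4 := nH.
have j4 : (4 < j)%N.
  rewrite ltnNge; apply/negP => j4.
  by move: jn; rewrite ltnNge (leq_trans _ h4)// leq_mul2r j4 orbT.
have jH : (j <= h.+1)%N by rewrite ltnW// (leq_trans jw)// outer_width_ltH.
set J := (h.+1 %/ j)%N; have J1 : (0 < J)%N by rewrite divn_gt0//; lia.
have HJ : (h.+1 < 2 * J * j)%N.
  have h1 : (h.+1 < J.+1 * j)%N by rewrite ltn_ceil//; lia.
  by apply: (leq_trans h1); rewrite leq_mul2r; lia.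
rewrite -(ltr_nat R) natrM.
have jr : 0 < j%:R :> R by rewrite ltr0n; lia.
have H0 : 0 < H by rewrite ltr0n.
have wk := outer_width_le m h k; have /andP[_ lk] := l_bounds k.
have k0 : 0 < k.+1%:R :> R by rewrite ltr0n.
have s1 : j%:R <= H * (M1 / k.+1%:R) + 2.
  apply: (@le_trans _ _ ((w k)%:R)); first by rewrite ler_nat ltnW.
  by apply: (le_trans wk); rewrite lerD2r ler_wpM2l// ltW.
have s2 : j%:R <= 2 * (H * (M1 / k.+1%:R)).
  have : 4 <= j%:R :> R by rewrite ler_nat ltnW.
  by move: s1; move: (_ * (M1 / _)) (j%:R) => x1 x2; lra.
have s3 : k.+1%:R * j%:R <= 2 * H * M1.
  rewrite -ler_pdivlMl// (le_trans s2)//; apply: le_of_eq.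
  by field; rewrite gt_eqF.
have s4 : H < 2 * J%:R * j%:R by rewrite -!natrM ltr_nat.
have s5 : 4 * M1 < block_factor%:R by exact: truncnS_gt.
have Jr : 0 < J%:R :> R by rewrite ltr0n.
rewrite -(ltr_pM2r jr); apply: (@lt_le_trans _ _ (k.+1%:R * j%:R)).
  by rewrite ltr_pM2r// ltr_nat.
apply: (le_trans s3); apply: (@le_trans _ _ (4 * M1 * J%:R * j%:R)).
  have -> : 4 * M1 * J%:R * j%:R = 2 * (2 * J%:R * j%:R) * M1 by ring.
  by rewrite ler_pM2r// ler_pM2l// ltW.
by rewrite ler_pM2r// ler_pM2r// ltW.
Qed.

Lemma sum_close_arcs (j : nat) : (j < w m)%N ->
  \sum_(m <= k < n) (if (j < w k)%N then (w k)%:R / H + 6 * ((w k)%:R / H) ^+ 2 else 0) <=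
  L (scale j) + exponent_const.
Proof.
move=> jw; have H0 : 0 < H by rewrite ltr0n.
have h4 := nH; have nHr : n%:R <= H by rewrite ler_nat; lia.
have i2 : 0 <= 2 / H by rewrite divr_ge0// ltW.
have p0 k : 0 <= (w k)%:R / H by rewrite divr_ge0.
have pk k : (w k)%:R / H <= l k + 2 / H.
  by rewrite ler_pdivrMr// mulrDl divfK ?gt_eqF// mulrC outer_width_le.
have sq : \sum_(m <= k < n) ((w k)%:R / H) ^+ 2 <= 4 * M1 ^+ 2 + 8.
  apply: (@le_trans _ _ (\sum_(0 <= k < n) (2 * M1 ^+ 2 * (k.+1%:R^-1) ^+ 2 + 2 * (2 / H) ^+ 2))).
    rewrite [leRHS](@big_cat_nat _ _ _ m 0 n)//= -[leLHS]add0r; apply: lerD.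
      apply: sumr_ge0 => k _; apply: addr_ge0; last by rewrite mulr_ge0 ?sqr_ge0.
      by apply: mulr_ge0 (sqr_ge0 _); rewrite mulr_ge0 ?sqr_ge0.
    apply: ler_sum => k _; have /andP[_ lk] := l_bounds k.
    have : (w k)%:R / H <= M1 / k.+1%:R + 2 / H by apply: (le_trans (pk k)); rewrite lerD2r.
    have : 0 <= M1 / k.+1%:R by rewrite divr_ge0 ?(ltW M1_pos).
    have -> : 2 * M1 ^+ 2 * (k.+1%:R^-1) ^+ 2 = 2 * (M1 / k.+1%:R) ^+ 2 by rewrite expr_div_n exprVn; ring.
    move: (p0 k); move: (M1 / _) (2 / H) i2 ((w k)%:R / H) => x1 x2 h2 x3 h3 h1 h5.
    apply: (@le_trans _ _ ((x1 + x2) ^+ 2)); first by rewrite lerXn2r ?nnegrE// addr_ge0.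
    by have := sqr_ge0 (x1 - x2); nra.
  rewrite big_split /= -mulr_sumr sumr_const_nat subn0; apply: lerD.
    rewrite big_mkord; have := sum_inv_sqr n; have := sqr_ge0 M1.
    by move: (M1 ^+ 2) (\sum_(_ < _) _) => x1 x2; nra.
  rewrite -[leLHS]mulr_natr; have -> : 2 * (2 / H) ^+ 2 * n%:R = 8 * (n%:R / H) / H.
    by rewrite expr_div_n; field; rewrite gt_eqF.
  have n1 : n%:R / H <= 1 by rewrite ler_pdivrMr// mul1r.
  have n0 : 0 <= n%:R / H by rewrite divr_ge0.
  have H1 : 1 <= H by rewrite ler1n.
  rewrite ler_pdivrMr//; move: (n%:R / H) n1 n0 H1; move: (H) => x1 x2; nra.
pose B := if (j * n <= h.+1)%N then n else (block_factor * scale j)%N.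
have lin : \sum_(m <= k < n) (if (j < w k)%N then (w k)%:R / H else 0) <= L B + 2.
  apply: (@le_trans _ _ (\sum_(0 <= k < n) ((if (k < B)%N then l k else 0) + 2 / H))).
    rewrite [leRHS](@big_cat_nat _ _ _ m 0 n)//= -[leLHS]add0r; apply: lerD.
      by apply: sumr_ge0 => k _; rewrite addr_ge0//; case: ifP => // _; exact: ltW.
    rewrite big_nat_cond [leRHS]big_nat_cond; apply: ler_sum => k /andP[/andP[mk kn] _].
    case: ifPn => [jwk|_]; last by rewrite addr_ge0//; case: ifP => // _; exact: ltW.
    have -> : (k < B)%N.
      rewrite /B; case: (leqP (j * n) h.+1) => // jn; exact: close_arcs.
    exact: pk.
  rewrite big_split /=; apply: lerD.
    rewrite big_mkord -big_mkcond /=.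
    have [Bn|nB] := leqP B n; first by rewrite /partial_sum -big_ord_widen.
    apply: (@le_trans _ _ (L n)); last exact: partial_sum_homo (ltnW nB).
    rewrite /partial_sum big_mkcond /=; apply: ler_sum => k _.
    by case: ifP => // _; exact: ltW.
  rewrite sumr_const_nat subn0 -[leLHS]mulr_natl mulrCA ger_pMr//.
  by rewrite ler_pdivrMr// mul1r.
have LB : L B <= L (scale j) + block_factor%:R * M1.
  have b0 : 0 <= block_factor%:R * M1 by rewrite mulr_ge0// ltW.
  rewrite /B /scale; case: (leqP (j * n) h.+1) => jn; first by rewrite lerDl.
  have jH : (j <= h.+1)%N by rewrite ltnW// (leq_trans jw)// outer_width_ltH.
  by apply: partial_sum_mul => //; rewrite divn_gt0//; lia.
apply: (@le_trans _ _ (\sum_(m <= k < n) ((if (j < w k)%N then (w k)%:R / H else 0) +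
    6 * ((w k)%:R / H) ^+ 2))).
  apply: ler_sum => k _; case: (j < w k)%N; first by [].
  by rewrite add0r mulr_ge0 ?sqr_ge0.
rewrite big_split /= -mulr_sumr /exponent_const.
move: lin LB sq; move: (L B) (L (scale j)) (block_factor%:R * M1) (M1 ^+ 2).
move=> x1 x2 x3 x4 h1 h2 h3.
by apply: (le_trans (lerD h1 (ler_wpM2l _ h3))); lra.
Qed.

End fixed_scale.

Lemma sum_interval_le (a b w : nat) : (\sum_(j < w) (a < j <= b) <= b - a)%N.
Proof.
(* The second bound [w.-1 - a] makes the induction on [w] work. *)
suff : (\sum_(j < w) (a < j <= b) <= minn (w.-1 - a) (b - a))%N.
  by move/leq_trans; apply; exact: geq_minr.
elim: w => [|w IH]; first by rewrite big_ord0.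
rewrite big_ord_recr /=; move: IH; set c := (\sum_(_ < _) _)%N => IH.
by case: (boolP (a < w <= b)%N) => /= hw; rewrite ?addn1 ?addn0; lia.
Qed.

Variables (J0 : nat) (e0 : R).
Hypothesis J02 : (2 <= J0)%N.
Hypothesis tail : forall N, \sum_(J0 <= J < N) expo J <= e0.

(** On [[n, 2 n)] the terms are at least [expo n / 8], since [L] increases, [k ^ 2 <= 4 n ^ 2] and
    [ln k <= 2 ln n]. This serves the distances below [h.+1 / n], which all have the scale [n]. *)
Lemma expo_le_tail n : (J0 <= n)%N -> n%:R * expo n <= 8 * e0.
Proof.
move=> Jn; have n2 : (2 <= n)%N by exact: leq_trans Jn.
have nr : 2 <= n%:R :> R by rewrite ler_nat.
have ln0 : 0 < ln n%:R :> R by rewrite ln_gt0// ltr1n.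
have n1 : 0 < n%:R :> R by lra.
apply: (@le_trans _ _ (8 * \sum_(n <= k < 2 * n) expo k)); last first.
  rewrite ler_pM2l//; apply: le_trans (tail (2 * n)).
  rewrite [leRHS](@big_cat_nat _ _ _ n)//=; last by lia.
  by rewrite lerDr sumr_ge0// => k _; exact: expo_ge0.
rewrite -ler_pdivrMl//; apply: (@le_trans _ _ (\sum_(n <= k < 2 * n) 8^-1 * expo n)).
  rewrite sumr_const_nat -[leRHS]mulr_natl (_ : (2 * n - n = n)%N); last by lia.
  by apply: le_of_eq; ring.
rewrite big_nat_cond [leRHS]big_nat_cond; apply: ler_sum => k /andP[/andP[nk kn] _].
have kr : n%:R <= k%:R :> R by rewrite ler_nat.
have kr2 : k%:R <= 2 * n%:R :> R by rewrite -natrM ler_nat ltnW.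
have lnk0 : 0 < ln k%:R :> R by rewrite ln_gt0// ltr1n; lia.
have lnk : ln k%:R <= 2 * ln n%:R :> R.
  apply: (@le_trans _ _ (ln (2 * n%:R))); first by rewrite ler_ln ?posrE//; lra.
  rewrite lnM ?posrE//; have : ln 2 <= ln n%:R :> R by rewrite ler_ln ?posrE.
  by move: (ln 2) (ln n%:R) => x1 x2; lra.
have k0 : 0 < k%:R :> R by lra.
rewrite mulrC ler_pdivrMr// /expo [leRHS]mulrAC ler_pdivlMr ?mulr_gt0 ?exprn_gt0//.
rewrite [leLHS]mulrAC ler_pdivrMr ?mulr_gt0 ?exprn_gt0//.
have Ln : expR (L n) <= expR (L k) by rewrite ler_expR; exact: partial_sum_homo.
have k4 : k%:R ^+ 2 <= 4 * n%:R ^+ 2 :> R.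
  have -> : 4 * n%:R ^+ 2 = (2 * n%:R) ^+ 2 :> R by ring.
  by rewrite lerXn2r ?nnegrE// ltW//; lra.
apply: (@le_trans _ _ (expR (L k) * (4 * n%:R ^+ 2 * (2 * ln n%:R)))).
  by apply: ler_pM; rewrite ?expR_ge0 ?mulr_ge0 ?sqr_ge0 ?(ltW lnk0)//; apply: ler_pM; rewrite ?sqr_ge0 ?(ltW lnk0).
by apply: le_of_eq; ring.
Qed.

Section fixed_scale_bound.
Variables (m n h : nat).
Hypothesis Jn : (J0 <= n)%N.
Hypothesis mn : (m <= n)%N.
Hypothesis hn : (h.+1 = 4 * n ^ 2)%N.
Hypothesis lm : l m * J0%:R <= 1 / 2.
Local Notation H := (h.+1%:R : R).
Local Notation w := (outer_width m h).
Local Notation scale := (scale n h).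

Let n2 : (2 <= n)%N. Proof. exact: leq_trans Jn. Qed.

Let nn : (2 * n <= n ^ 2)%N. Proof. by rewrite expnS expn1 leq_mul2r n2 orbT. Qed.

Let H0 : 0 < H. Proof. by rewrite ltr0n. Qed.

(** The arcs from [m] on occupy at most a fraction [1 / J0] of the circle, so only scales [J >= J0]
    occur, and only the tail of the series enters. *)
Lemma outer_width_scale : (w m * J0 <= h.+1)%N.
Proof.
rewrite -(ler_nat R) natrM.
apply: (@le_trans _ _ ((H * l m + 2) * J0%:R)).
  by rewrite ler_wpM2r//; exact: outer_width_le.
have Jr : J0%:R * 4 <= H by rewrite -natrM ler_nat hn; lia.
rewrite mulrDl -mulrA; have := ler_wpM2l (ltW H0) lm.
by move: Jr; move: (_ * (l m * _)) => x1; lra.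
Qed.

Lemma outer_width_half k : (m <= k)%N -> (2 * w k <= h.+1)%N.
Proof.
move=> mk; apply: leq_trans outer_width_scale.
by rewrite mulnC; apply: leq_mul => //; exact: outer_width_decr.
Qed.

(** Up to constants, the weight of one distance of scale [J]. About [h.+1 / J ^ 2] distances have
    this scale, which turns the weights into [h.+1] times the terms of the series. *)
Definition scaled_exp (J : nat) : R := J%:R ^+ 2 * expo J.

Lemma scaled_exp_ge0 J : 0 <= scaled_exp J.
Proof. by rewrite mulr_ge0 ?sqr_ge0 ?expo_ge0. Qed.

Lemma sum_scaled_exp_short :
  \sum_(j < w m | (j * n <= h.+1)%N) scaled_exp (scale j) <= 16 * H * e0.
Proof.
have n0 : 0 < n%:R :> R by rewrite ltr0n; lia.
apply: (@le_trans _ _ (\sum_(j < w m) ((0 < j.+1 <= (h.+1 %/ n).+1)%N%:R * scaled_exp n))).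
  rewrite big_mkcond /=; apply: ler_sum => j _; rewrite /scale.
  case: ifP => jn; first by rewrite ltnS leq_divRL ?jn ?mul1r//; lia.
  by rewrite mulr_ge0 ?scaled_exp_ge0.
rewrite -mulr_suml.
have c : \sum_(j < w m) (0 < j.+1 <= (h.+1 %/ n).+1)%N%:R <= 2 * H / n%:R :> R.
  rewrite -natr_sum; apply: (@le_trans _ _ ((h.+1 %/ n).+1)%:R).
    rewrite ler_nat; have := sum_interval_le 0 (h.+1 %/ n).+1 (w m).+1.
    by rewrite big_ord_recl subn0.
  rewrite -natr1 mulr2n mulrDl mul1r mulrDl; apply: lerD; first by apply: natr_divn_le; lia.
  by rewrite ler_pdivlMr// mul1r ler_nat hn; lia.
apply: (le_trans (ler_wpM2r (scaled_exp_ge0 n) c)); rewrite /scaled_exp.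
have -> : 2 * H / n%:R * (n%:R ^+ 2 * expo n) = 2 * H * (n%:R * expo n).
  by field; rewrite gt_eqF.
have -> : 16 * H * e0 = 2 * H * (8 * e0) by ring.
by rewrite ler_pM2l ?mulr_gt0//; exact: expo_le_tail.
Qed.

(** Two consecutive quotients differ by at most [h.+1 / J ^ 2 + 1]; the rounding error 1 is absorbed
    because [J ^ 2 <= n ^ 2 <= h.+1]. *)
Lemma count_scale J : (0 < J < n)%N ->
  (\sum_(j < w m) (h.+1 %/ J.+1 < j <= h.+1 %/ J))%N%:R <= 2 * H / J%:R ^+ 2.
Proof.
move=> /andP[J1 JN]; have Jr : 0 < J%:R :> R by rewrite ltr0n.
have Jr1 : 0 < J.+1%:R :> R by rewrite ltr0n.
apply: (@le_trans _ _ (h.+1 %/ J - h.+1 %/ J.+1)%:R); first by rewrite ler_nat sum_interval_le.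
rewrite natrB; last by apply: leq_div2l.
have a1 : (h.+1 %/ J)%:R <= H / J%:R by exact: natr_divn_le.
have a2 : H / J.+1%:R <= (h.+1 %/ J.+1)%:R + 1.
  by rewrite ler_pdivrMr// natr1 -natrM ler_nat ltnW// ltn_ceil.
have a3 : H / J%:R - H / J.+1%:R <= H / J%:R ^+ 2.
  rewrite -mulrBr ler_pM2l// -[J.+1%:R]natr1.
  have -> : J%:R^-1 - (J%:R + 1)^-1 = (J%:R * (J%:R + 1))^-1 :> R.
    by field; rewrite natr1 !gt_eqF.
  by rewrite lef_pV2 ?posrE ?mulr_gt0 ?exprn_gt0 ?natr1// expr2 ler_pM2l// ler_nat.
have a4 : 1 <= H / J%:R ^+ 2.
  rewrite ler_pdivlMr ?exprn_gt0// mul1r -natrX ler_nat hn.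
  by apply: (@leq_trans (n ^ 2)); [rewrite leq_exp2r// ltnW|lia].
rewrite -mulrA; move: a1 a2 a3 a4; move: (H / J%:R) (H / J.+1%:R) (H / J%:R ^+ 2) (h.+1 %/ J)%:R (h.+1 %/ J.+1)%:R.
by move=> x1 x2 x3 x4 x5; lra.
Qed.

Lemma sum_scaled_exp_long :
  \sum_(j < w m | ~~ (j * n <= h.+1)%N) scaled_exp (scale j) <= 2 * H * e0.
Proof.
(* The scale [J = h.+1 %/ j] of a long distance lies in [[J0, n)] and satisfies these inequalities;
   exchanging the sums then counts the distances of each scale. *)
apply: (@le_trans _ _ (\sum_(j < w m) \sum_(J0 <= J < n)
    (h.+1 %/ J.+1 < j <= h.+1 %/ J)%N%:R * scaled_exp J)).
  rewrite big_mkcond /=; apply: ler_sum => j _; rewrite /scale.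
  case: ifP => [/negbTE jn|_]; last first.
    by apply: sumr_ge0 => J _; rewrite mulr_ge0 ?scaled_exp_ge0.
  rewrite jn; move/negbT: jn; rewrite -ltnNge => jn.
  have j0 : (0 < j)%N by move: jn; case: (nat_of_ord j).
  have JJ : (J0 <= h.+1 %/ j)%N.
    rewrite leq_divRL//; apply: leq_trans outer_width_scale.
    by rewrite mulnC leq_mul2r ltnW ?orbT.
  have JN : (h.+1 %/ j < n)%N by rewrite ltn_divLR// mulnC.
  rewrite (@big_cat_nat _ _ _ (h.+1 %/ j))//=; last exact: ltnW.
  rewrite ler_wpDl//; first by apply: sumr_ge0 => J _; rewrite mulr_ge0 ?scaled_exp_ge0.
  rewrite big_ltn//=.
  have -> : (h.+1 %/ (h.+1 %/ j).+1 < j <= h.+1 %/ (h.+1 %/ j))%N.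
    rewrite ltn_divLR// mulnC ltn_ceil//= leq_divRL ?leq_trunc_div//; last by lia.
    by rewrite mulnC leq_trunc_div.
  by rewrite mul1r lerDl; apply: sumr_ge0 => J _; rewrite mulr_ge0 ?scaled_exp_ge0.
rewrite exchange_big /=.
apply: (@le_trans _ _ (\sum_(J0 <= J < n) 2 * H * expo J)).
  rewrite big_nat_cond [leRHS]big_nat_cond; apply: ler_sum => J /andP[/andP[J1 JN] _].
  have J0' : (0 < J)%N by lia.
  have Jr : 0 < J%:R :> R by rewrite ltr0n.
  rewrite -mulr_suml -natr_sum.
  apply: (@le_trans _ _ (2 * H / J%:R ^+ 2 * scaled_exp J)).
    by rewrite ler_wpM2r ?scaled_exp_ge0// count_scale ?J0'.
  rewrite /scaled_exp; apply: le_of_eq; field; rewrite gt_eqF//.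
rewrite -mulr_sumr ler_pM2l ?mulr_gt0//.
Qed.

Definition error_const : R := expR (exponent_const) * (1 + 2 / M0).

Context {d : measure_display} {Omega : measurableType d} {P : probability Omega R}.
Variables (C Y : nat -> nat -> {RV P >-> R}).
Hypothesis model : poisson_covering_model l C Y 0.

(** A distance of scale [J] has weight at most [error_const * scaled_exp J]: this uses
    [1 / h.+1 <= 1 / ln J] and [S >= L J >= M0 ln J], the source of the logarithm in the series. The
    constant 72 is [4 (16 + 2)], from the prefactor and the short and long distances. *)
Lemma pr_outer : 1 - 72 * error_const * e0 <=
  pr P [set om | exists x : 'I_h.+1 * 'I_h.+1,
    uncov C Y w (inner_radius l h) m n (x.2%:R / h.+1%:R) x.1 om].
Proof.
pose S j := L (scale j) + exponent_const.
have Cc := exponent_const_gt0.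
have S_gt0 j : 0 < S j by rewrite ltr_wpDl// partial_sum_ge0.
have wH k := outer_width_ltH m h k.
have p_half k : (w k)%:R / H <= 1 / 2.
  have [km|mk] := ltnP k m; first by rewrite /outer_width km mul0r divr_ge0.
  rewrite ler_pdivrMr//; have := outer_width_half mk; rewrite -(ler_nat R) natrM.
  by move: (w k)%:R H => x1 x2; lra.
have S_ge j (jw : (j < w m)%N) := sum_close_arcs n2 mn hn jw.
have H1 := pr_exists_uncov model (inner_radius l h) wH p_half mn (ltn0Sn h).
have H2 := H1 S outer_width_half (fun k => @outer_width_decr m h k).
have H3 := H2 (fun j _ => S_gt0 j) S_ge.
apply: le_trans H3.
rewrite lerD2l lerN2.
have ec0 : 0 < error_const by rewrite mulr_gt0 ?expR_gt0// addr_gt0// divr_gt0.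
apply: (@le_trans _ _ (4 / H * \sum_(j < w m) error_const * scaled_exp (scale j))).
  rewrite ler_pM2l ?divr_gt0//; apply: ler_sum => j _.
  have [J2 JN] : (2 <= scale j)%N /\ (scale j <= n)%N.
    rewrite /scale; case: (leqP (j * n) h.+1) => jn; first by [].
    have j0 : (0 < j)%N by move: jn; case: (nat_of_ord j).
    split; last by rewrite ltnW// ltn_divLR// mulnC.
    rewrite leq_divRL//; apply: leq_trans outer_width_scale.
    by rewrite mulnC leq_mul// ltnW.
  set J := scale j in J2 JN *; rewrite /S -/J.
  have lnJ : 0 < ln J%:R :> R by rewrite ln_gt0// ltr1n.
  have Jr : 0 < J%:R :> R by rewrite ltr0n; lia.
  have -> : error_const * scaled_exp J =
      expR (L J + exponent_const) * ((ln J%:R)^-1 + 2 / (M0 * ln J%:R)).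
    rewrite /error_const /scaled_exp /expo expRD; field.
    by rewrite !gt_eqF.
  rewrite ler_pM2l ?expR_gt0//; apply: lerD.
    rewrite lef_pV2 ?posrE//; apply: (@le_trans _ _ J%:R).
      by rewrite ltW// ln_sublinear.
    by rewrite ler_nat hn; lia.
  rewrite ler_pM2l// lef_pV2 ?posrE ?mulr_gt0//; last exact: S_gt0.
  apply: (@le_trans _ _ (L J)); last by rewrite lerDl ltW.
  apply: le_trans (partial_sum_ge M0_pos l_bounds J).
  by rewrite ler_pM2l// ler_ln ?posrE// ler_nat.
rewrite -mulr_sumr (bigID (fun j : 'I_(w m) => (j * n <= h.+1)%N)) /=.
apply: (@le_trans _ _ (4 / H * (error_const * (16 * H * e0 + 2 * H * e0)))).
  rewrite ler_pM2l ?divr_gt0// ler_pM2l//.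
  exact: lerD sum_scaled_exp_short sum_scaled_exp_long.
by apply: le_of_eq; field; rewrite gt_eqF.
Qed.

End fixed_scale_bound.

End outer_discretisation.

(** * Exceptional times *)

Section outer_geometry.
Context {R : realType} {d : measure_display} {Omega : measurableType d}
  {P : probability Omega R}.
Variables (l : R^nat) (C Y : nat -> nat -> {RV P >-> R}) (M0 M1 : R).
Hypothesis l_pos : forall n, 0 < l n.
Local Notation Pr := (pr P).

(** If [s] is the truncated radius and [c] the cell of the centre, the sites in the arc lie between
    [c - s] and [c + s + 1], which are [2 s + 2] sites. *)
Lemma outer_cov_arc m h k (y : 'I_h.+1) (u : R) : (m <= k)%N -> 0 <= u < 1 ->
  Defs.arc u (l k) (y%:R / h.+1%:R) ->
  cov (outer_width l m h k) (inner_radius l h k) (cell h u) y.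
Proof.
move=> mk u01 [_ [z hz]]; have H0 : 0 < h.+1%:R :> R by rewrite ltr0n.
have := truncnS_gt (h.+1%:R * l k / 2); rewrite -/(inner_radius l h k).
move: hz; rewrite -(ltr_pM2r H0) -[X in `|_| * X](ger0_norm (ltW H0)) -normrM.
have -> : (y%:R / h.+1%:R - u - z%:~R) * h.+1%:R = y%:R - u * h.+1%:R - z%:~R * h.+1%:R.
  by field; rewrite gt_eqF.
have -> : l k / 2 * h.+1%:R = h.+1%:R * l k / 2 by ring.
have := cell_bounds h u01; rewrite ler_pdivrMr// ltr_pdivlMr// -[(cell h u).+1%:R]natr1.
set s := inner_radius l h k => /andP[u1 u2] hz hs.
have [z' ez] := @offsetE R h y (cell h u) s.
rewrite /cov /outer_width ifN -?leqNgt// leq_min ltn_ord andbT.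
set D := nat_of_ord (y - cell h u + inZp s)%R in ez *.
have Dh : D%:R <= h.+1%:R - 1 :> R.
  by rewrite lerBrDr natr1 ler_nat /D ltn_ord.
move: hz; rewrite ltr_norml => /andP[z1 z2].
have zz : z' + z <= 0.
  rewrite leNgt; apply/negP; rewrite gtz0_ge1 => h1.
  rewrite -(ler_int R) mulr1z in h1.
  have : h.+1%:R <= (z' + z)%:~R * h.+1%:R :> R by rewrite ler_peMl// ltW.
  rewrite intrD mulrDl.
  move: ez Dh u1 u2 z1 z2 hs; rewrite -[s.+1%:R]natr1.
  move: (h.+1%:R * l k / 2) (u * h.+1%:R) (z%:~R * h.+1%:R) (z'%:~R * h.+1%:R).
  move: (h.+1%:R).
  move: (D%:R) (s%:R) (y%:R) (cell h u)%:R.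
  by move=> x1 x2 x3 x4 x5 x6 x7 x8 x9; lra.
rewrite -(ler_int R) in zz.
have zr : (z' + z)%:~R * h.+1%:R <= 0 :> R by rewrite pmulr_lle0.
rewrite -(ltr_nat R) natrD natrM; move: zr; rewrite intrD mulrDl.
move: ez u1 u2 z1 z2 hs; rewrite -[s.+1%:R]natr1.
move: (h.+1%:R * l k / 2) (u * h.+1%:R) (z%:~R * h.+1%:R) (z'%:~R * h.+1%:R).
move: (D%:R) (s%:R) (y%:R) (cell h u)%:R.
by move=> x1 x2 x3 x4 x5 x6 x7 x8; lra.
Qed.

(** So many cells that rounding the lengths of [n] arcs changes the exponents by a bounded amount;
    the same mesh serves for the times. *)
Definition outer_mesh (n : nat) : nat := (4 * n ^ 2).-1.

Definition outer_event (m n : nat) : set Omega :=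
  [set om | exists x : 'I_(outer_mesh n).+1 * 'I_(outer_mesh n).+1,
    uncov C Y (outer_width l m (outer_mesh n)) (inner_radius l (outer_mesh n)) m n
      (x.2%:R / (outer_mesh n).+1%:R) x.1 om].

Definition avoiding (m n : nat) (t x : R) (w : Omega) : Prop :=
  [/\ 0 <= t <= 1, 0 <= x < 1 & forall k, (m <= k < n)%N -> ~ moving_arc l C Y k t w x].

Lemma outer_event_avoiding m n w : good C Y w -> outer_event m n w ->
  exists t x, avoiding m n t x w.
Proof.
move=> [reg c01] [[y q] /= hu]; set h := outer_mesh n in y q hu.
have H0 : 0 < h.+1%:R :> R by rewrite ltr0n.
exists (q%:R / h.+1%:R), (y%:R / h.+1%:R); split.
- by rewrite divr_ge0//= ler_pdivrMr// mul1r ler_nat ltnW.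
- by rewrite divr_ge0//= ltr_pdivrMr// mul1r ltr_nat.
- move=> k mkn; have /andP[mk _] := mkn => ak.
  have := hu k mkn; rewrite /state => /negP; apply.
  by apply: outer_cov_arc => //; rewrite -center_jumps.
Qed.

Hypothesis model : poisson_covering_model l C Y 0.

Lemma measurable_outer_event m n : measurable (outer_event m n).
Proof.
apply: (@sig_measurable _ _ _ P _ (resampling_family C Y) (arcs_index [set k | (m <= k < n)%N])).
by apply: sig_exists_fin => x; exact: sig_uncov.
Qed.

Hypothesis l_decr : nonincreasing_seq l.
Hypothesis M0_pos : 0 < M0.
Hypothesis l_bounds : forall n, M0 / n.+1%:R <= l n <= M1 / n.+1%:R.
Hypothesis summable : forall e : R, 0 < e ->
  exists J0, forall N, \sum_(J0 <= J < N) expo l J <= e.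

Lemma outer_event_ge (e : R) : 0 < e ->
  exists m N, forall n, (N <= n)%N -> 1 - e <= Pr (outer_event m n).
Proof.
move=> e0; have M1_pos := M1_gt0 M0_pos l_bounds.
have ec0 : 0 < error_const M0 M1 by rewrite mulr_gt0 ?expR_gt0// addr_gt0// divr_gt0.
have e1 : 0 < e / (72 * error_const M0 M1) by rewrite divr_gt0// mulr_gt0.
have [J hJ] := summable e1.
pose J0 := maxn 2 J.
have tail N : \sum_(J0 <= j < N) expo l j <= e / (72 * error_const M0 M1).
  apply: le_trans (hJ N); have [NJ|JN] := leqP N J0.
    by rewrite big_geq// sumr_ge0// => j _; exact: expo_ge0.
  rewrite [leRHS](@big_cat_nat _ _ _ J0)//=; [|exact: leq_maxr|exact: ltnW].
  by rewrite lerDr sumr_ge0// => j _; exact: expo_ge0.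
(* Large enough for [l m <= M1 / m.+1 <= 1 / (2 J0)]. *)
pose m := Num.truncn (2 * J0%:R * M1).
exists m, (maxn m J0) => n; rewrite geq_max => /andP[mn Jn].
have J2 : (2 <= J0)%N by exact: leq_maxl.
have n0 : (0 < n)%N by lia.
have hn : ((outer_mesh n).+1 = 4 * n ^ 2)%N.
  by rewrite /outer_mesh prednK// muln_gt0 expn_gt0 n0.
have lm : l m * J0%:R <= 1 / 2.
  have /andP[_ lm] := l_bounds m; have m1 : 0 < m.+1%:R :> R by rewrite ltr0n.
  apply: (le_trans (ler_wpM2r (ler0n _ _) lm)).
  rewrite mulrAC ler_pdivrMr// -ler_pdivrMl ?divr_gt0//.
  have := truncnS_gt (2 * J0%:R * M1); rewrite -/m => hm.
  by apply/ltW; apply: le_lt_trans hm; apply: le_of_eq; field.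
apply: le_trans (pr_outer l_pos l_decr M0_pos l_bounds J2 tail Jn mn hn lm model).
rewrite lerD2l lerN2; apply: le_of_eq; field.
by rewrite gt_eqF.
Qed.

(** The grids for different [n] are unrelated, so the events are not monotone; their lim sup still
    has probability at least [1 - e]. Occurring for infinitely many [n] is enough, since avoiding
    more arcs is the stronger property. *)
Lemma negligible_not_avoiding :
  P.-negligible (~` [set w | good C Y w /\
    exists m, forall n, exists t x, avoiding m n t x w]).
Proof.
pose F m := lim_sup_set (outer_event m).
have mU m N : measurable (\bigcup_(n >= N) outer_event m n).
  by apply: bigcup_measurable => n _; exact: measurable_outer_event.
have mF m : measurable (F m) by apply: bigcapT_measurable.
have mFF : measurable (\bigcup_m F m) by apply: bigcupT_measurable.
have F1 : Pr (~` \bigcup_m F m) = 0.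
  apply/eqP; rewrite eq_le pr_ge0 andbT; apply/ler_addgt0Pl => e e0; rewrite addr0.
  have [m [N hN]] := outer_event_ge e0.
  rewrite (@prC _ _ _ P)// lerBlDl -lerBlDr.
  apply: (@le_trans _ _ (Pr (F m))); last by apply: le_pr => // w Fw; exists m.
  have cv : P (\bigcup_(n >= N') outer_event m n) @[N' --> \oo] --> P (F m).
    apply: nonincreasing_cvg_mu => //.
    - by rewrite ltey_eq fin_num_measure.
    - exact: mF.
    - by move=> a b ab; apply/subsetPset => w [n bn] h; exists n => //=; exact: leq_trans ab bn.
  rewrite -lee_fin -prE//; apply: (cvge_to_ge cv).
  apply: nearW => N' /=; rewrite prE// lee_fin.
  apply: (le_trans (hN (maxn N N') (leq_maxl _ _))).
  apply: le_pr => //; first exact: measurable_outer_event.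
  by move=> w ow; exists (maxn N N') => //=; exact: leq_maxr.
have nF : P.-negligible (~` \bigcup_m F m).
  have mC := measurableC mFF; exists (~` \bigcup_m F m); split => //.
  by apply: etrans (prE mC) _; rewrite F1.
apply: negligibleS (negligibleU (negligible_not_good model) nF) => w nw.
apply: contrapT => /not_orP[/contrapT gw /contrapT [m _ Fw]]; apply: nw; split => //.
exists m => N; have [n /= Nn ow] := Fw N Logic.I.
have [t [x [t01 x01 av]]] := outer_event_avoiding gw ow.
exists t, x; split => // k /andP[mk kN]; apply: av; rewrite mk /=.
exact: leq_trans kN Nn.
Qed.

End outer_geometry.

Section simultaneous_jumps.
Context {R : realType} {d : measure_display} {Omega : measurableType d}
  {P : probability Omega R}.
Variables (l : R^nat) (C Y : nat -> nat -> {RV P >-> R}).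
Hypothesis model : poisson_covering_model l C Y 0.
Local Notation Pr := (pr P).
Local Notation X := (resampling_family C Y).
Local Notation T := (resample_time Y).

Lemma pr_Y_itv_le i j (x y : R) : 0 <= x <= y -> Pr (Y i j @^-1` `]x, y]) <= y - x.
Proof.
move=> /andP[x0 xy]; have y0 := le_trans x0 xy.
have mI (I : interval R) : measurable (Y i j @^-1` [set` I]).
  by apply: measurable_rv; exact: measurable_itv.
have e : Pr (Y i j @^-1` `]-oo, y]) = Pr (Y i j @^-1` `]-oo, x]) + Pr (Y i j @^-1` `]x, y]).
  rewrite -(@prU _ _ _ P) => //.
    congr (pr _ _); apply/seteqP; split => w /=; rewrite !in_itv /=.
      by move=> wy; case: (leP (Y i j w) x) => wx; [left|right].
    by move=> [wx|/andP[]//]; exact: le_trans wx xy.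
  apply/seteqP; split => w //= []; rewrite !in_itv /= => h1 /andP[h2 _].
  by move: h2; rewrite ltNge h1.
move: e; rewrite !(Y_le model)// => e.
have : expR (- x) - expR (- y) <= y - x.
  have -> : - y = - x + - (y - x) by ring.
  rewrite expRD -[X in X - _]mulr1 -mulrBr.
  have e1 : expR (- x) <= 1 by rewrite -[leRHS]expR0 ler_expR oppr_le0.
  have e2 : 1 - expR (- (y - x)) <= y - x by have := le_oneB_expR (y - x); lra.
  apply: le_trans e2; rewrite ler_piMl// subr_ge0 -[leRHS]expR0 ler_expR oppr_le0 subr_ge0//.
by move: e; move: (Pr _) (expR _) (expR _) => x1 x2 x3; lra.
Qed.

(** Contains the closed cell in the form []x, y]] required by [pr_Y_itv_le]; starting one cell
    earlier includes the left end. *)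
Definition cell_cover h (c : 'I_h.+1) : interval R :=
  Interval (if c == ord0 then -oo%O else BRight (c.-1%:R / h.+1%:R))
           (BRight (c.+1%:R / h.+1%:R)).

Lemma mem_cell_cover h (u : R) : 0 <= u <= 1 -> u \in cell_cover (cell h u).
Proof.
have H0 : 0 < h.+1%:R :> R by rewrite ltr0n.
move=> /andP[u0 u1].
have /andP[c1 c2] : (cell h u)%:R / h.+1%:R <= u <= (cell h u).+1%:R / h.+1%:R.
  move: u1; rewrite le_eqVlt => /predU1P[->|u1]; last first.
    by have /andP[-> /ltW ->] := @cell_bounds R h u (introT andP (conj u0 u1)).
  have -> : (@cell R h 1 : nat) = h.
    rewrite /cell mul1r natrK; rewrite (minn_idPl _)//; exact: inordK.
  by rewrite divff ?gt_eqF// lexx ler_pdivrMr// mul1r ler_nat leqnSn.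
rewrite in_itv /= c2 andbT; case: eqP => [//|/eqP cn] /=.
apply: lt_le_trans c1; rewrite ltr_pM2r ?invr_gt0// ltr_nat.
by rewrite prednK// lt0n.
Qed.

Lemma pr_cell_cover i j h (c : 'I_h.+1) :
  Pr (Y i j @^-1` [set` cell_cover c]) <= 2 / h.+1%:R.
Proof.
have H0 : 0 < h.+1%:R :> R by rewrite ltr0n.
rewrite /cell_cover; case: eqP => [->|/eqP cn].
  have e1 (x : R) : 1 - expR (- x) <= x by have := le_oneB_expR x; lra.
  rewrite (Y_le model) ?divr_ge0//; apply: (le_trans (e1 _)).
  by rewrite ler_pM2r ?invr_gt0// ler_nat.
apply: le_trans (pr_Y_itv_le _ _ _) _.
  by rewrite divr_ge0//= ler_pM2r ?invr_gt0// ler_nat; lia.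
rewrite -mulrBl ler_pM2r ?invr_gt0// -natrB; last by lia.
by rewrite ler_nat; lia.
Qed.

(** If [Y i j = f], both lie in the same cell, up to its boundary; by independence this has
    probability at most [2 / h.+1], whatever the law of [f]. *)
Lemma negligible_meet S i j (f : Omega -> R) : ~ S (inr (i, j)) ->
  (forall B, measurable B -> sig X S (f @^-1` B)) ->
  P.-negligible [set w | 0 <= Y i j w <= 1 /\ Y i j w = f w].
Proof.
move=> Sij sf.
pose D h (c : 'I_h.+1) := Y i j @^-1` [set` cell_cover c].
pose F h (c : 'I_h.+1) := f @^-1` (@cell R h @^-1` [set c]).
have sF h c : sig X S (F h c) by apply: sf; exact: measurable_cell.
have sD h c : sig X [set inr (i, j)] (D h c).
  by apply: (@sig_preimage _ _ _ P _ X _ (inr (i, j))) => //; exact: measurable_itv.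
have mF h c : measurable (F h c) := sig_measurable (sF h c).
have mD h c : measurable (D h c) := sig_measurable (sD h c).
pose U h := [set w | exists c, (D h c `&` F h c) w].
have mU h : measurable (U h).
  apply: (@sig_measurable _ _ _ P _ X setT); apply: sig_exists_fin => c.
  by apply: sigI; apply: (sig_sub (@subsetT _ _)); [exact: sD|exact: sF].
have U2 h : Pr (U h) <= 2 / h.+1%:R.
  have H0 : 0 < h.+1%:R :> R by rewrite ltr0n.
  rewrite -[U h]setIT; have := @pr_fibres _ _ _ P 'I_h.+1 (fun w => cell h (f w)) (U h) (mU h) (mF h) predT.
  rewrite (_ : [set w | predT _] = setT); last by apply/seteqP.
  move=> ->; have := @pr_fibres _ _ _ P 'I_h.+1 (fun w => cell h (f w)) setT measurableT (mF h) predT.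
  rewrite (_ : [set w | predT _] = setT); last by apply/seteqP.
  rewrite setIT prT => e; rewrite -[leRHS]mulr1 [X in _ <= _ * X]e mulr_sumr; apply: ler_sum => c _.
  rewrite setTI; apply: (@le_trans _ _ (Pr (D h c `&` F h c))).
    apply: le_pr; [exact: measurableI (mU h) (mF h c)|exact: measurableI (mD h c) (mF h c)|].
    move=> w [[c' [Dc Fc']] Fc]; have e' : c' = c := etrans (esym Fc') Fc.
    by rewrite -e'.
  rewrite (sig_indep (@family_indep _ _ _ _ _ _ _ model) _ (sD h c) (sF h c)); last first.
    by apply/seteqP; split => k // [/= ->].
  apply: ler_wpM2r; first exact: pr_ge0. exact: pr_cell_cover.
have mI : measurable (\bigcap_h U h) by exact: bigcapT_measurable.
exists (\bigcap_h U h); split => //; last first.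
  move=> w /= [Y01 Yf] h _; exists (cell h (f w)); split => //.
  by rewrite /D /= Yf; apply: mem_cell_cover; rewrite -Yf.
apply: etrans (prE mI) _; congr _%:E; apply/eqP; rewrite eq_le pr_ge0 andbT.
apply/ler_addgt0Pl => e e0; rewrite addr0.
apply: (@le_trans _ _ (Pr (U (Num.truncn (2 / e))))).
  by apply: le_pr => // w; apply.
apply: (le_trans (U2 _)); rewrite ler_pdivrMr ?ltr0n// -ler_pdivrMl//.
by rewrite mulrC ltW// truncnS_gt.
Qed.

(** The index [j.+1] skips the common starting time 0, which is not a resampling. *)
Definition no_simultaneous_jump : set Omega :=
  [set w | forall i i' j j', i != i' -> T i j.+1 w <= 1 -> T i j.+1 w <> T i' j'.+1 w].

(** A coincidence means [Y i j = T i' j'.+1 - T i j], where the right side does not involve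
    [Y i j]. *)
Lemma negligible_simultaneous_jump :
  P.-negligible (~` [set w | good C Y w /\ no_simultaneous_jump w]).
Proof.
pose f i i' j j' w := T i' j'.+1 w - T i j w.
pose N i i' j j' := [set w | i != i' /\ 0 <= Y i j w <= 1 /\ Y i j w = f i i' j j' w].
have nN i i' j j' : P.-negligible (N i i' j j').
  have [<-|ii'] := eqVneq i i'.
    by apply: negligibleS (negligible_set0 P) => w []; rewrite eqxx.
  pose S := ~` [set (inr (i, j) : (nat * nat + nat * nat)%type)].
  have : P.-negligible [set w | 0 <= Y i j w <= 1 /\ Y i j w = f i i' j j' w].
    apply: (@negligible_meet S); first by apply.
    pose Om := g_sigma_algebraType (cylinders X S).
    suff m : measurable_fun [set: Om] (f i i' j j' : Om -> R).
      by move=> B mB; have := m measurableT B mB; rewrite setTI.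
    have s1 B : measurable B -> sig X S (T i' j'.+1 @^-1` B).
      move=> mB; have h := @sig_resample_time _ _ _ _ C Y i' j'.+1 0 B mB.
      apply: (sig_sub _ h); move=> [] [a b] //= [-> _] [ei _].
      by move: ii'; rewrite ei eqxx.
    have s2 B : measurable B -> sig X S (T i j @^-1` B).
      move=> mB; have h := @sig_resample_time _ _ _ _ C Y i j 0 B mB.
      apply: (sig_sub _ h); move=> [] [a b] //= [_ bj] [_ ej].
      by move: bj; rewrite ej ltnn.
    by apply: measurable_funB => _ B mB; rewrite setTI; [exact: s1|exact: s2].
  by apply: negligibleS => w [].
have nU : P.-negligible (\bigcup_i \bigcup_i' \bigcup_j \bigcup_j' N i i' j j').
  by do 4 (apply: negligible_bigcup => ?).
apply: negligibleS (negligibleU (negligible_not_good model) nU) => w nw.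
apply: contrapT => /not_orP[/contrapT gw nu]; apply: nw; split => //.
move=> i i' j j' ii' T1 TT; apply: nu.
exists i => //; exists i' => //; exists j => //; exists j' => //; split => //.
have [reg _] := gw; have [Y0 _] := reg i.
split; last by rewrite /f -TT resample_timeS addrC addKr.
rewrite Y0 /=; apply: le_trans T1; rewrite resample_timeS lerDr.
exact: resample_time_ge0.
Qed.

End simultaneous_jumps.

Section persistence.
Context {R : realType} {d : measure_display} {Omega : measurableType d}
  {P : probability Omega R}.
Variables (l : R^nat) (C Y : nat -> nat -> {RV P >-> R}).
Local Notation T := (resample_time Y).

Lemma cluster_unit_square (z : nat -> R * R) :
  (forall N, 0 <= (z N).1 <= 1) -> (forall N, 0 <= (z N).2 <= 1) ->
  exists p : R * R, [/\ 0 <= p.1 <= 1, 0 <= p.2 <= 1 &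
    forall (e : R) N0, 0 < e -> exists2 N, (N0 <= N)%N &
      `|p.1 - (z N).1| < e /\ `|p.2 - (z N).2| < e].
Proof.
move=> z1 z2.
have Fz : ProperFilter (z @ \oo) by apply: fmap_proper_filter.
have Fsq : (z @ \oo) (`[0, 1]%classic `*` `[0, 1]%classic).
  by exists 0%N => // N _; split; rewrite /= in_itv /=; [exact: z1|exact: z2].
have [p [[p1 p2] cp]] :=
  compact_setX (@segment_compact R 0 1) (@segment_compact R 0 1) Fz Fsq.
exists p; split; [by move: p1; rewrite /= in_itv|by move: p2; rewrite /= in_itv|].
move=> e N0 e0.
have Fz' : (z @ \oo) [set y | exists2 N, (N0 <= N)%N & z N = y].
  by exists N0 => // N NN; exists N.
have [_ [[N NN <-] [b1 b2]]] := cp _ _ Fz' (nbhsx_ballx p e e0).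
by exists N.
Qed.

Lemma jumps_locally_constant i t w : 0 <= t -> regular Y i w ->
  (forall j, T i j.+1 w <> t) ->
  exists2 e : R, 0 < e & forall t', 0 <= t' -> `|t - t'| < e ->
    jumps Y i t' w = jumps Y i t w.
Proof.
move=> t0 r nt; have [j aj] := regular_at_index t0 r.
have /(at_indexE t j r)/andP[jt tj] := aj.
rewrite (jumps_at aj).
suff [e e0 he] : exists2 e : R, 0 < e & forall t', 0 <= t' -> `|t - t'| < e -> T i j w <= t' < T i j.+1 w.
  by exists e => // t' t'0 tt'; apply: jumps_at; apply/(at_indexE _ _ r); exact: he.
(* For [j = 0] the lower bound is 0, which every admissible [t'] satisfies, even if [t = 0]. *)
have [j0|j0] := posnP j.
  exists (T i j.+1 w - t); first by rewrite subr_gt0.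
  move=> t' t'0; rewrite ltr_norml => /andP[h1 h2]; rewrite j0 resample_time0 t'0 /= -j0.
  by move: h1; lra.
have tj' : T i j w < t.
  rewrite lt_neqAle jt andbT; apply/eqP; rewrite -(prednK j0); exact: nt.
exists (Num.min (T i j.+1 w - t) (t - T i j w)); first by rewrite lt_min !subr_gt0 tj tj'.
move=> t' _; rewrite lt_min !ltr_norml => /andP[/andP[h1 h2] /andP[h3 h4]].
by apply/andP; split; lra.
Qed.

Lemma avoiding_uncovered m w : good C Y w -> no_simultaneous_jump Y w ->
  (forall n, exists t x, avoiding l C Y m n t x w) ->
  exists t : R, 0 <= t <= 1 /\ uncovered l C Y t w !=set0.
Proof.
move=> [reg c01] nsj /choice[tt] /choice[xx av].
have [|n|p [t01 x01 cl]] := @cluster_unit_square (fun n => (tt n, xx n)).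
- by move=> n; have [] := av n.
- by have [_ /andP[h1 h2] _] := av n; rewrite h1 ltW.
pose t := p.1; have t0 : 0 <= t by case/andP: t01.
exists t; split => //.
(* The limit point may be 1, which represents the point 0 of the circle; then [z = 1]. *)
have [z [x x01' xz]] : exists (z : int), exists2 x : R, 0 <= x < 1 & p.2 = x + z%:~R.
  move: x01 => /andP[x0]; rewrite le_eqVlt => /predU1P[->|x1].
    by exists 1, 0; rewrite ?add0r// lexx ltr01.
  by exists 0, p.2; rewrite ?x0 ?addr0.
(* If the open arc contained [x] at time [t], it would also contain the nearby points [xx N] at the
   nearby times [tt N], when it is in the same position. *)
have far k : (m <= k)%N -> (forall j, T k j.+1 w <> t) -> ~ moving_arc l C Y k t w x.
  move=> mk nt [_ [z' hz']].
  have [e e0 he] := jumps_locally_constant t0 (reg k) nt.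
  set r := `|_| in hz'; have r0 : 0 < Num.min e (l k / 2 - r) by rewrite lt_min e0 subr_gt0.
  have [N kN [d1 d2]] := cl _ k.+1 r0; have [/andP[tN0 _] xN01 /(_ k)] := av N.
  rewrite mk kN => /(_ isT); apply; split; first by rewrite /circle /= in_itv.
  exists (z' + z); move: d1 d2; rewrite !lt_min => /andP[d1 _] /andP[_ d2].
  have -> : Defs.center C Y k (tt N) w = Defs.center C Y k t w.
    by rewrite !center_jumps// he.
  have : `|xx N - p.2| < l k / 2 - r by rewrite distrC.
  have -> : xx N - Defs.center C Y k t w - (z' + z)%:~R =
      (xx N - p.2) + (x - Defs.center C Y k t w - z'%:~R).
    by rewrite xz intrD; ring.
  move=> h; apply: (le_lt_trans (ler_normD _ _)); rewrite -/r.
  by move: h; rewrite ltrBrDr.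
exists x; split; first by rewrite /circle /= in_itv.
(* At most one arc [k0] is resampled exactly at time [t]; starting from [k0.+1] discards it. *)
have [n hn] : exists n, forall k, (n <= k)%N -> forall j, T k j.+1 w <> t.
  have [[k0 [j0 e0]]|nk] := pselect (exists k0 j0, T k0 j0.+1 w = t); last first.
    by exists 0%N => k _ j e; apply: nk; exists k, j.
  exists k0.+1 => k k0k j e; apply: (nsj k0 k j0 j _ _ _); rewrite ?e ?e0//.
  - by rewrite neq_ltn k0k.
  - by case/andP: t01.
move=> /(_ (maxn m n) Logic.I) [k /=]; rewrite geq_max => /andP[mk nk].
by apply: far => //; exact: hn.
Qed.

End persistence.

Lemma limn_einf_frequently (R : realType) (u : R^nat) :
  (limn_einf (fun n => (u n)%:E) < +oo)%E ->
  exists c, forall N, exists2 n, (N <= n)%N & u n <= c.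
Proof.
move=> h; have [c hc] : exists c : R, (limn_einf (fun n => (u n)%:E) < c%:E)%E.
  case: (limn_einf _) h => [r _|//|_]; last by exists 0; exact: ltNyr.
  by exists (r + 1); rewrite lte_fin ltrDl.
exists c => N; apply: contrapT => nN; move: hc; rewrite ltNge => /negP; apply.
rewrite limn_einf_lim; apply: lime_ge; first exact: is_cvg_einfs.
near=> n; apply: le_ereal_inf_tmp => _ [k /= nk <-].
rewrite lee_fin leNgt; apply/negP => /ltW uk; apply: nN; exists k => //.
by apply: leq_trans nk; near: n; exact: nbhs_infty_ge.
Unshelve. all: by end_near. Qed.

Lemma nneseries_small_tails (R : realType) (a : R^nat) m : (forall n, 0 <= a n) ->
  (\sum_(m <= n <oo) (a n)%:E < +oo)%E ->
  forall e : R, 0 < e -> exists J, forall N, \sum_(J <= n < N) a n <= e.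
Proof.
move=> a0 fin e e0.
have fin' : (\sum_(m <= n <oo) (a n)%:E)%E \is a fin_num.
  by rewrite ge0_fin_numE// nneseries_ge0// => n _ _; rewrite lee_fin.
pose S := [set \sum_(m <= n < k) a n | k in [set: nat]].
have S_sup : has_sup S.
  split; first by exists (\sum_(m <= n < 0) a n), 0%N.
  exists (fine (\sum_(m <= n <oo) (a n)%:E)%E) => _ [k _ <-].
  rewrite -lee_fin fineK// -sumEFin; apply: nneseries_lim_ge => n _ _.
  by rewrite lee_fin.
have [_ [J _ <-] hJ] := sup_adherent e0 S_sup.
exists (maxn m J) => N; have [JN|NJ] := leqP (maxn m J) N; last first.
  by rewrite big_geq; [exact: ltW|exact: ltnW].
have : \sum_(m <= n < N) a n <= sup S by apply: sup_upper_bound => //; exists N.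
rewrite (@big_cat_nat _ _ _ (maxn m J))//= ?leq_maxl//.
have : \sum_(m <= n < J) a n <= \sum_(m <= n < maxn m J) a n.
  have [Jm|mJ] := leqP J m; first by rewrite big_geq// sumr_ge0.
  by [].
by move: hJ; move: (sup S) (\sum_(_ <= _ < _) _) (\sum_(_ <= _ < _) _) (\sum_(_ <= _ < _) _) => x1 x2 x3 x4; lra.
Qed.

Theorem theorem1p6 (R : realType) (d : measure_display)
    (Omega : measurableType d) (P : probability Omega R)
    (l : R^nat) (M0 M1 : R) (C Y : nat -> nat -> {RV P >-> R})
    (l_pos : forall n, 0 < l n)
    (l_decr : nonincreasing_seq l)
    (l_cvg0 : l n @[n --> \oo] --> (0 : R))
    (M0_pos : 0 < M0) (M0_le_M1 : M0 <= M1)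
    (l_bounds : forall n, M0 / n.+1%:R <= l n <= M1 / n.+1%:R)
    (model : poisson_covering_model l C Y 0) :
  (l 0%N <= 1 / 2 ->
   (limn_einf (fun n => (n%:R * ln n%:R * gap_product l n)%:E) < +oo)%E ->
   P.-negligible [set w | exists t : R,
     0 <= t <= 1 /\ uncovered l C Y t w !=set0]) /\
  ((\sum_(2 <= n <oo)
      (expR (\sum_(k < n) l k) / (n%:R ^+ 2 * ln n%:R))%:E < +oo)%E ->
   {ae P, forall w, exists t : R,
     0 <= t <= 1 /\ uncovered l C Y t w !=set0}).
Proof.
split=> [l_half /limn_einf_frequently[c hc]|summable].
  by have := negligible_uncovered model l_pos l_decr M0_pos l_bounds l_half hc.
have tails := nneseries_small_tails (expo_ge0 l) summable.
apply: negligibleS (negligibleU (negligible_simultaneous_jump model)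
  (negligible_not_avoiding l_pos model l_decr M0_pos l_bounds tails)) => w nw.
apply: contrapT => /not_orP[/contrapT[gw nsj] /contrapT[_ [m av]]]; apply: nw.
exact: avoiding_uncovered gw nsj av.
Qed.
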